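(* Let $h(t)=(t+r)^ke^{-\alpha t}$, $t>0$, where $\alpha\in\mathbb{R}$, $r\ge0$, $k\in\mathbb{R}$. If $k\in\mathbb{R}\setminus\mathbb{Z}_+$, then the sigma-function of $h$ is $$\sigma(\lambda)=\frac{1}{\Gamma(-k)}(\lambda-\alpha)_+^{-k-1}e^{-r(\lambda-\alpha)}.$$ If $k\in\mathbb{Z}_+$, then it is $$\sigma(\lambda)=\delta^{(k)}(\lambda-\alpha)\,e^{-r(\lambda-\alpha)}.$$
   Context: $\mathbb{R}_+=(0,\infty)$, $\mathbb{Z}_+=\{0,1,2,\dots\}$. For a space of test functions $X$, $X'$ denotes the space of continuous antilinear functionals on $X$; $\langle h,F\rangle$ is linear in the first and antilinear in the second argument, $\langle h,F\rangle=\int h\overline F$ for functions. The space $\mathcal{Y}$ consists of entire functions $\varphi(\lambda)$ satisfying, for all $\lambda\in\mathbb{C}$, the bounds $|\varphi(\lambda)|\le C_n(1+|\lambda|)^{-n}e^{r_\pm|\operatorname{Re}\lambda|}$ for $\pm\operatorname{Re}\lambda\ge 0$, for all $n$, with some $r_+=r_+(\varphi)<0$ and some $r_-=r_-(\varphi)\in\mathbb{R}$; $\varphi_k\to0$ in $\mathcal{Y}$ if all $\varphi_k$ satisfy these bounds with the same constants and $\varphi_k\to0$ uniformly on compact subsets of $\mathbb{C}$. The Laplace transform $(\mathsf{L}f)(\lambda)=\int_0^\infty e^{-t\lambda}f(t)\,dt$ is an isomorphism $C_0^\infty(\mathbb{R}_+)\to\mathcal{Y}$, hence $\mathsf{L}^*:\mathcal{Y}'\to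 C_0^\infty(\mathbb{R}_+)'$, $\langle\mathsf{L}^*\sigma,F\rangle=\langle\sigma,\mathsf{L}F\rangle$, is an isomorphism. The sigma-function of $h\in C_0^\infty(\mathbb{R}_+)'$ is $\sigma=(\mathsf{L}^* )^{-1}h\in\mathcal{Y}'$. The distribution $(\lambda-\alpha)_+^{-k-1}$: for $k<0$ it is the function equal to $(\lambda-\alpha)^{-k-1}$ for $\lambda>\alpha$ and $0$ for $\lambda<\alpha$; for $n<k<n+1$, $n\in\mathbb{Z}_+$, it is defined by $$\int(\lambda-\alpha)_+^{-k-1}\omega(\lambda)\,d\lambda:=\int_\alpha^\infty(\lambda-\alpha)^{-k-1}\Big(\omega(\lambda)-\sum_{p=0}^n\frac{1}{p!}\omega^{(p)}(\alpha)(\lambda-\alpha)^p\Big)d\lambda .$$ For $k\notin\mathbb{Z}_+$, the action of $\sigma$ on $w\in\mathcal{Y}$ is obtained by taking $\omega(\lambda)=e^{-r(\lambda-\alpha)}\overline{w(\lambda)}$ ($\lambda$ real) and multiplying by $1/\Gamma(-k)$. For $k\in\mathbb{Z}_+$, the action of $\delta^{(k)}(\lambda-\alpha)e^{-r(\lambda-\alpha)}$ on $w$ is $(-1)^k\omega^{(k)}(\alpha)$ with the same $\omega$. *)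

(* Defs.v *)
From HB Require Import structures.
From mathcomp Require Import all_boot all_order all_algebra.
From mathcomp Require Import all_classical all_reals all_analysis.
From mathcomp Require Import complex.
Set Implicit Arguments.
Unset Strict Implicit.
Unset Printing Implicit Defensive.
Import Order.TTheory GRing.Theory Num.Theory.
Import numFieldNormedType.Exports.
Local Open Scope classical_set_scope.
Local Open Scope ring_scope.
Local Open Scope complex_scope.

Section calculus.
Variable R : realType.
Local Notation C := R[i].
Local Notation mu := (@lebesgue_measure R).

(* R[i] is not a normed module over R in the library, so derivatives and
   integrals of functions R -> R[i] are taken componentwise. *)
Definition cderive (n : nat) (f : R -> C) (t : R) : C :=
  Complex (derive1n n (fun s => complex.Re (f s)) t)
          (derive1n n (fun s => complex.Im (f s)) t).

Definition cintegral (D : set R) (f : R -> C) : C :=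
  Complex (\int[mu]_(t in D) complex.Re (f t))
          (\int[mu]_(t in D) complex.Im (f t)).

Definition csmooth (f : R -> C) : Prop :=
  forall (n : nat) (t : R),
    derivable (derive1n n (fun s => complex.Re (f s))) t 1 /\
    derivable (derive1n n (fun s => complex.Im (f s))) t 1.

(* Differentiation is over the complex scalars: the increments tend to 0 in C. *)
Definition entire (phi : C -> C) : Prop :=
  forall z : C, derivable (phi : C^o -> C^o) z 1.

End calculus.

Section gamma.
Variable R : realType.

Definition gamma_integral (x : R) : R :=
  \int[@lebesgue_measure R]_(t in `]0, +oo[) (t `^ (x - 1) * expR (- t)).

(* For x <= 0 the integral diverges; the function is continued by
   Gamma(x) = Gamma(x + m) / (x (x + 1) ... (x + m - 1)), with m the number
   of steps needed to reach ]0, 1[.  Meaningless at x = 0, -1, -2, ... *)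
Definition Gamma (x : R) : R :=
  if 0 < x then gamma_integral x
  else let m := (Num.truncn (- x)).+1 in
       gamma_integral (x + m%:R) / \prod_(i < m) (x + i%:R).

End gamma.

Section dual.
Variables (R : realType) (T : Type).
Local Notation C := R[i].

Definition antilinear_on (X : set (T -> C)) (h : (T -> C) -> C) : Prop :=
  forall (a b : C) (f g : T -> C), X f -> X g ->
    h (fun x => a * f x + b * g x) = conjc a * h f + conjc b * h g.

(* X' for a space X of functions T -> C whose topology is given through its
   null sequences.  A functional is a total function on T -> C, and only its
   values on X are meaningful. *)
Definition in_dual (X : set (T -> C)) (null_seq : (nat -> T -> C) -> Prop)
    (h : (T -> C) -> C) : Prop :=
  antilinear_on X h /\
  forall f : nat -> T -> C, (forall j, X (f j)) -> null_seq f ->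
    (fun j => h (f j) : C^o) @ \oo --> (0 : C^o).

End dual.

Section spaces.
Variable R : realType.
Local Notation C := R[i].

Definition supported_in (a b : R) (F : R -> C) : Prop :=
  forall t, t \notin `[a, b] -> F t = 0.

(* C_0^oo(R_+), each function being extended by 0 to the whole line. *)
Definition test_space : set (R -> C) :=
  [set F | csmooth F /\ exists a b : R, 0 < a /\ supported_in a b F].

(* Sequential convergence in the usual inductive limit topology; for linear
   and antilinear functionals on C_0^oo(R_+), which is bornological,
   continuity and sequential continuity agree. *)
Definition test_null (F : nat -> R -> C) : Prop :=
  (exists a b : R, 0 < a /\ forall j, supported_in a b (F j)) /\
  forall (n : nat) (e : R), 0 < e ->
    \forall j \near \oo, forall t : R, Normc.normc (cderive n (F j) t) < e.

Definition test_dual : set ((R -> C) -> C) := in_dual test_space test_null.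

Definition Y_bounds (rp rm : R) (c : nat -> R) (phi : C -> C) : Prop :=
  forall (n : nat) (z : C),
    (0 <= complex.Re z -> Normc.normc (phi z) <=
       c n * (1 + Normc.normc z) ^- n * expR (rp * `|complex.Re z|)) /\
    (complex.Re z <= 0 -> Normc.normc (phi z) <=
       c n * (1 + Normc.normc z) ^- n * expR (rm * `|complex.Re z|)).

Definition Y_space : set (C -> C) :=
  [set phi | entire phi /\
     exists (rp rm : R) (c : nat -> R), rp < 0 /\ Y_bounds rp rm c phi].

Definition Y_null (phi : nat -> C -> C) : Prop :=
  (exists (rp rm : R) (c : nat -> R),
     rp < 0 /\ forall j, Y_bounds rp rm c (phi j)) /\
  {family compact, (phi : nat -> C^o -> C^o) @ \oo --> (cst 0 : C^o -> C^o)}.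

Definition Y_dual : set ((C -> C) -> C) := in_dual Y_space Y_null.

End spaces.

Section laplace.
Variable R : realType.
Local Notation C := R[i].

Definition cexp (z : C) : C :=
  (expR (complex.Re z))%:C * Complex (cos (complex.Im z)) (sin (complex.Im z)).

Definition laplace (f : R -> C) (z : C) : C :=
  cintegral `]0, +oo[ (fun t => cexp (- t%:C * z) * f t).

Definition laplace_adjoint (sigma : (C -> C) -> C) : (R -> C) -> C :=
  fun F => sigma (laplace F).

(* The functional <h, F> = int_0^oo h(t) conj(F(t)) dt of a function h. *)
Definition distribution_of (h : R -> C) : (R -> C) -> C :=
  fun F => cintegral `]0, +oo[ (fun t => h t * conjc (F t)).

(* sigma = (L^* )^-1 h, i.e. sigma is the element of Y' with L^* sigma = h. *)
Definition is_sigma_function (h : (R -> C) -> C) (sigma : (C -> C) -> C) :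
    Prop :=
  [/\ test_dual h, Y_dual sigma &
      forall F, test_space F -> laplace_adjoint sigma F = h F].

Lemma sigma_function_unique (h : (R -> C) -> C) (sigma1 sigma2 : (C -> C) -> C) :
  @laplace @` @test_space R = @Y_space R ->
  is_sigma_function h sigma1 -> is_sigma_function h sigma2 ->
  forall w, Y_space w -> sigma1 w = sigma2 w.
Proof.
move=> LY [_ _ s1h] [_ _ s2h] w; rewrite -LY => -[F DF <-].
by rewrite -[LHS]/(laplace_adjoint sigma1 F) s1h// -s2h.
Qed.

End laplace.

Section sigma.
Variable R : realType.
Local Notation C := R[i].

(* The number of Taylor terms subtracted in the regularization: none if
   k < 0, and those of order p = 0, ..., n if n < k < n + 1. *)
Definition taylor_terms (k : R) : nat :=
  if k < 0 then 0%N else (Num.truncn k).+1.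

(* int (l - alpha)_+^(-k-1) omega(l) dl, for k not in {0, 1, 2, ...} *)
Definition power_plus (alpha k : R) (omega : R -> C) : C :=
  cintegral `]alpha, +oo[ (fun l =>
    ((l - alpha) `^ (- k - 1))%:C *
    (omega l - \sum_(p < taylor_terms k)
       (p`!%:R)^-1 * cderive p omega alpha * ((l - alpha) ^+ p)%:C)).

Definition delta_derivative (alpha : R) (k : nat) (omega : R -> C) : C :=
  (-1) ^+ k * cderive k omega alpha.

Definition damped_conj (alpha r : R) (w : C -> C) : R -> C :=
  fun l => (expR (- r * (l - alpha)))%:C * conjc (w l%:C).

Definition sigma_power (alpha r k : R) : (C -> C) -> C :=
  fun w => ((Gamma (- k))^-1)%:C * power_plus alpha k (damped_conj alpha r w).

Definition sigma_delta (alpha r : R) (k : nat) : (C -> C) -> C :=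
  fun w => delta_derivative alpha k (damped_conj alpha r w).

End sigma.

(* Main.v *)
(* The functional sigma sees an entire function only through its values on the
   real axis. If w = L F, then e^(- r (l - alpha)) conj(w(l)) is, for real l,
   the exponential transform int e^(- (t + r) (l - alpha)) g(t) dt of
   g(t) = e^(- alpha t) conj(F(t)). Its k-th derivative at alpha is
   (- 1)^k int (t + r)^k g(t) dt, which settles the case k in Z_+; otherwise
   Fubini's theorem reduces the identity to the Cauchy-Saalschuetz formula
     int_0^oo x^(- k - 1) (e^(- c x) - sum_(p < m) (- c x)^p / p!) dx
       = c^k Gamma(- k),
   which holds by scaling once c = 1 is known; differentiating it in c at c = 1
   reduces c = 1 to k - 1 in place of k, and k < 0 is the definition of Gamma.

   Continuity of sigma on Y needs bounds on the derivatives of an entire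
   function f by its size on discs. Goursat's bisection on rectangles, applied
   to the 2 pi i-periodic function u |-> (f(a + e^u) - f(a)) e^(- u), gives
     f'(a) = (2 pi)^(- 1) int_0^(2 pi) (f(a + e^(i t)) - f(a)) e^(- i t) dt.
   The right-hand side is an operator that can be iterated without further
   complex analysis, which yields smoothness on the real axis and
   |f^(p)| <= 4^p M on a disc when |f| <= M on the disc with radius p larger. *)
Require Import Defs.
From mathcomp Require Import all_boot all_order all_algebra.
From mathcomp Require Import all_classical all_reals all_analysis.
From mathcomp Require Import measurable_realfun complex.
From mathcomp Require Import ring lra.
Set Implicit Arguments.
Unset Strict Implicit.
Unset Printing Implicit Defensive.
Import Order.TTheory GRing.Theory Num.Theory.
Import numFieldNormedType.Exports.
Local Open Scope classical_set_scope.
Local Open Scope ring_scope.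

(** * Goursat's lemma on rectangles *)

Section segment_integral.
Variable R : realType.
Local Notation mu := (@lebesgue_measure R).
Implicit Types (f g : R -> R) (a b c : R).

Lemma continuous_integrable_itv a b f : continuous f ->
  mu.-integrable `[a, b] (EFin \o f).
Proof.
move=> cf; apply: continuous_compact_integrable; first exact: segment_compact.
exact: continuous_subspaceT.
Qed.

Lemma Rintegral_itv_split a b c f : continuous f -> a <= c -> c <= b ->
  \int[mu]_(x in `[a, b]) f x =
  \int[mu]_(x in `[a, c]) f x + \int[mu]_(x in `[c, b]) f x.
Proof.
move=> cf ac cb.
have := @Rintegral_itvB R f (BLeft a) (BRight b) c (continuous_integrable_itv a b cf).
rewrite !bnd_simp => /(_ ac cb).
rewrite Rintegral_itv_obnd_cbnd; last first.
  apply: integrableS (continuous_integrable_itv a b cf) => //.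
  apply: subset_itv; rewrite bnd_simp//.
by move=> <-; rewrite addrC subrK.
Qed.

Lemma Rintegral_itv_cst a b c : a <= b ->
  \int[mu]_(x in `[a, b]) c = c * (b - a).
Proof.
move=> ab; rewrite Rintegral_cst//.
transitivity (c * fine (if (a%:E < b%:E)%E then (b%:E - a%:E)%E else 0%E)).
  by congr (_ * fine _); exact: lebesgue_measure_itv.
rewrite lte_fin.
by case: ltgtP ab => //= ->; rewrite subrr.
Qed.

Lemma normr_Rintegral_itv_le a b f M : a <= b -> continuous f ->
  (forall x, a <= x <= b -> `|f x| <= M) ->
  `|\int[mu]_(x in `[a, b]) f x| <= M * (b - a).
Proof.
move=> ab cf fM; apply: le_trans (le_normr_Rintegral _ (continuous_integrable_itv a b cf)) _ => //.
rewrite -Rintegral_itv_cst//; apply: le_Rintegral => //.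
- apply: continuous_integrable_itv => x.
  by apply: continuous_comp; [exact: cf|exact: norm_continuous].
- exact/continuous_integrable_itv/cst_continuous.
Qed.

End segment_integral.

Section bisection.
Variable R : realType.
Variables (Phi : R -> R -> R -> R) (a b : R).
Hypotheses (a0 : 0 <= a) (b0 : 0 <= b).
Hypothesis Phi_split : forall x y s : R, 0 < s ->
  Phi x y s = Phi x y (s / 2) + Phi (x + s / 2 * a) y (s / 2) +
    Phi x (y + s / 2 * b) (s / 2) + Phi (x + s / 2 * a) (y + s / 2 * b) (s / 2).
Hypothesis Phi_small : forall x y e : R, 0 < e -> exists2 d : R, 0 < d &
  forall x' y' s : R, 0 < s < d -> x' <= x <= x' + s * a -> y' <= y <= y' + s * b ->
    `|Phi x' y' s| <= e * s ^+ 2.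

Let quarter (p : R * R * R) : exists q : R * R * R, 0 < p.2 ->
  [/\ q.2 = p.2 / 2, p.1.1 <= q.1.1 <= p.1.1 + p.2 / 2 * a,
   p.1.2 <= q.1.2 <= p.1.2 + p.2 / 2 * b &
   `|Phi p.1.1 p.1.2 p.2| <= 4 * `|Phi q.1.1 q.1.2 q.2|].
Proof.
case: p => -[x y] s /=; have [s0|s0] := ltP 0 s; last by exists (x, y, s).
have ha : 0 <= s / 2 * a by rewrite mulr_ge0// divr_ge0// ltW.
have hb : 0 <= s / 2 * b by rewrite mulr_ge0// divr_ge0// ltW.
have := Phi_split x y s0.
set A := Phi x y (s / 2); set B := Phi _ y (s / 2).
set C := Phi x (y + _) (s / 2); set D := Phi _ _ (s / 2) => PE.
have [hA|hA] := leP `|Phi x y s| (4 * `|A|).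
  by exists (x, y, s / 2) => _; split => //=; lra.
have [hB|hB] := leP `|Phi x y s| (4 * `|B|).
  by exists (x + s / 2 * a, y, s / 2) => _; split => //=; lra.
have [hC|hC] := leP `|Phi x y s| (4 * `|C|).
  by exists (x, y + s / 2 * b, s / 2) => _; split => //=; lra.
have [hD|hD] := leP `|Phi x y s| (4 * `|D|).
  by exists (x + s / 2 * a, y + s / 2 * b, s / 2) => _; split => //=; lra.
exfalso; move: (ler_normD (A + B + C) D) (ler_normD (A + B) C) (ler_normD A B).
by rewrite -PE; lra.
Qed.

Lemma bisection_eq0 (x y s : R) : 0 < s -> Phi x y s = 0.
Proof.
move=> s0; have [nx nxP] := choice quarter.
pose u n := iter n nx (x, y, s).
have us n : (u n).2 = s / 2 ^+ n.
  elim: n => [|n ih] /=; first by rewrite expr0 divr1.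
  have un0 : 0 < (u n).2 by rewrite ih divr_gt0// exprn_gt0.
  have [-> _ _ _] := nxP _ un0; rewrite ih exprS invfM.
  by rewrite mulrA (mulrAC s).
have us0 n : 0 < (u n).2 by rewrite us divr_gt0// exprn_gt0.
have uS n := nxP _ (us0 n).
have nested (z : R * R -> R) (c : R) : (forall n, z (u n).1 <= z (u n.+1).1 <= z (u n).1 + (u n).2 / 2 * c) ->
  exists l, forall n, z (u n).1 <= l <= z (u n).1 + (u n).2 * c.
  move=> zS.
  have lo n m : z (u n).1 <= z (u (m + n)%N).1.
    elim: m => // m ih; apply: (le_trans ih).
    by have /andP[] := zS (m + n)%N.
  have hi n m : z (u (m + n)%N).1 + (u (m + n)%N).2 * c <= z (u n).1 + (u n).2 * c.
    elim: m => // m; apply: le_trans.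
    have /andP[_] := zS (m + n)%N.
    by have [-> _ _ _] := uS (m + n)%N; rewrite -[(m.+1 + n)%N]/((m + n).+1); lra.
  have c0 n : 0 <= (u n).2 * c.
    by have /andP[h1 h2] := zS n; have := le_trans h1 h2; lra.
  have ub n m : z (u m).1 <= z (u n).1 + (u n).2 * c.
    have [mn|/ltnW nm] := leqP m n.
      rewrite -(subnK mn); apply: le_trans (lo m (n - m)%N) _.
      by rewrite lerDl.
    by rewrite -(subnK nm); apply: le_trans (hi n (m - n)%N); rewrite lerDl.
  exists (sup (range (fun n => z (u n).1))) => n; apply/andP; split.
    apply: ub_le_sup; last by exists n.
    by exists (z (u 0%N).1 + (u 0%N).2 * c) => _ [m _ <-].
  apply: ge_sup; first by exists (z (u 0%N).1), 0%N.
  by move=> _ [m _ <-].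
have [|xl xlP] := nested fst a; first by move=> n; case: (uS n).
have [|yl ylP] := nested snd b; first by move=> n; case: (uS n).
have PhiS n : `|Phi x y s| <= 4 ^+ n * `|Phi (u n).1.1 (u n).1.2 (u n).2|.
  elim: n => [|n ih]; first by rewrite expr0 mul1r.
  apply: (le_trans ih); rewrite exprSr -mulrA ler_wpM2l ?exprn_ge0//.
  by case: (uS n).
apply/eqP; rewrite -normr_le0; apply/ler_addgt0Pr => e e0; rewrite add0r.
have s20 : 0 < s ^+ 2 by rewrite exprn_gt0.
have [|d d0 dP] := @Phi_small xl yl (e / s ^+ 2); first by rewrite divr_gt0.
have [n nd] : exists n, s / 2 ^+ n < d.
  have : @GRing.exp R (2^-1) n @[n --> \oo] --> 0.
    by apply: cvg_expr; rewrite ger0_norm ?invr_ge0// invf_lt1// ltr1n.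
  move=> /cvgrPdist_lt/(_ (d / s)); rewrite divr_gt0// => /(_ isT)[n _ /(_ n (leqnn n))].
  rewrite sub0r normrN ger0_norm ?exprn_ge0 ?invr_ge0// ltr_pdivlMr// => nd.
  by exists n; rewrite mulrC -exprVn.
apply: (le_trans (PhiS n)).
have := dP (u n).1.1 (u n).1.2 (u n).2.
rewrite us0 {1}us nd => /(_ isT (xlP n) (ylP n)) h.
apply: (@le_trans _ _ (4 ^+ n * (e / s ^+ 2 * (u n).2 ^+ 2))).
  by rewrite ler_wpM2l// exprn_ge0.
rewrite us expr_div_n -exprM mulnC exprM (_ : 2 ^+ 2 = 4 :> R); last by ring.
have h4 : 4 ^+ n != 0 :> R by rewrite expf_neq0// pnatr_eq0.
rewrite (_ : _ * _ = e)//; field.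
by rewrite h4 gt_eqF.
Qed.

End bisection.

(* [lra] and [ring] do not treat integrals as atoms. *)
Ltac generalize_integrals :=
  repeat match goal with |- context [Rintegral ?m ?D ?f] =>
    generalize (Rintegral m D f) end.

Section goursat.
Variable R : realType.
Local Notation mu := (@lebesgue_measure R).

Definition linear_approx (F : R -> R -> R) (x y p q : R) :=
  forall e : R, 0 < e -> exists2 d : R, 0 < d & forall x' y' : R,
    `|x' - x| <= d -> `|y' - y| <= d ->
    `|F x' y' - F x y - p * (x' - x) - q * (y' - y)| <=
      e * (`|x' - x| + `|y' - y|).

Lemma linear_approx_continuous1 F x y p q :
  linear_approx F x y p q -> {for x, continuous (F^~ y)}.
Proof.
move=> FA; apply/cvgrPdist_le => /= e e0.
have [d d0 dF] := FA 1 ltr01.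
have ep : 0 < 1 + `|p| by rewrite ltr_pwDl.
near=> t.
have td : `|t - x| <= d.
  by rewrite distrC; near: t; exact: (@cvgr_dist_le _ _ _ _ _ id x).
have te : `|t - x| <= e / (1 + `|p|).
  by rewrite distrC; near: t; apply: (@cvgr_dist_le _ _ _ _ _ id x) => //; rewrite divr_gt0.
have := dF t y td; rewrite subrr normr0 ltW// => /(_ isT).
rewrite mulr0 subr0 addr0 mul1r => h.
rewrite distrC; rewrite ler_pdivlMr// in te; apply: le_trans te.
rewrite mulrDr mulr1 -[F t y - F x y](subrK (p * (t - x))).
by rewrite (le_trans (ler_normD _ _))// lerD// normrM mulrC.
Unshelve. all: end_near. Qed.

Lemma linear_approx_swap F x y p q :
  linear_approx F x y p q -> linear_approx (fun x y => F y x) y x q p.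
Proof.
move=> FA e e0; have [d d0 dF] := FA _ e0; exists d => // y' x' hy hx.
by have := dF x' y' hx hy; rewrite [_ + `|y' - y|]addrC addrAC.
Qed.

Lemma linear_approx_continuous2 F x y p q :
  linear_approx F x y p q -> {for y, continuous (F x)}.
Proof. by move=> /linear_approx_swap/linear_approx_continuous1. Qed.

Variables P Q : R -> R -> R.
Hypothesis PQ : forall x y, exists p q r,
  linear_approx P x y p q /\ linear_approx Q x y q r.

Let cP y : continuous (P^~ y).
Proof. by move=> x; have [p [q [r [h _]]]] := PQ x y; exact: linear_approx_continuous1 h. Qed.

Let cQ x : continuous (Q x).
Proof. by move=> y; have [p [q [r [_ h]]]] := PQ x y; exact: linear_approx_continuous2 h. Qed.

Lemma Rintegral_itv_diff_shift (f g : R -> R) c (a b : R) : a <= b ->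
  continuous f -> continuous g ->
  \int[mu]_(t in `[a, b]) f t - \int[mu]_(t in `[a, b]) g t =
  \int[mu]_(t in `[a, b]) (f t - g t - c) + c * (b - a).
Proof.
move=> ab cf cg.
have cfg : continuous (fun t => f t - g t) by move=> t; apply: cvgB; [exact: cf|exact: cg].
rewrite -RintegralB//; try exact: continuous_integrable_itv.
rewrite (_ : \int[mu]_(t in `[a, b]) (f t - g t - c) =
  \int[mu]_(t in `[a, b]) (f t - g t) - \int[mu]_(t in `[a, b]) c).
  by rewrite Rintegral_itv_cst// subrK.
by rewrite -RintegralB//; apply: continuous_integrable_itv => //; exact: cst_continuous.
Qed.

Lemma goursat_rectangle (x0 y0 a b : R) : 0 < a -> 0 < b ->
  \int[mu]_(x in `[x0, x0 + a]) P x y0 + \int[mu]_(y in `[y0, y0 + b]) Q (x0 + a) y =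
  \int[mu]_(x in `[x0, x0 + a]) P x (y0 + b) + \int[mu]_(y in `[y0, y0 + b]) Q x0 y.
Proof.
move=> a0 b0.
pose Phi (x y s : R) : R :=
  \int[mu]_(t in `[x, x + s * a]) P t y - \int[mu]_(t in `[x, x + s * a]) P t (y + s * b)
  + (\int[mu]_(t in `[y, y + s * b]) Q (x + s * a) t - \int[mu]_(t in `[y, y + s * b]) Q x t).
suff : Phi x0 y0 (1 : R) = 0 by rewrite /Phi !mul1r; generalize_integrals; move=> *; lra.
apply: (@bisection_eq0 R Phi a b) => //; try exact: ltW.
- move=> x y s s0; rewrite /Phi.
  have ha : 0 < s / 2 * a by rewrite mulr_gt0// divr_gt0.
  have hb : 0 < s / 2 * b by rewrite mulr_gt0// divr_gt0.
  have -> : s * a = s / 2 * a + s / 2 * a by field.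
  have -> : s * b = s / 2 * b + s / 2 * b by field.
  rewrite !addrA; set h := s / 2 * a in ha *; set k := s / 2 * b in hb *.
  have xs f (cf : continuous f) := @Rintegral_itv_split R x (x + h + h) (x + h) f cf.
  have ys f (cf : continuous f) := @Rintegral_itv_split R y (y + k + k) (y + k) f cf.
  rewrite (xs (P^~ y)) ?(xs (P^~ (y + k + k))) ?(ys (Q x)) ?(ys (Q (x + h + h)))//; try lra.
- move=> x y e e0; have [p [q [r [PA QA]]]] := PQ x y.
  have ab0 : 0 < a + b by rewrite addr_gt0.
  pose e' := e / (2 * (a + b) ^+ 2).
  have e'0 : 0 < e' by rewrite divr_gt0// mulr_gt0// exprn_gt0.
  have [d1 d10 PA1] := PA _ e'0; have [d2 d20 QA2] := QA _ e'0.
  pose d := Num.min d1 d2; have d0 : 0 < d by rewrite lt_min d10.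
  exists (d / (a + b)); first by rewrite divr_gt0.
  move=> x' y' s /andP[s0]; rewrite ltr_pdivlMr// => sd xx' yy'; rewrite /Phi.
  have sa : 0 < s * a by rewrite mulr_gt0.
  have sb : 0 < s * b by rewrite mulr_gt0.
  have sabd : s * a + s * b <= d by rewrite -mulrDr ltW.
  have [dd1 dd2] : d <= d1 /\ d <= d2 by split; rewrite ge_min lexx ?orbT.
  rewrite (Rintegral_itv_diff_shift (- q * (s * b)))//; last by lra.
  rewrite (Rintegral_itv_diff_shift (q * (s * a)))//; last by lra.
  rewrite (_ : forall A B : R, A + - q * (s * b) * (x' + s * a - x') +
     (B + q * (s * a) * (y' + s * b - y')) = A + B); last by move=> A B; ring.
  have dist (z z' w c : R) : 0 < c -> z' <= z <= z' + c -> z' <= w <= z' + c -> `|w - z| <= c.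
    by move=> c0 h1 h2; rewrite ler_norml; lra.
  have bd (A B : R) : `|A| <= e' * (2 * (s * a + s * b)) * (s * a) ->
      `|B| <= e' * (2 * (s * a + s * b)) * (s * b) -> `|A + B| <= e * s ^+ 2.
    move=> hA hB; rewrite (le_trans (ler_normD _ _))// (le_trans (lerD hA hB))//.
    rewrite -mulrDr -!mulrDr /e'.
    rewrite [leLHS](_ : _ = e * s ^+ 2)//; field.
    by rewrite gt_eqF.
  have est (F : R -> R -> R) (p' q' dF u1 v1 u2 v2 : R) : (forall x' y', `|x' - x| <= dF -> `|y' - y| <= dF ->
      `|F x' y' - F x y - p' * (x' - x) - q' * (y' - y)| <= e' * (`|x' - x| + `|y' - y|)) ->
      d <= dF -> x' <= u1 <= x' + s * a -> x' <= u2 <= x' + s * a ->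
      y' <= v1 <= y' + s * b -> y' <= v2 <= y' + s * b ->
      `|F u1 v1 - F u2 v2 - (p' * (u1 - u2) + q' * (v1 - v2))| <= e' * (2 * (s * a + s * b)).
    move=> FA dF1 hu1 hu2 hv1 hv2.
    have du1 := dist _ _ _ _ sa xx' hu1; have du2 := dist _ _ _ _ sa xx' hu2.
    have dv1 := dist _ _ _ _ sb yy' hv1; have dv2 := dist _ _ _ _ sb yy' hv2.
    have [adF bdF] : s * a <= dF /\ s * b <= dF.
      by split; apply: le_trans dF1; apply: le_trans sabd; rewrite ?lerDl ?lerDr ltW.
    have F1 : `|F u1 v1 - F x y - p' * (u1 - x) - q' * (v1 - y)| <= e' * (s * a + s * b).
      apply: (le_trans (FA u1 v1 (le_trans du1 adF) (le_trans dv1 bdF))).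
      by rewrite ler_pM2l// lerD.
    have F2 : `|F u2 v2 - F x y - p' * (u2 - x) - q' * (v2 - y)| <= e' * (s * a + s * b).
      apply: (le_trans (FA u2 v2 (le_trans du2 adF) (le_trans dv2 bdF))).
      by rewrite ler_pM2l// lerD.
    rewrite (_ : F u1 v1 - F u2 v2 - (p' * (u1 - u2) + q' * (v1 - v2)) =
      (F u1 v1 - F x y - p' * (u1 - x) - q' * (v1 - y)) -
      (F u2 v2 - F x y - p' * (u2 - x) - q' * (v2 - y))); last by ring.
    by rewrite (le_trans (ler_normB _ _))// (le_trans (lerD F1 F2))// -mulrDr -mulr2n mulr_natl.
  apply: bd.
    rewrite [X in _ <= _ * X](_ : s * a = x' + s * a - x'); last by rewrite addrAC subrr add0r.
    apply: normr_Rintegral_itv_le; first by lra.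
      move=> t; apply: cvgB; last exact: cvg_cst.
      by apply: cvgB; exact: cP.
    move=> t ht; have := est P p q d1 t y' t (y' + s * b) PA1 dd1 ht ht.
    rewrite subrr mulr0 add0r (_ : q * _ = - q * (s * b)); last by ring.
    by apply; lra.
  rewrite [X in _ <= _ * X](_ : s * b = y' + s * b - y'); last by rewrite addrAC subrr add0r.
  apply: normr_Rintegral_itv_le; first by lra.
    move=> t; apply: cvgB; last exact: cvg_cst.
    by apply: cvgB; exact: cQ.
  move=> t ht; have := est Q q r d2 (x' + s * a) t x' t QA2 dd2.
  rewrite subrr mulr0 addr0 (_ : q * _ = q * (s * a)); last by ring.
  by apply => //; lra.
Qed.

End goursat.

(** * Entire functions *)

Section complex_norm.
Local Open Scope complex_scope.
Variable R : realType.
Local Notation C := R[i].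
Local Notation nc := (@Normc.normc R).
Implicit Types z w : C.

Lemma normc_normr z : `|z| = (nc z)%:C.
Proof. by []. Qed.

Lemma normc_ge0 z : 0 <= nc z.
Proof. by case: z => x y; exact: sqrtr_ge0. Qed.

Lemma ler_normcD z w : nc (z + w) <= nc z + nc w.
Proof. exact: le_normcD. Qed.

Lemma normc_opp z : nc (- z) = nc z.
Proof. exact: normcN. Qed.

Lemma ler_normcB z w : nc (z - w) <= nc z + nc w.
Proof. by rewrite -(normc_opp w) ler_normcD. Qed.

Lemma normcR (x : R) : nc x%:C = `|x|.
Proof. by rewrite /= expr0n addr0 sqrtr_sqr. Qed.

Lemma cReD z w : complex.Re (z + w) = complex.Re z + complex.Re w.
Proof. by case: z w => [? ?] []. Qed.

Lemma cImD z w : complex.Im (z + w) = complex.Im z + complex.Im w.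
Proof. by case: z w => [? ?] []. Qed.

Lemma cReB z w : complex.Re (z - w) = complex.Re z - complex.Re w.
Proof. by case: z w => [? ?] []. Qed.

Lemma cImB z w : complex.Im (z - w) = complex.Im z - complex.Im w.
Proof. by case: z w => [? ?] []. Qed.

Lemma cReM z w : complex.Re (z * w) =
  complex.Re z * complex.Re w - complex.Im z * complex.Im w.
Proof. by case: z w => [? ?] []. Qed.

Lemma cImM z w : complex.Im (z * w) =
  complex.Re z * complex.Im w + complex.Im z * complex.Re w.
Proof. by case: z w => [? ?] []. Qed.

Lemma Re_le_normc z : `|complex.Re z| <= nc z.
Proof.
by case: z => x y /=; rewrite -sqrtr_sqr ler_wsqrtr// lerDl sqr_ge0.
Qed.

Lemma Im_le_normc z : `|complex.Im z| <= nc z.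
Proof.
by case: z => x y /=; rewrite -sqrtr_sqr ler_wsqrtr// lerDr sqr_ge0.
Qed.

Lemma normc_le_ReIm z : nc z <= `|complex.Re z| + `|complex.Im z|.
Proof.
case: z => x y /=; rewrite -[leRHS]ger0_norm ?addr_ge0// -sqrtr_sqr ler_wsqrtr//.
rewrite sqrrD !real_normK ?num_real// -addrA [_ *+ 2 + _]addrC addrA lerDl.
by rewrite mulrn_wge0// mulr_ge0.
Qed.

Lemma ltcR0 (e : C) : 0 < e -> 0 < complex.Re e /\ e = (complex.Re e)%:C.
Proof. by case: e => x y; rewrite ltcE /= => /andP[/eqP -> x0]. Qed.

End complex_norm.

Section complex_derivative.
Local Open Scope complex_scope.
Variable R : realType.
Local Notation C := R[i].
Local Notation nc := (@Normc.normc R).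
Implicit Types (f g : C -> C) (z d : C).

Definition cdiff f z d := forall e : R, 0 < e -> exists2 r : R, 0 < r &
  forall h : C, nc h <= r -> nc (f (z + h) - f z - d * h) <= e * nc h.

Lemma derivable_cdiff f z :
  derivable (f : C^o -> C^o) z 1 -> exists d, cdiff f z d.
Proof.
move=> /cvg_ex[l /cvgrPdist_le fl]; exists l => e e0.
have /fl : 0 < e%:C by rewrite ltcR.
move=> [r /= r0 rP]; have [r0' rE] := ltcR0 r0.
exists (complex.Re r / 2); first by rewrite divr_gt0.
move=> h hr; have [->|h0] := eqVneq h 0.
  by rewrite mulr0 addr0 subrr subr0 Normc.normc0 mulr0.
have := rP h; rewrite /= sub0r normrN rE normc_normr ltcR => /(_ _ h0) H.
have {H} : (nc (l - h^-1 *: (f (h *: 1 + z) - f z)))%:C <= e%:C :> C.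
  by apply: H; rewrite (le_lt_trans hr)// ltr_pdivrMr// mulr_natr mulr2n ltrDl.
rewrite lecR => H.
rewrite (_ : f (z + h) - f z - l * h = - ((l - h^-1 *: (f (h *: 1 + z) - f z)) * h)).
  by rewrite normc_opp Normc.normcM ler_wpM2r// normc_ge0.
rewrite [h *: 1]mulr1 (addrC h z) /GRing.scale/=.
by rewrite mulrBl mulrAC mulVf// mul1r opprB.
Qed.

Lemma cdiff_derivable f z d : cdiff f z d -> derivable (f : C^o -> C^o) z 1.
Proof.
move=> fd; apply/cvg_ex; exists d; apply/cvgrPdist_le => e e0.
have [e0' ->] := ltcR0 e0; have [r r0 rP] := fd _ e0'.
exists r%:C; first by rewrite /= ltcR.
move=> h /=; rewrite sub0r normrN normc_normr ltcR => /ltW hr h0.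
have := rP h hr; rewrite normc_normr lecR => H.
rewrite [h *: 1]mulr1 (addrC h z).
rewrite -(ler_pM2r (x := nc h)); last first.
  by rewrite lt_neqAle normc_ge0 andbT eq_sym; apply: contra h0 => /eqP/Normc.eq0_normc ->.
apply: le_trans H; rewrite -Normc.normcM -normc_opp.
by rewrite mulrBl opprB /GRing.scale/= mulrAC mulVf// mul1r.
Qed.

Lemma is_derive_linear_approx (u : R -> R) (x l : R) :
  (forall e : R, 0 < e -> exists2 r : R, 0 < r & forall h : R, `|h| <= r ->
     `|u (x + h) - u x - l * h| <= e * `|h|) -> is_derive x 1 u l.
Proof.
move=> ul; suff H : h^-1 *: ((u \o shift x) (h *: 1) - u x) @[h --> 0^'] --> l.
  apply: DeriveDef; first by apply/cvg_ex; exists l.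
  exact/cvg_lim.
apply/cvgrPdist_le => e e0; have [r r0 rP] := ul _ e0.
exists r => //= h /=; rewrite sub0r normrN => /ltW hr h0.
have := rP h hr; rewrite [h *: 1]mulr1 (addrC h x) => H.
rewrite -(ler_pM2r (x := `|h|)) ?normr_gt0//.
apply: le_trans H; rewrite -normrM -normrN.
by rewrite mulrBl opprB /GRing.scale/= mulrAC mulVf// mul1r.
Qed.

Lemma cdiff_line f z v d s : cdiff f (z + s%:C * v) d ->
  is_derive s 1 (fun s : R => complex.Re (f (z + s%:C * v))) (complex.Re (d * v)) /\
  is_derive s 1 (fun s : R => complex.Im (f (z + s%:C * v))) (complex.Im (d * v)).
Proof.
move=> fd.
have H (e : R) : 0 < e -> exists2 r : R, 0 < r & forall h : R, `|h| <= r ->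
   nc (f (z + (s + h)%:C * v) - f (z + s%:C * v) - d * v * h%:C) <= e * `|h|.
  move=> e0; have v0 : 0 < nc v + 1 by rewrite ltr_wpDl// normc_ge0.
  have [r r0 rP] := fd (e / (nc v + 1)) (divr_gt0 e0 v0).
  exists (r / (nc v + 1)); first by rewrite divr_gt0.
  move=> h; rewrite ler_pdivlMr// => hr.
  have hv : nc (h%:C * v) = `|h| * nc v by rewrite Normc.normcM normcR.
  have hvle : `|h| * nc v <= `|h| * (nc v + 1) by rewrite ler_wpM2l// lerDl.
  have := rP (h%:C * v); rewrite hv => /(_ (le_trans hvle hr)) H.
  rewrite (_ : z + (s + h)%:C * v = z + s%:C * v + h%:C * v); last first.
    by rewrite (rmorphD (real_complex R)); ring.
  rewrite (_ : d * v * h%:C = d * (h%:C * v)); last by ring.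
  apply: (le_trans H); rewrite mulrAC -mulrA ler_wpM2l ?(ltW e0)//.
  by rewrite ler_pdivrMr.
split; apply: is_derive_linear_approx => e e0.
  have [r r0 rP] := H e e0; exists r => // h hr; apply: le_trans (rP h hr).
  apply: le_trans (Re_le_normc _).
  by rewrite !cReB [complex.Re (_ * h%:C)]cReM/= mulr0 subr0.
have [r r0 rP] := H e e0; exists r => // h hr; apply: le_trans (rP h hr).
apply: le_trans (Im_le_normc _).
by rewrite !cImB [complex.Im (_ * h%:C)]cImM/= mulr0 add0r.
Qed.

Lemma cdiff_linear_approx f z d : cdiff f z d ->
  linear_approx (fun x y => complex.Re (f (x +i* y))) (complex.Re z) (complex.Im z)
    (complex.Re d) (- complex.Im d) /\
  linear_approx (fun x y => complex.Im (f (x +i* y))) (complex.Re z) (complex.Im z)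
    (complex.Im d) (complex.Re d).
Proof.
case: z => x y; case: d => p q fd /=.
have H (e : R) : 0 < e -> exists2 r : R, 0 < r & forall x' y' : R,
    `|x' - x| <= r -> `|y' - y| <= r ->
    nc (f (x' +i* y') - f (x +i* y) - (p +i* q) * ((x' - x) +i* (y' - y))) <=
      e * (`|x' - x| + `|y' - y|).
  move=> e0; have [r r0 rP] := fd e e0.
  exists (r / 2); first by rewrite divr_gt0.
  move=> x' y' hx hy; have hle := normc_le_ReIm ((x' - x) +i* (y' - y)).
  have := rP ((x' - x) +i* (y' - y)).
  rewrite (_ : (x +i* y) + ((x' - x) +i* (y' - y)) = x' +i* y'); last first.
    by apply/eqP; rewrite eq_complex /= ![_ + (_ - _)]addrC !subrK !eqxx.
  move=> /(_ _)/le_trans; apply; first by rewrite (le_trans hle)//=; lra.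
  by rewrite ler_wpM2l// ltW.
split=> e e0.
  have [r r0 rP] := H e e0; exists r => // x' y' hx hy.
  apply: le_trans (rP x' y' hx hy); apply: le_trans (Re_le_normc _).
  by rewrite !cReB cReM/= opprB mulNr opprK -addrA [- _ + _]addrC.
have [r r0 rP] := H e e0; exists r => // x' y' hx hy.
apply: le_trans (rP x' y' hx hy); apply: le_trans (Im_le_normc _).
by rewrite !cImB cImM/= opprD addrA addrAC.
Qed.

Lemma cdiff_continuous f z d : cdiff f z d -> forall e : R, 0 < e ->
  exists2 r : R, 0 < r & forall h, nc h <= r -> nc (f (z + h) - f z) <= e.
Proof.
move=> fd e e0; have [r r0 rP] := fd 1 ltr01.
have dp : 0 < nc d + 1 by rewrite ltr_wpDl// normc_ge0.
exists (Num.min r (e / (nc d + 1))); first by rewrite lt_min r0 divr_gt0.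
move=> h; rewrite le_min ler_pdivlMr// => /andP[hr he].
apply: le_trans he; have := rP h hr; rewrite mul1r => H.
rewrite -[f (z + h) - f z](subrK (d * h)) (le_trans (ler_normcD _ _))//.
rewrite mulrDr mulr1 addrC lerD//.
by rewrite Normc.normcM mulrC.
Qed.

End complex_derivative.

Section complex_exponential.
Local Open Scope complex_scope.
Variable R : realType.
Local Notation C := R[i].
Local Notation nc := (@Normc.normc R).
Implicit Types z w : C.

Lemma cexpD z w : cexp (z + w) = cexp z * cexp w.
Proof.
case: z => x y; case: w => x' y'; rewrite /cexp /= expRD cosD sinD.
apply/eqP; rewrite eq_complex /=; apply/andP; split; apply/eqP; ring.
Qed.

Lemma cexp0 : cexp (0 : C) = 1.
Proof. by rewrite /cexp/= expR0 cos0 sin0 mul1r. Qed.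

Lemma cexpNr z : cexp z * cexp (- z) = 1.
Proof. by rewrite -cexpD subrr cexp0. Qed.

Lemma normc_cexp z : nc (cexp z) = expR (complex.Re z).
Proof.
rewrite /cexp Normc.normcM normcR ger0_norm ?expR_ge0//=.
by rewrite cos2Dsin2 sqrtr1 mulr1.
Qed.

Lemma cexpR (x : R) : cexp x%:C = (expR x)%:C.
Proof. by rewrite /cexp/= cos0 sin0 mulr1. Qed.

Lemma real_derive_approx (u : R -> R) (x l : R) : is_derive x 1 u l ->
  forall e : R, 0 < e -> exists2 r : R, 0 < r & forall h : R, `|h| <= r ->
     `|u (x + h) - u x - l * h| <= e * `|h|.
Proof.
move=> [/cvg_ex[l' ul] <-] e e0.
have -> : 'D_1 u x = l' by exact/cvg_lim.
move/cvgrPdist_le : ul => /(_ _ e0)[r /= r0 rP].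
exists (r / 2); first by rewrite divr_gt0.
move=> h hr; have [->|h0] := eqVneq h 0; first by rewrite mulr0 addr0 subrr subr0 normr0 mulr0.
have := rP h; rewrite /= sub0r normrN => /(_ _ h0) H.
have {H} : `|l' - h^-1 *: (u (h *: 1 + x) - u x)| <= e.
  by apply: H; rewrite (le_lt_trans hr)// ltr_pdivrMr// mulr_natr mulr2n ltrDl.
rewrite [h *: 1]mulr1 (addrC h x) => H.
rewrite (_ : _ - _ = - ((l' - h^-1 *: (u (x + h) - u x)) * h)).
  by rewrite normrN normrM ler_wpM2r.
by rewrite mulrBl opprB /GRing.scale/= mulrAC mulVf// mul1r.
Qed.

Lemma cdiff_cexp z : cdiff (@cexp R) z (cexp z).
Proof.
move=> e e0; have c0 : 0 < expR (complex.Re z) by exact: expR_gt0.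
pose e1 := Num.min 1 (e / (8 * expR (complex.Re z))).
have e10 : 0 < e1 by rewrite lt_min ltr01/= divr_gt0// mulr_gt0.
have e1le1 : e1 <= 1 by rewrite ge_min lexx.
have e1le : e1 * 8 * expR (complex.Re z) <= e.
  by rewrite -mulrA -ler_pdivlMr ?mulr_gt0// ge_min lexx orbT.
have [r1 r10 r1P] := real_derive_approx (is_derive_expR (0 : R)) e10.
have [r2 r20 r2P] := real_derive_approx (is_derive_cos (0 : R)) e10.
have [r3 r30 r3P] := real_derive_approx (is_derive_sin (0 : R)) e10.
exists (Num.min (Num.min r1 r2) (Num.min r3 e1)); first by rewrite (lt_min 0 (Num.min _ _)) (lt_min 0 r1) (lt_min 0 r3) r10 r20 r30.
case=> x y; rewrite (le_min _ (Num.min r1 r2)) (le_min _ r1) (le_min _ r3) => /andP[/andP[h1 h2] /andP[h3 h4]].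
have xn := Re_le_normc (x +i* y); have yn := Im_le_normc (x +i* y).
set N := nc (x +i* y) in h1 h2 h3 h4 xn yn *; rewrite /= in xn yn.
have E := r1P x (le_trans xn h1); have Co := r2P y (le_trans yn h2).
have Si := r3P y (le_trans yn h3).
rewrite !add0r expR0 mul1r in E; rewrite !add0r cos0 sin0 oppr0 mul0r subr0 in Co.
rewrite !add0r sin0 cos0 mul1r subr0 in Si.
rewrite cexpD (_ : _ - _ - _ = cexp z * (cexp (x +i* y) - 1 - (x +i* y))); last by ring.
rewrite Normc.normcM normc_cexp (le_trans _ (ler_wpM2r (normc_ge0 _) e1le))//.
rewrite (mulrC (e1 * 8)) -mulrA ler_pM2l// -/N.
apply: (le_trans (normc_le_ReIm _)); rewrite /cexp !cReB !cImB cReM cImM /= !mul0r !subr0 addr0.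
have e1x : `|x| * e1 <= e1 * N by rewrite mulrC ler_pM2l.
have e1y : `|y| * e1 <= e1 * N by rewrite mulrC ler_pM2l.
have R1 : `|expR x * cos y - 1 - x| <= e1 * `|x| + (1 + `|x|) * (e1 * `|y|).
  rewrite (_ : _ - _ - _ = (expR x - 1 - x) * cos y + (1 + x) * (cos y - 1)); last by ring.
  rewrite (le_trans (ler_normD _ _))// lerD// normrM.
    rewrite -[leRHS]mulr1 ler_pM// ler_norml cos_geN1 cos_le1//.
  by rewrite ler_pM// (le_trans (ler_normD _ _))// normr1.
have R2 : `|expR x * sin y - y| <= 2 * `|x| * (2 * `|y|) + e1 * `|y|.
  rewrite (_ : _ - _ = (expR x - 1) * sin y + (sin y - y)); last by ring.
  rewrite (le_trans (ler_normD _ _))// lerD// normrM ler_pM//.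
    rewrite -[expR x - 1](subrK x) (le_trans (ler_normD _ _))//.
    have : e1 * `|x| <= `|x| by rewrite ler_piMl.
    by lra.
  rewrite -[sin y](subrK y) (le_trans (ler_normD _ _))//.
  have : e1 * `|y| <= `|y| by rewrite ler_piMl.
  by lra.
have xe : `|x| <= e1 by exact: le_trans xn h4.
have x1 : `|x| <= 1 by exact: le_trans xe e1le1.
have xy : `|x| * `|y| <= e1 * N by rewrite ler_pM.
have e1xy : `|x| * (e1 * `|y|) <= e1 * N.
  by rewrite -[leRHS]mul1r ler_pM ?mulr_ge0// ?ler_wpM2l// ltW.
apply: (le_trans (lerD R1 R2)); rewrite (_ : 2 * `|x| * (2 * `|y|) = 4 * (`|x| * `|y|)); last by ring.
by rewrite mulrDl mul1r; rewrite mulrC in e1x; rewrite mulrC in e1y; lra.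
Qed.

Definition circ (t : R) : C := cos t +i* sin t.

Lemma cexp_circ (t : R) : cexp (0 +i* t) = circ t.
Proof. by rewrite /cexp/= expR0 mul1r. Qed.

Lemma normc_circ (t : R) : nc (circ t) = 1.
Proof. by rewrite -cexp_circ normc_cexp expR0. Qed.

Lemma cexp_pi2 (x : R) : cexp (x +i* (pi *+ 2)) = cexp (x +i* 0).
Proof. by rewrite /cexp/= cos2pi sin2pi cos0 sin0. Qed.

End complex_exponential.

Section derivative_by_circle_average.
Local Open Scope complex_scope.
Variable R : realType.
Local Notation C := R[i].
Local Notation mu := (@lebesgue_measure R).
Local Notation nc := (@Normc.normc R).
Local Notation circ := (@circ R).
Implicit Types (f g : C -> C) (z w a d : C).

Lemma derivable_compC f g z : derivable (g : C^o -> C^o) z 1 ->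
  derivable (f : C^o -> C^o) (g z) 1 -> derivable (f \o g : C^o -> C^o) z 1.
Proof. by rewrite !derivable1_diffP; exact: differentiable_comp. Qed.

Lemma derivable_cexp z : derivable (@cexp R : C^o -> C^o) z 1.
Proof. exact: cdiff_derivable (cdiff_cexp z). Qed.

Lemma derivable_affine z a b : derivable ((fun w => a * w + b) : C^o -> C^o) z 1.
Proof.
apply: (@cdiff_derivable _ _ _ a) => e e0; exists 1 => // h _.
rewrite (_ : _ - _ = 0); last by ring.
by rewrite Normc.normc0 mulr_ge0 ?normc_ge0// ltW.
Qed.

Lemma Rintegral_itv_near_cst (u : R -> R) (a b c e : R) : a <= b -> continuous u ->
  (forall x, a <= x <= b -> `|u x - c| <= e) ->
  `|\int[mu]_(x in `[a, b]) u x - c * (b - a)| <= e * (b - a).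
Proof.
move=> ab cu uc; rewrite -Rintegral_itv_cst// -RintegralB//.
- by apply: normr_Rintegral_itv_le => // x; apply: cvgB; [exact: cu|exact: cvg_cst].
- exact: continuous_integrable_itv.
- exact/continuous_integrable_itv/cst_continuous.
Qed.

Lemma linear_approxN (F : R -> R -> R) x y p q : linear_approx F x y p q ->
  linear_approx (fun x y => - F x y) x y (- p) (- q).
Proof.
move=> FA e e0; have [r r0 rP] := FA e e0; exists r => // x' y' hx hy.
apply: le_trans (rP _ _ hx hy); rewrite -normrN.
by rewrite [X in `|X| <= _](_ : _ = F x' y' - F x y - p * (x' - x) - q * (y' - y))//; ring.
Qed.

Let pi2_gt0 : 0 < pi *+ 2 :> R.
Proof. by rewrite mulrn_wgt0// pi_gt0. Qed.

(* The horizontal sides of [rho, 0] x [0, 2 pi] cancel by periodicity. *)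
Lemma periodic_integral_vertical g : entire g ->
  (forall x : R, g (x +i* (pi *+ 2)) = g (x +i* 0)) ->
  forall rho : R, rho < 0 ->
  \int[mu]_(t in `[0, pi *+ 2]) complex.Re (g (rho +i* t)) =
  \int[mu]_(t in `[0, pi *+ 2]) complex.Re (g (0 +i* t)) /\
  \int[mu]_(t in `[0, pi *+ 2]) complex.Im (g (rho +i* t)) =
  \int[mu]_(t in `[0, pi *+ 2]) complex.Im (g (0 +i* t)).
Proof.
move=> eg per rho rho0; have nrho : 0 < - rho by rewrite oppr_gt0.
have dg (x y : R) : exists d, cdiff g (x +i* y) d by exact/derivable_cdiff/eg.
have G1 (x y : R) : exists p q r,
    linear_approx (fun x y => complex.Im (g (x +i* y))) x y p q /\
    linear_approx (fun x y => complex.Re (g (x +i* y))) x y q r.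
  have [d dd] := dg x y; have [h1 h2] := cdiff_linear_approx dd.
  by exists (complex.Im d), (complex.Re d), (- complex.Im d).
have G2 (x y : R) : exists p q r,
    linear_approx (fun x y => - complex.Re (g (x +i* y))) x y p q /\
    linear_approx (fun x y => complex.Im (g (x +i* y))) x y q r.
  have [d dd] := dg x y; have [h1 h2] := cdiff_linear_approx dd.
  exists (- complex.Re d), (complex.Im d), (complex.Re d); split => //.
  by rewrite -[complex.Im d]opprK; exact: linear_approxN.
split.
  have := goursat_rectangle G1 rho 0 nrho pi2_gt0.
  rewrite subrr !add0r; under [X in _ = X + _]eq_Rintegral do rewrite per.
  by move=> /addrI ->.
have := goursat_rectangle G2 rho 0 nrho pi2_gt0.
rewrite subrr !add0r; under [X in _ = X + _]eq_Rintegral do rewrite per.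
by move=> /addrI ->.
Qed.

Definition circle_kernel f z (t : R) : C := (f (z + circ t) - f z) * conjc (circ t).

Definition circle_derivative f z : C :=
  ((pi *+ 2)^-1)%:C * cintegral `[0, pi *+ 2] (circle_kernel f z).

Lemma circle_derivativeP f a d : entire f -> cdiff f a d -> d = circle_derivative f a.
Proof.
move=> ef fd.
pose g w := (f (a + cexp w) - f a) * cexp (- w).
have eg : entire g.
  move=> w; have h1 : derivable ((fun w => f (a + cexp w) - f a) : C^o -> C^o) w 1.
    apply: (@derivableB C C^o C^o (fun w => f (a + cexp w)) (fun=> f a)); last exact: derivable_cst.
    apply: (@derivable_compC f (fun w => a + cexp w)); last exact: ef.
    apply: (@derivableD C C^o C^o (fun=> a) (@cexp R)); first exact: derivable_cst.
    exact: derivable_cexp.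
  have h2 : derivable ((fun w => cexp (- w)) : C^o -> C^o) w 1.
    apply: (@derivable_compC (@cexp R) (fun w => - w)); last exact: derivable_cexp.
    have := @derivable_affine w (- 1) 0.
    by rewrite (_ : (fun w => _) = (fun w => - w))//; apply/funext => v; rewrite mulN1r addr0.
  exact: (derivableM h1 h2).
have per (x : R) : g (x +i* (pi *+ 2)) = g (x +i* 0).
  have cN (u v : R) : - (u +i* v) = (- u) +i* (- v) by [].
  rewrite /g cexp_pi2 !cN; congr (_ * _).
  by rewrite /cexp/= cosN sinN cos2pi sin2pi cosN sinN cos0 sin0.
have gE t : g (0 +i* t) = circle_kernel f a t.
  rewrite /g /circle_kernel cexp_circ; congr (_ * _).
  by rewrite /cexp/= oppr0 expR0 mul1r cosN sinN.
have cRe (x : R) : continuous (fun t => complex.Re (g (x +i* t))).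
  move=> y; have [d' dd] := derivable_cdiff (eg (x +i* y)).
  by have [h1 _] := cdiff_linear_approx dd; exact: linear_approx_continuous2 h1.
have cIm (x : R) : continuous (fun t => complex.Im (g (x +i* t))).
  move=> y; have [d' dd] := derivable_cdiff (eg (x +i* y)).
  by have [_ h1] := cdiff_linear_approx dd; exact: linear_approx_continuous2 h1.
have small (e : R) : 0 < e -> exists2 rho : R, rho < 0 & forall t, nc (g (rho +i* t) - d) <= e.
  move=> e0; have [r r0 rP] := fd e e0.
  exists (Num.min (- 1) (ln r)); first by rewrite gt_min ltrN10.
  move=> t; set w := _ +i* t.
  have hw : nc (cexp w) <= r.
    by rewrite normc_cexp /= -[leRHS](lnK (x := r)) ?posrE// ler_expR ge_min lexx orbT.
  have := rP _ hw => H.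
  rewrite (_ : g w - d = (f (a + cexp w) - f a - d * cexp w) * cexp (- w)); last first.
    by rewrite [RHS]mulrBl -[d * _ * _]mulrA cexpNr mulr1.
  rewrite Normc.normcM (le_trans (ler_wpM2r (normc_ge0 _) H))//.
  by rewrite -mulrA -Normc.normcM cexpNr Normc.normc1 mulr1.
have key (u : R -> R -> R) (c : R) : (forall x, continuous (u x)) ->
    (forall e : R, 0 < e -> exists2 rho : R, rho < 0 & forall t, `|u rho t - c| <= e) ->
    (forall rho : R, rho < 0 -> \int[mu]_(t in `[0, pi *+ 2]) u rho t =
      \int[mu]_(t in `[0, pi *+ 2]) u 0 t) ->
    c = (pi *+ 2)^-1 * \int[mu]_(t in `[0, pi *+ 2]) u 0 t.
  move=> cu su iu; apply: (mulfI (lt0r_neq0 pi2_gt0)).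
  rewrite mulrA divff ?lt0r_neq0// mul1r; apply/eqP; rewrite eq_sym -subr_eq0 -normr_le0.
  apply/ler_addgt0Pr => e e0; rewrite add0r.
  have [rho rho0 rhoP] := su (e / (pi *+ 2)) (divr_gt0 e0 pi2_gt0).
  have := @Rintegral_itv_near_cst (u rho) 0 (pi *+ 2) c _ (ltW pi2_gt0) (cu rho)
    (fun x _ => rhoP x).
  by rewrite (iu rho rho0) subr0 divfK ?lt0r_neq0// mulrC.
have gI := periodic_integral_vertical eg per.
apply/eqP; rewrite eq_complex /circle_derivative cReM cImM /= !mul0r subr0 addr0.
under eq_Rintegral do rewrite -gE.
under [X in _ && (_ == _ * X)]eq_Rintegral do rewrite -gE.
have smallRe (e : R) : 0 < e ->
    exists2 rho : R, rho < 0 & forall t, `|complex.Re (g (rho +i* t)) - complex.Re d| <= e.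
  move=> e0; have [rho rho0 rhoP] := small e e0; exists rho => // t.
  by apply: le_trans (rhoP t); rewrite -cReB Re_le_normc.
have smallIm (e : R) : 0 < e ->
    exists2 rho : R, rho < 0 & forall t, `|complex.Im (g (rho +i* t)) - complex.Im d| <= e.
  move=> e0; have [rho rho0 rhoP] := small e e0; exists rho => // t.
  by apply: le_trans (rhoP t); rewrite -cImB Im_le_normc.
have kRe := key _ _ cRe smallRe (fun rho h => (gI rho h).1).
have kIm := key _ _ cIm smallIm (fun rho h => (gI rho h).2).
by apply/andP; split; apply/eqP; [exact: kRe|exact: kIm].
Qed.

End derivative_by_circle_average.

Section derivative_under_integral.
Local Open Scope complex_scope.
Context {R : realType}.
Local Notation mu := (@lebesgue_measure R).

Lemma is_derive_Rintegral (D : set R) (u u' : R -> R -> R) (G : R -> R) (s r : R) :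
  measurable D -> 0 < r -> (forall x, `|x - s| < r -> mu.-integrable D (EFin \o u x)) ->
  (forall x y, `|x - s| < r -> D y -> is_derive x 1 (u^~ y) (u' x y)) ->
  (forall y, 0 <= G y) -> mu.-integrable D (EFin \o G) ->
  (forall x y, `|x - s| < r -> D y -> `|u' x y| <= G y) ->
  is_derive s 1 (fun x => \int[mu]_(y in D) u x y) (\int[mu]_(y in D) u' s y).
Proof.
move=> mD r0 iu du G0 iG uG.
have sI : `]s - r, s + r[%classic s by rewrite /= in_itv/=; lra.
have nI (x : R) : `]s - r, s + r[%classic x -> `|x - s| < r.
  by rewrite /= in_itv/= ltr_norml => h; lra.
have ss : `|s - s| < r by rewrite subrr normr0.
have dE (x y : R) : `]s - r, s + r[%classic x -> D y -> partial1of2 u x y = u' x y.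
  by move=> /nI sx Dy; have := du x y sx Dy => d; rewrite partial1of2E derive_val.
have h1 (x : R) : `]s - r, s + r[%classic x -> mu.-integrable D (EFin \o u x) by move=> /nI; exact: iu.
have h2 (x y : R) : `]s - r, s + r[%classic x -> D y -> derivable (u^~ y) x 1.
  by move=> /nI sx Dy; have := du x y sx Dy => d; exact: ex_derive.
have h3 (x y : R) : `]s - r, s + r[%classic x -> D y -> `|partial1of2 u x y| <= G y.
  by move=> sx Dy; rewrite dE//; apply: uG => //; exact: nI.
apply: DeriveDef.
  refine (@derivable_under_integral R _ (measurableTypeR R) mu u D mD s (s - r) (s + r) sI h1 h2 G G0 iG h3).
rewrite -derive1E (@differentiation_under_integral R _ (measurableTypeR R) mu u D mD s (s - r) (s + r) sI h1 h2 G G0 iG h3).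
by apply: eq_Rintegral => y /set_mem Dy; exact: dE.
Qed.

End derivative_under_integral.

Section iterated_circle_derivative.
Local Open Scope complex_scope.
Variable R : realType.
Local Notation C := R[i].
Local Notation mu := (@lebesgue_measure R).
Local Notation nc := (@Normc.normc R).
Local Notation circ := (@circ R).
Local Notation T := (@circle_derivative R).
Implicit Types (f g : C -> C) (z w a d : C).

Definition bounded_on_disc f (rho M : R) := forall z, nc z <= rho -> nc (f z) <= M.

Definition lipschitz_on_discs f := forall rho : R, exists2 L : R, 0 <= L &
  forall z w, nc z <= rho -> nc w <= rho -> nc (f z - f w) <= L * nc (z - w).

Definition real_derivative f g := forall z (s : R),
  is_derive s 1 (fun s => complex.Re (f (z + s%:C))) (complex.Re (g (z + s%:C))) /\
  is_derive s 1 (fun s => complex.Im (f (z + s%:C))) (complex.Im (g (z + s%:C))).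

Definition circle_smooth f := lipschitz_on_discs f /\ real_derivative f (T f).

Definition circle_continuous f := forall z,
  continuous (fun t => complex.Re (f (z + circ t))) /\
  continuous (fun t => complex.Im (f (z + circ t))).

Lemma continuous_of_normc (u : R -> C) :
  (forall t e, 0 < e -> \forall s \near t, nc (u t - u s) <= e) ->
  continuous (fun t => complex.Re (u t)) /\ continuous (fun t => complex.Im (u t)).
Proof.
move=> cu; split=> t; apply/cvgrPdist_le => e e0; apply: filterS (cu t e e0) => s.
  by apply: le_trans; rewrite -cReB Re_le_normc.
by apply: le_trans; rewrite -cImB Im_le_normc.
Qed.

Lemma circ_near (t e : R) : 0 < e -> \forall s \near t, nc (circ t - circ s) <= e.
Proof.
move=> e0; have e20 : 0 < e / 2 by rewrite divr_gt0.
near=> s; apply: (le_trans (normc_le_ReIm _)); rewrite cReB cImB /=.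
rewrite (splitr e) lerD//.
  by near: s; move: (e / 2) e20; apply/cvgrPdist_le; exact: continuous_cos.
by near: s; move: (e / 2) e20; apply/cvgrPdist_le; exact: continuous_sin.
Unshelve. all: end_near. Qed.

Lemma normc_add_circ z (t rho : R) : nc z <= rho -> nc (z + circ t) <= rho + 1.
Proof. by move=> h; rewrite (le_trans (ler_normcD _ _))// normc_circ lerD2r. Qed.

Lemma lipschitz_circle_continuous f : lipschitz_on_discs f -> circle_continuous f.
Proof.
move=> lf z; have [L L0 LP] := lf (nc z + 1).
apply: (@continuous_of_normc (fun t => f (z + circ t))) => t e e0.
have L1 : 0 < L + 1 by rewrite ltr_wpDl.
have := circ_near t (divr_gt0 e0 L1); apply: filterS => s.
rewrite ler_pdivlMr// => hs.
apply: le_trans (LP _ _ (normc_add_circ _ (lexx _)) (normc_add_circ _ (lexx _))) _.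
rewrite (_ : z + circ t - (z + circ s) = circ t - circ s); last by ring.
by apply: le_trans hs; rewrite mulrC ler_wpM2l ?normc_ge0// lerDl.
Qed.

Lemma entire_circle_continuous f : entire f -> circle_continuous f.
Proof.
move=> ef z; apply: (@continuous_of_normc (fun t => f (z + circ t))) => t e e0.
have [d fd] := derivable_cdiff (ef (z + circ t)).
have [r r0 rP] := cdiff_continuous fd e0.
have := circ_near t r0; apply: filterS => s hs.
have := rP (circ s - circ t); rewrite -normc_opp opprB => /(_ hs).
by rewrite -normc_opp opprB (_ : z + circ t + (circ s - circ t) = z + circ s)//; ring.
Qed.

Lemma circle_kernelE f z t :
  complex.Re (circle_kernel f z t) =
    complex.Re (f (z + circ t) - f z) * cos t + complex.Im (f (z + circ t) - f z) * sin t /\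
  complex.Im (circle_kernel f z t) =
    complex.Im (f (z + circ t) - f z) * cos t - complex.Re (f (z + circ t) - f z) * sin t.
Proof.
rewrite /circle_kernel cReM cImM /=; split; first by rewrite mulrN opprK.
by rewrite mulrN addrC.
Qed.

Lemma circle_kernel_continuous f z : circle_continuous f ->
  continuous (fun t => complex.Re (circle_kernel f z t)) /\
  continuous (fun t => complex.Im (circle_kernel f z t)).
Proof.
move=> cf; have [c1 c2] := cf z; split=> t.
  under eq_fun do rewrite (circle_kernelE f z _).1 cReB cImB.
  apply: cvgD; apply: cvgM; try exact: continuous_cos; try exact: continuous_sin.
    by apply: cvgB; [exact: c1|exact: cvg_cst].
  by apply: cvgB; [exact: c2|exact: cvg_cst].
under eq_fun do rewrite (circle_kernelE f z _).2 cReB cImB.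
apply: cvgB; apply: cvgM; try exact: continuous_cos; try exact: continuous_sin.
  by apply: cvgB; [exact: c2|exact: cvg_cst].
by apply: cvgB; [exact: c1|exact: cvg_cst].
Qed.

Lemma normc_circle_kernel f z t : nc (circle_kernel f z t) = nc (f (z + circ t) - f z).
Proof.
by rewrite /circle_kernel Normc.normcM /= sqrrN cos2Dsin2 sqrtr1 mulr1.
Qed.

Let pi2_gt0 : 0 < pi *+ 2 :> R.
Proof. by rewrite mulrn_wgt0// pi_gt0. Qed.

Lemma circle_derivativeE f z :
  complex.Re (T f z) =
    (pi *+ 2)^-1 * \int[mu]_(t in `[0, pi *+ 2]) complex.Re (circle_kernel f z t) /\
  complex.Im (T f z) =
    (pi *+ 2)^-1 * \int[mu]_(t in `[0, pi *+ 2]) complex.Im (circle_kernel f z t).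
Proof. by rewrite /T cReM cImM /= !mul0r subr0 addr0. Qed.

Lemma circle_derivative_le f z (M : R) : circle_continuous f ->
  (forall t, nc (f (z + circ t) - f z) <= M) -> nc (T f z) <= 2 * M.
Proof.
move=> cf fM; have [c1 c2] := circle_kernel_continuous z cf.
apply: (le_trans (normc_le_ReIm _)); rewrite mulr_natl mulr2n.
rewrite (circle_derivativeE f z).1 (circle_derivativeE f z).2.
have pin : `|(pi *+ 2)^-1 : R| = (pi *+ 2)^-1 by rewrite ger0_norm// invr_ge0 ltW.
rewrite lerD// normrM pin mulrC ler_pdivrMr//.
  rewrite -[X in _ <= _ * X]subr0; apply: normr_Rintegral_itv_le => //; first exact: ltW.
  by move=> t _; rewrite (le_trans (Re_le_normc _))// normc_circle_kernel.
rewrite -[X in _ <= _ * X]subr0; apply: normr_Rintegral_itv_le => //; first exact: ltW.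
by move=> t _; rewrite (le_trans (Im_le_normc _))// normc_circle_kernel.
Qed.

Lemma circle_derivative_bounded f (rho M : R) : circle_continuous f ->
  bounded_on_disc f (rho + 1) M -> bounded_on_disc (T f) rho (4 * M).
Proof.
move=> cf fM z hz; rewrite (_ : 4 * M = 2 * (M + M)); last by ring.
apply: circle_derivative_le => // t.
rewrite (le_trans (ler_normcB _ _))// lerD//; apply: fM.
  exact: normc_add_circ.
by rewrite (le_trans hz)// lerDl.
Qed.

Lemma lipschitz_bounded_on_disc f (rho : R) : lipschitz_on_discs f ->
  exists M, bounded_on_disc f rho M.
Proof.
move=> lf; have [L L0 LP] := lf (Num.max 0 rho).
exists (L * Num.max 0 rho + nc (f 0)) => z hz.
rewrite -[f z](subrK (f 0)) (le_trans (ler_normcD _ _))// lerD2r.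
have hz' : nc z <= Num.max 0 rho by rewrite le_max hz orbT.
apply: (le_trans (LP z 0 hz' _)); first by rewrite Normc.normc0 le_max lexx.
by rewrite subr0 ler_wpM2l.
Qed.

Lemma entire_circle_smooth f : entire f ->
  (forall rho : R, exists M, bounded_on_disc f rho M) -> circle_smooth f.
Proof.
move=> ef bf; have cf := entire_circle_continuous ef.
have fd z : cdiff f z (T f z).
  by have [d dd] := derivable_cdiff (ef z); rewrite -(circle_derivativeP ef dd).
split=> [rho|z s]; last first.
  have := @cdiff_line R f z 1 (T f (z + s%:C)) s; rewrite !mulr1 => /(_ (fd _))[h1 h2].
  by split; [move: h1|move: h2]; under eq_fun do rewrite mulr1.
have [M MP] := bf (rho + 1).
have TM := circle_derivative_bounded cf MP.
exists (8 * Num.max 0 M); first by rewrite mulr_ge0// le_max lexx.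
move=> z w hz hw; pose v := z - w.
have seg (s : R) : 0 <= s <= 1 -> nc (w + s%:C * v) <= rho.
  move=> /andP[s0 s1].
  rewrite (_ : _ + _ = s%:C * z + (1 - s)%:C * w); last first.
    by rewrite /v (rmorphB (real_complex R)) rmorph1; ring.
  rewrite (le_trans (ler_normcD _ _))// !Normc.normcM !normcR !ger0_norm ?subr_ge0//.
  have h1 : s * nc z <= s * rho by rewrite ler_wpM2l.
  have h2 : (1 - s) * nc w <= (1 - s) * rho by rewrite ler_wpM2l// subr_ge0.
  by apply: (le_trans (lerD h1 h2)); rewrite -mulrDl addrC subrK mul1r.
have dv (s : R) : 0 <= s <= 1 -> nc (T f (w + s%:C * v) * v) <= 4 * Num.max 0 M * nc v.
  move=> hs; rewrite Normc.normcM ler_wpM2r ?normc_ge0// (le_trans (TM _ (seg s hs)))//.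
  by rewrite ler_wpM2l// le_max lexx orbT.
have line s := cdiff_line (fd (w + s%:C * v)).
have mvt (u u' : R -> R) : (forall s : R, is_derive s 1 u (u' s)) ->
    (forall s : R, 0 <= s <= 1 -> `|u' s| <= 4 * Num.max 0 M * nc v) ->
    `|u 1 - u 0| <= 4 * Num.max 0 M * nc v.
  move=> du u'le; have cu : {within `[0, 1], continuous u}.
    by apply: derivable_within_continuous => x _; exact: ex_derive.
  have [c c01 ->] := @MVT _ u u' 0 1 ltr01 (fun x _ => du x) cu.
  by rewrite subr0 mulr1 u'le//; move: c01; rewrite in_itv/= => /andP[/ltW-> /ltW->].
have h0 : w + (0 : R)%:C * v = w by rewrite mul0r addr0.
have h1 : w + (1 : R)%:C * v = z by rewrite mul1r addrC subrK.
have hRe := mvt _ _ (fun s => (line s).1) (fun s hs => le_trans (Re_le_normc _) (dv s hs)).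
have hIm := mvt _ _ (fun s => (line s).2) (fun s hs => le_trans (Im_le_normc _) (dv s hs)).
rewrite !h0 !h1 -cReB -cImB -/v in hRe hIm *.
apply: (le_trans (normc_le_ReIm _)); apply: (le_trans (lerD hRe hIm)).
by rewrite -mulrDl -mulrDl (_ : 4 + 4 = 8 :> R)//; ring.
Qed.

Lemma circle_smooth_derivative f : circle_smooth f -> circle_smooth (T f).
Proof.
move=> [lf df]; have cf := lipschitz_circle_continuous lf.
have lT : lipschitz_on_discs (T f).
  move=> rho; have [L L0 LP] := lf (rho + 1).
  exists (4 * L); first by rewrite mulr_ge0.
  move=> z w hz hw.
  have hz1 : nc z <= rho + 1 by rewrite (le_trans hz)// lerDl.
  have hw1 : nc w <= rho + 1 by rewrite (le_trans hw)// lerDl.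
  have kerB t : nc (circle_kernel f z t - circle_kernel f w t) <= 2 * L * nc (z - w).
    rewrite /circle_kernel -mulrBl Normc.normcM /= sqrrN cos2Dsin2 sqrtr1 mulr1.
    rewrite (_ : _ - _ - _ = (f (z + circ t) - f (w + circ t)) - (f z - f w)); last by ring.
    rewrite (le_trans (ler_normcB _ _))// -mulrA mulr_natl mulr2n lerD//; last exact: LP.
    apply: le_trans (LP _ _ (normc_add_circ _ hz) (normc_add_circ _ hw)) _.
    by rewrite (_ : z + circ t - (w + circ t) = z - w)//; ring.
  have [cz1 cz2] := circle_kernel_continuous z cf.
  have [cw1 cw2] := circle_kernel_continuous w cf.
  have comp (u v : R -> R) : continuous u -> continuous v ->
      (forall t, `|u t - v t| <= 2 * L * nc (z - w)) ->
      `|(pi *+ 2)^-1 * \int[mu]_(t in `[0, pi *+ 2]) u t -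
        (pi *+ 2)^-1 * \int[mu]_(t in `[0, pi *+ 2]) v t| <= 2 * L * nc (z - w).
    move=> cu cv uv; rewrite -mulrBr normrM ger0_norm ?invr_ge0 ?(ltW pi2_gt0)//.
    rewrite mulrC ler_pdivrMr// -RintegralB//; try exact: continuous_integrable_itv.
    rewrite -[X in _ <= _ * X]subr0; apply: normr_Rintegral_itv_le => //; first exact: ltW.
    by move=> t; apply: cvgB; [exact: cu|exact: cv].
  rewrite (_ : 4 * L * nc (z - w) = 2 * L * nc (z - w) + 2 * L * nc (z - w)); last by ring.
  apply: (le_trans (normc_le_ReIm _)); rewrite cReB cImB.
  have [-> ->] := circle_derivativeE f z; have [-> ->] := circle_derivativeE f w.
  by apply: lerD; apply: comp => // t; apply: le_trans (kerB t);
    rewrite -?cReB -?cImB ?Re_le_normc ?Im_le_normc.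
split=> // z s.
have cT := lipschitz_circle_continuous lT.
have [M MP] := @lipschitz_bounded_on_disc (T f) (nc z + `|s| + 2) lT.
have sE (x t : R) : z + x%:C + circ t = (z + circ t) + x%:C by ring.
have kd (x t : R) :
    is_derive x 1 (fun x => complex.Re (circle_kernel f (z + x%:C) t))
      (complex.Re (circle_kernel (T f) (z + x%:C) t)) /\
    is_derive x 1 (fun x => complex.Im (circle_kernel f (z + x%:C) t))
      (complex.Im (circle_kernel (T f) (z + x%:C) t)).
  have [d1 d2] := df z x; have [d3 d4] := df (z + circ t) x.
  split.
    under eq_fun do rewrite (circle_kernelE f _ t).1 cReB cImB sE.
    rewrite (circle_kernelE (T f) _ t).1 cReB cImB sE.
    by apply: is_derive_eq; rewrite /GRing.scale/=; ring.
  under eq_fun do rewrite (circle_kernelE f _ t).2 cReB cImB sE.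
  rewrite (circle_kernelE (T f) _ t).2 cReB cImB sE.
  by apply: is_derive_eq; rewrite /GRing.scale/=; ring.
have kle (x t : R) : `|x - s| < 1 -> nc (circle_kernel (T f) (z + x%:C) t) <= M + M.
  move=> xs; rewrite normc_circle_kernel (le_trans (ler_normcB _ _))//.
  have hx : nc (z + x%:C) <= nc z + `|s| + 1.
    rewrite (le_trans (ler_normcD _ _))// -addrA lerD2l normcR.
    by have := ler_normD (x - s) s; rewrite subrK; lra.
  rewrite lerD//; apply: MP; last by rewrite (le_trans hx)// lerD2l ler1n.
  by apply: le_trans (normc_add_circ _ hx) _; rewrite -addrA.
have M0 : 0 <= M + M.
  by apply: le_trans (kle s 0 _); rewrite ?normc_ge0// subrr normr0.
have iM : mu.-integrable `[0, pi *+ 2] (EFin \o (fun=> M + M)).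
  by apply: continuous_integrable_itv; exact: cst_continuous.
split.
  under eq_fun do rewrite (circle_derivativeE f _).1.
  rewrite (circle_derivativeE (T f) _).1.
  apply: is_deriveZ; apply: (@is_derive_Rintegral _ _
    (fun x t => complex.Re (circle_kernel f (z + x%:C) t))
    (fun x t => complex.Re (circle_kernel (T f) (z + x%:C) t)) (fun=> M + M) s 1) => //.
  - by move=> x _; apply: continuous_integrable_itv; exact: (circle_kernel_continuous _ cf).1.
  - by move=> x y _ _; exact: (kd x y).1.
  - by move=> x y xs _; rewrite (le_trans (Re_le_normc _))// kle.
under eq_fun do rewrite (circle_derivativeE f _).2.
rewrite (circle_derivativeE (T f) _).2.
apply: is_deriveZ; apply: (@is_derive_Rintegral _ _
    (fun x t => complex.Im (circle_kernel f (z + x%:C) t))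
    (fun x t => complex.Im (circle_kernel (T f) (z + x%:C) t)) (fun=> M + M) s 1) => //.
- by move=> x _; apply: continuous_integrable_itv; exact: (circle_kernel_continuous _ cf).2.
- by move=> x y _ _; exact: (kd x y).2.
- by move=> x y xs _; rewrite (le_trans (Im_le_normc _))// kle.
Qed.

Lemma circle_smooth_iter f p : circle_smooth f -> circle_smooth (iter p T f).
Proof. by move=> sf; elim: p => //= p; exact: circle_smooth_derivative. Qed.

Lemma derive1n_circle f p : circle_smooth f ->
  derive1n p (fun s : R => complex.Re (f s%:C)) = (fun s => complex.Re (iter p T f s%:C)) /\
  derive1n p (fun s : R => complex.Im (f s%:C)) = (fun s => complex.Im (iter p T f s%:C)).
Proof.
move=> sf; elim: p => // p [ih1 ih2]; rewrite !derive1nS ih1 ih2.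
have [_ h] := circle_smooth_iter p sf.
split; apply/funext => s; rewrite derive1E; have [h1 h2] := h 0 s;
  rewrite !add0r in h1 h2.
  by under eq_fun do rewrite -[_%:C]add0r; rewrite derive_val.
by under eq_fun do rewrite -[_%:C]add0r; rewrite derive_val.
Qed.

Lemma derivable_circle f p : circle_smooth f -> forall s : R,
  derivable (derive1n p (fun s : R => complex.Re (f s%:C))) s 1 /\
  derivable (derive1n p (fun s : R => complex.Im (f s%:C))) s 1.
Proof.
move=> sf s; have [-> ->] := derive1n_circle p sf.
have [_ /(_ 0 s)[h1 h2]] := circle_smooth_iter p sf.
split.
  by under eq_fun do rewrite -[_%:C]add0r; exact: ex_derive.
by under eq_fun do rewrite -[_%:C]add0r; exact: ex_derive.
Qed.

Lemma iter_circle_bounded f (rho M : R) p : circle_smooth f ->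
  bounded_on_disc f (rho + p%:R) M -> bounded_on_disc (iter p T f) rho (4 ^+ p * M).
Proof.
move=> sf; elim: p rho => [|p ih] rho.
  by rewrite addr0 expr0 mul1r.
move=> h; rewrite exprS -mulrA; apply: circle_derivative_bounded.
  exact: lipschitz_circle_continuous (circle_smooth_iter p sf).1.
by apply: ih; rewrite -addrA nat1r.
Qed.

End iterated_circle_derivative.

(** * Integrals of powers on the half-line *)

Lemma integrableU_disjoint (d : measure_display) (T : measurableType d) (R : realType)
    (mu : {measure set T -> \bar R}) (A B : set T) (f : T -> R) : measurable A -> measurable B ->
  [disjoint A & B] -> mu.-integrable A (EFin \o f) -> mu.-integrable B (EFin \o f) ->
  mu.-integrable (A `|` B) (EFin \o f).
Proof.
move=> mA mB AB /integrableP[mf iA] /integrableP[mf' iB].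
have /measurable_EFinP mAB : measurable_fun (A `|` B) f.
  by apply/measurable_funU => //; split; exact/measurable_EFinP.
apply/integrableP; split => //.
rewrite ge0_integral_setU//; first exact: lte_add_pinfty.
exact: measurableT_comp.
Qed.

Section half_line_integrals.
Variable R : realType.
Local Notation mu := (@lebesgue_measure R).
Implicit Types (f F : R -> R) (a b c s u x : R).

Lemma continuous_at_measurable_pos f : (forall x, 0 < x -> {for x, continuous f}) ->
  measurable_fun (`]0, +oo[ : set R) f.
Proof.
move=> cf; apply: open_continuous_measurable_fun => //.
by move=> x; rewrite inE/= in_itv/= andbT; exact: cf.
Qed.

Lemma integrable_bounded_primitive F f (a b : nat -> R) (B : R) :
  (forall n, 0 < a n < b n) -> (forall n, a n.+1 <= a n /\ b n <= b n.+1) ->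
  (forall x, 0 < x -> is_derive x 1 F (f x)) ->
  (forall x, 0 < x -> {for x, continuous f}) -> (forall x, 0 < x -> 0 <= f x) ->
  (forall n, F (b n) - F (a n) <= B) ->
  mu.-integrable (\bigcup_n `[a n, b n]%classic) (EFin \o f).
Proof.
move=> ab abS dF cf f0 FB.
have sub n : `[a n, b n]%classic `<=` `]0, +oo[.
  move=> x /=; rewrite !in_itv/= andbT => /andP[h _].
  by case/andP: (ab n) => a0 _; exact: lt_le_trans h.
have /measurable_EFinP mf := continuous_at_measurable_pos cf.
have nd : nondecreasing_seq (fun n => `[a n, b n]%classic).
  apply/nondecreasing_seqP => n; rewrite subsetEset; apply: subset_itv;
    by rewrite bnd_simp; case: (abS n).
have mn n := measurable_funS (measurable_itv `]0, +oo[) (sub n) mf.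
have pos n x : `[a n, b n]%classic x -> (0 <= (EFin \o f) x)%E.
  by move=> /sub; rewrite /= in_itv/= andbT lee_fin; exact: f0.
have H := @ge0_nondecreasing_set_cvg_integral _ (measurableTypeR R) R (fun n => `[a n, b n]%classic)
  (EFin \o f) mu nd (fun n => measurable_itv _) mn pos.
have le : (\int[mu]_(x in \bigcup_n `[a n, b n]%classic) (EFin \o f) x <= B%:E)%E.
  rewrite -(cvg_lim _ H)//; apply: lime_le; first by apply/cvg_ex; eexists; exact: H.
  apply: nearW => n; have /andP[a0 abn] := ab n.
  rewrite (@continuous_FTC2 _ f F)//.
  - by rewrite -EFinB lee_fin.
  - apply: continuous_in_subspaceT => x; rewrite inE => /sub /=.
    by rewrite in_itv/= andbT; exact: cf.
  - have cF x : 0 < x -> {for x, continuous F}.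
      move=> x0; apply: differentiable_continuous; rewrite -derivable1_diffP.
      by have := dF x x0 => h; exact: ex_derive.
    have b0 := lt_trans a0 abn.
    split.
    + move=> x; rewrite in_itv/= => /andP[h _].
      by have := dF x (lt_trans a0 h) => dh; exact: ex_derive.
    + exact: (cvg_at_right_filter (cF _ a0)).
    + exact: (cvg_at_left_filter (cF _ b0)).
  - move=> x; rewrite in_itv/= => /andP[h _].
    by have := dF x (lt_trans a0 h) => dh; rewrite derive1E derive_val.
apply/integrableP; split.
  apply: measurable_funS mf => //.
  by move=> x [n _]; exact: sub.
apply: (@le_lt_trans _ _ B%:E); last exact: ltry.
apply: le_trans le; rewrite le_eqVlt; apply/orP; left; apply/eqP/eq_integral => x.
by rewrite inE => -[n _ /pos h]; rewrite gee0_abs.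
Qed.

Lemma continuous_powR_pos s x : 0 < x -> {for x, continuous (fun y => y `^ s)}.
Proof.
move=> x0; apply: differentiable_continuous; rewrite -derivable1_diffP.
by have := is_derive1_powR s x0 => h; exact: ex_derive.
Qed.

Lemma is_derive_powR_primitive s x : s + 1 != 0 -> 0 < x ->
  is_derive x 1 (fun y => (s + 1)^-1 * y `^ (s + 1)) (x `^ s).
Proof.
move=> s1 x0; have h := is_derive1_powR (s + 1) x0.
by apply: is_derive_eq; rewrite /GRing.scale/= mulrA mulVf// mul1r addrK.
Qed.

Definition two_power s u x := if x <= 1 then x `^ s else x `^ u.

Lemma two_power_ge0 s u x : 0 <= two_power s u x.
Proof. by rewrite /two_power; case: ifP => _; exact: powR_ge0. Qed.

Lemma integrable_two_power s u : -1 < s -> u < -1 ->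
  mu.-integrable `]0, +oo[ (EFin \o two_power s u).
Proof.
move=> s1 u1.
have sp : 0 < s + 1 by lra.
have un : u + 1 < 0 by lra.
have E : `]0, +oo[%classic = `]0, 1]%classic `|` `]1, +oo[%classic :> set R.
  by rewrite -itv_bndbnd_setU// bnd_simp.
have I1 : mu.-integrable `]0, 1] (EFin \o (fun x => x `^ s)).
  have -> : `]0, 1]%classic = \bigcup_n `[n.+2%:R^-1, 1]%classic :> set R.
    apply/seteqP; split=> x; last first.
      move=> [n _]; rewrite /= !in_itv/= => /andP[h ->]; rewrite andbT.
      by rewrite (lt_le_trans _ h)// invr_gt0.
    rewrite /= in_itv/= => /andP[x0 x1].
    exists (Num.truncn x^-1) => //=; rewrite in_itv/= x1 andbT.
    rewrite -[leRHS]invrK lef_pV2 ?posrE ?invr_gt0//.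
    by rewrite (le_trans (ltW (truncnS_gt _)))// ler_nat.
  apply: (@integrable_bounded_primitive (fun y => (s + 1)^-1 * y `^ (s + 1)) _ _ _ (s + 1)^-1).
  - by move=> n; rewrite invr_gt0 ltr0n/= invf_lt1 ?ltr1n.
  - by move=> n; rewrite lexx lef_pV2 ?posrE// ler_nat.
  - by move=> x x0; apply: is_derive_powR_primitive => //; rewrite gt_eqF.
  - by move=> x x0; exact: continuous_powR_pos.
  - by move=> x _; exact: powR_ge0.
  - move=> n; rewrite powR1 mulr1 gerBl mulr_ge0 ?powR_ge0// invr_ge0 ltW//.
have I2 : mu.-integrable `]1, +oo[ (EFin \o (fun x => x `^ u)).
  apply: (@integrableS _ _ _ mu (\bigcup_n `[1, n.+2%:R]%classic)) => //.
  - exact: bigcup_measurable.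
  - move=> x; rewrite /= in_itv/= andbT => x1.
    exists (Num.truncn x) => //=; rewrite in_itv/= ltW//=.
    by rewrite (le_trans (ltW (truncnS_gt _)))// ler_nat.
  apply: (@integrable_bounded_primitive (fun y => (u + 1)^-1 * y `^ (u + 1)) _ _ _ (- (u + 1)^-1)).
  - by move=> n; rewrite ltr01/= ltr1n.
  - by move=> n; rewrite lexx ler_nat.
  - by move=> x x0; apply: is_derive_powR_primitive => //; rewrite lt_eqF.
  - by move=> x x0; exact: continuous_powR_pos.
  - by move=> x _; exact: powR_ge0.
  - move=> n; rewrite powR1 mulr1 gerDr mulr_le0_ge0 ?powR_ge0// invr_le0 ltW//.
rewrite E; apply: integrableU_disjoint => //.
- rewrite disj_set2E; apply/eqP/seteqP; split=> x // [].
  by rewrite /= !in_itv/= => /andP[_ x1]; rewrite ltNge x1.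
- apply: eq_integrable I1 => // x; rewrite inE/= in_itv/= => /andP[_ x1].
  by rewrite /two_power x1.
- apply: eq_integrable I2 => // x; rewrite inE/= in_itv/= andbT ltNge => x1.
  by rewrite /two_power (negbTE x1).
Qed.

End half_line_integrals.

Section scaling.
Variable R : realType.
Local Notation mu := (@lebesgue_measure R).
Implicit Types (f : R -> R) (c alpha x l : R).

Let itv_exhaust c alpha : 0 < c ->
  `]alpha, +oo[%classic = \bigcup_n `[alpha + c^-1 * n.+1%:R^-1, +oo[%classic :> set R.
Proof.
move=> c0; apply/seteqP; split=> x; last first.
  move=> [n _]; rewrite /= !in_itv/= !andbT; apply: lt_le_trans.
  by rewrite ltrDl mulr_gt0 ?invr_gt0.
rewrite /= in_itv/= andbT -subr_gt0 => x0.
exists (Num.truncn (c * (x - alpha))^-1) => //=; rewrite in_itv/= andbT -lerBrDl.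
rewrite ler_pdivrMl// -[leRHS]invrK lef_pV2 ?posrE ?invr_gt0 ?mulr_gt0//.
exact/ltW/truncnS_gt.
Qed.

Lemma continuous_at_measurable_ray f alpha : (forall x, alpha < x -> {for x, continuous f}) ->
  measurable_fun `]alpha, +oo[ f.
Proof.
move=> cf; apply: open_continuous_measurable_fun => //.
by move=> x; rewrite inE/= in_itv/= andbT; exact: cf.
Qed.

Let integral_exhaust f c alpha : 0 < c -> (forall x, alpha < x -> {for x, continuous f}) ->
  (forall x, alpha < x -> 0 <= f x) ->
  ((\int[mu]_(x in `[(alpha + c^-1 * n.+1%:R^-1)%R, +oo[) (f x)%:E)%E @[n --> \oo] -->
  (\int[mu]_(x in `]alpha, +oo[) (f x)%:E)%E).
Proof.
move=> c0 cf f0; rewrite (itv_exhaust alpha c0).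
have sub n : `[alpha + c^-1 * n.+1%:R^-1, +oo[%classic `<=` `]alpha, +oo[%classic.
  move=> x; rewrite /= !in_itv/= !andbT; apply: lt_le_trans.
  by rewrite ltrDl mulr_gt0 ?invr_gt0.
apply: (@ge0_nondecreasing_set_cvg_integral _ (measurableTypeR R) R) => //.
- apply/nondecreasing_seqP => n; rewrite subsetEset; apply: subset_itvr.
  by rewrite bnd_simp lerD2l ler_pM2l ?invr_gt0// lef_pV2 ?posrE// ler_nat.
- move=> n; apply: measurable_funS (sub n) _ => //.
  by apply/measurable_EFinP; exact: continuous_at_measurable_ray.
- by move=> n x /sub; rewrite /= in_itv/= andbT lee_fin; exact: f0.
Qed.

Lemma integral_scale f c alpha : 0 < c -> (forall x, 0 < x -> {for x, continuous f}) ->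
  (forall x, 0 < x -> 0 <= f x) ->
  (\int[mu]_(x in `]0%R, +oo[) (f x)%:E =
   \int[mu]_(l in `]alpha, +oo[) (f (c * (l - alpha)) * c)%R%:E)%E.
Proof.
move=> c0 cf f0.
pose F l := c * (l - alpha).
have dF l : is_derive l 1 F c.
  by rewrite /F; apply: is_derive_eq; rewrite /GRing.scale/=; ring.
have F' : F^`()%classic = fun=> c by apply/funext => l; rewrite derive1E derive_val.
have Fpos l : alpha < l -> 0 < F l by move=> h; rewrite mulr_gt0// subr_gt0.
have cF : continuous F.
  move=> l; apply: differentiable_continuous; rewrite -derivable1_diffP.
  exact: ex_derive.
have H1 := @integral_exhaust f 1 0 ltr01 cf f0.
have H2 : ((\int[mu]_(x in `[(alpha + c^-1 * n.+1%:R^-1)%R, +oo[) (f (c * (x - alpha)) * c)%R%:E)%E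
    @[n --> \oo] --> (\int[mu]_(x in `]alpha, +oo[) (f (c * (x - alpha)) * c)%R%:E)%E).
  apply: integral_exhaust => // x hx.
    apply: continuousM; last exact: cst_continuous.
    by apply: continuous_comp; [exact: cF|exact/cf/Fpos].
  by rewrite mulr_ge0 ?(ltW c0)// f0// Fpos.
apply: (cvg_unique (@ereal_hausdorff R) H1); apply: cvg_trans _ H2.
apply: near_eq_cvg; apply: nearW => n; rewrite add0r invr1 mul1r.
set e := n.+1%:R^-1; have e0 : 0 < e :> R by rewrite invr_gt0.
have Fa : F (alpha + c^-1 * e) = e.
  by rewrite /F addrAC subrr add0r mulrA divff ?gt_eqF// mul1r.
rewrite [RHS](_ : _ = \int[mu]_(x in `[F (alpha + c^-1 * e)%R, +oo[) (f x)%:E)%E; last by rewrite Fa.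
rewrite (@increasing_ge0_integration_by_substitutiony _ F f)//.
- by apply: eq_integral => x _; rewrite F'.
- by move=> x y _ _ xy; rewrite /F ltr_pM2l// ltrD2r.
- by rewrite F' => x _; exact: cst_continuous.
- by rewrite F'; exact: is_cvg_cst.
- by rewrite F'; exact: is_cvg_cst.
- by split=> [x _|]; [exact: ex_derive|apply: cvg_at_right_filter; exact: cF].
- apply: gt0_cvgMry => //.
  exact: cvg_addrr.
- rewrite Fa; apply: continuous_in_subspaceT => x; rewrite inE/= in_itv/= andbT => h.
  by apply: cf; exact: lt_le_trans h.
- by rewrite Fa => x; rewrite in_itv/= andbT => h; apply: f0; exact: lt_trans h.
Qed.

Lemma Rintegral_scale f c alpha : 0 < c -> (forall x, 0 < x -> {for x, continuous f}) ->
  (forall x, 0 < x -> 0 <= f x) ->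
  \int[mu]_(x in `]0, +oo[) f x = c * \int[mu]_(l in `]alpha, +oo[) f (c * (l - alpha)).
Proof.
move=> c0 cf f0; rewrite /Rintegral (integral_scale alpha c0 cf f0).
rewrite [X in fine X = _](_ : _ =
  \int[mu]_(l in `]alpha, +oo[) ((f (c * (l - alpha)))%R%:E * c%:E))%E//.
rewrite ge0_integralZr//.
- have : (0 <= \int[mu]_(x in `]alpha, +oo[) (f (c * (x - alpha)))%R%:E)%E.
    apply: integral_ge0 => x; rewrite /= in_itv/= andbT => h.
    by rewrite lee_fin f0// mulr_gt0// subr_gt0.
  case: (\int[mu]_(x in _) _)%E => [y _| _|//] /=; first by rewrite mulrC.
  by rewrite gt0_mulye ?lte_fin// mulr0.
- apply/measurable_EFinP; apply: continuous_at_measurable_ray => x hx.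
  apply: continuous_comp; last by apply: cf; rewrite mulr_gt0// subr_gt0.
  apply: continuousM; first exact: cst_continuous.
  by apply: continuousB => //; exact: cst_continuous.
- move=> x; rewrite /= in_itv/= andbT => h.
  by rewrite lee_fin f0// mulr_gt0// subr_gt0.
- by rewrite lee_fin ltW.
Qed.

Lemma integrable_shift f alpha : (forall x, 0 < x -> {for x, continuous f}) ->
  (forall x, 0 < x -> 0 <= f x) ->
  mu.-integrable `]0, +oo[ (EFin \o f) ->
  mu.-integrable `]alpha, +oo[ (EFin \o (fun l => f (l - alpha))).
Proof.
move=> cf f0 /integrableP[_ fi]; apply/integrableP; split.
  apply/measurable_EFinP; apply: continuous_at_measurable_ray => x hx.
  apply: continuous_comp; last by apply: cf; rewrite subr_gt0.
  by apply: continuousB => //; exact: cst_continuous.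
apply: le_lt_trans fi; rewrite le_eqVlt; apply/orP; left; apply/eqP.
rewrite [RHS](_ : _ = \int[mu]_(x in `]0%R, +oo[) (f x)%:E)%E; last first.
  apply: eq_integral => x; rewrite inE/= in_itv/= andbT => h.
  by rewrite ger0_norm// f0.
rewrite (integral_scale alpha ltr01 cf f0); apply: eq_integral => x.
rewrite inE/= in_itv/= andbT => h; rewrite mul1r mulr1 ger0_norm// f0//.
by rewrite subr_gt0.
Qed.

Lemma two_power_min (s u x : R) : u <= s -> 0 < x -> two_power s u x = Num.min (x `^ s) (x `^ u).
Proof.
move=> us x0; rewrite /two_power; case: (leP x 1) => [x1|/ltW x1].
  by apply/esym/min_idPl; apply: ger_powR => //; rewrite x0.
by apply/esym/min_idPr; exact: ler_powR.
Qed.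

Lemma continuous_two_power (s u x : R) : u <= s -> 0 < x ->
  {for x, continuous (two_power s u)}.
Proof.
move=> us x0.
have c : {for x, continuous (fun y => (y `^ s + y `^ u - `|y `^ s - y `^ u|) / 2)}.
  apply: continuousM; last exact: cst_continuous.
  apply: continuousB.
    by apply: continuousD; exact: continuous_powR_pos.
  apply: continuous_comp; last exact: norm_continuous.
  by apply: continuousB; exact: continuous_powR_pos.
move: c; rewrite /prop_for /continuous_at => c.
have E y : 0 < y -> (y `^ s + y `^ u - `|y `^ s - y `^ u|) / 2 = two_power s u y.
  by move=> y0; rewrite two_power_min// minr_absE.
rewrite -E//; apply: cvg_trans _ c; apply: near_eq_cvg.
near=> y; rewrite E//; near: y; exact: lt_nbhsr.
Unshelve. all: end_near. Qed.


End scaling.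

(** * The Gamma function *)

Section exponential_remainder.
Variable R : realType.
Local Notation mu := (@lebesgue_measure R).
Implicit Types (m n p : nat) (x y c k : R).

Definition exp_rem m y : R := expR (- y) - \sum_(p < m) p`!%:R^-1 * (- y) ^+ p.

Lemma exp_rem0 y : exp_rem 0 y = expR (- y).
Proof. by rewrite /exp_rem big_ord0 subr0. Qed.

Lemma exp_remS m y : exp_rem m.+1 y = exp_rem m y - m`!%:R^-1 * (- y) ^+ m.
Proof. by rewrite /exp_rem big_ord_recr /= opprD addrA. Qed.

Lemma exp_rem_at0 m : exp_rem m.+1 0 = 0.
Proof.
elim: m => [|m ih]; rewrite exp_remS.
  by rewrite exp_rem0 oppr0 expR0 fact0 invr1 mul1r expr0 subrr.
by rewrite ih oppr0 expr0n /= mulr0 subrr.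
Qed.

Lemma is_derive_oppX n y :
  is_derive y 1 (fun z : R => (- z) ^+ n) (- (n%:R * (- y) ^+ n.-1)).
Proof.
have h : is_derive (- y) 1 (fun z : R => z ^+ n) (n%:R * (- y) ^+ n.-1).
  apply: DeriveDef; first exact: exprn_derivable.
  by rewrite exp_derive scaler1.
have := @is_derive1_comp R (fun z => z ^+ n) (fun z => - z) y _ _ h (is_deriveNid y 1).
by rewrite mulrN1.
Qed.

Lemma is_derive_exp_rem m y : is_derive y 1 (exp_rem m) (- exp_rem m.-1 y).
Proof.
elim: m => [|m ih].
  rewrite (_ : exp_rem 0 = fun y => expR (- y)); last by apply/funext => z; exact: exp_rem0.
  have := @is_derive1_comp R expR (fun z => - z) y _ _ (is_derive_expR _) (is_deriveNid y 1).
  by rewrite mulrN1.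
rewrite (_ : exp_rem m.+1 = fun z => exp_rem m z - m`!%:R^-1 * (- z) ^+ m); last first.
  by apply/funext => z; exact: exp_remS.
have h : is_derive y 1 (fun z => m`!%:R^-1 * (- z) ^+ m)
    (m`!%:R^-1 * - (m%:R * (- y) ^+ m.-1)).
  exact: is_deriveZ (is_derive_oppX m y).
have := is_deriveB ih h; congr (is_derive _ _ _ _).
case: m {ih h} => [|m] /=; first by rewrite mul0r oppr0 mulr0 subr0.
rewrite exp_remS factS natrM invfM.
have m0 : m.+1%:R != 0 :> R by rewrite pnatr_eq0.
have mf0 : m`!%:R != 0 :> R by rewrite pnatr_eq0 -lt0n fact_gt0.
by field; rewrite nat1r m0 mf0.
Qed.

Lemma exp_rem_mvt m y : 0 < y -> exists2 c, 0 < c < y & exp_rem m.+1 y = - exp_rem m c * y.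
Proof.
move=> y0; have cE : {within `[0, y], continuous (exp_rem m.+1)}.
  apply: derivable_within_continuous => x _.
  by have h := is_derive_exp_rem m.+1 x; exact: ex_derive.
have [c] := @MVT R (exp_rem m.+1) _ 0 y y0 (fun x _ => is_derive_exp_rem m.+1 x) cE.
by rewrite in_itv/= exp_rem_at0 !subr0 => cy ->; exists c.
Qed.

Lemma exp_rem_sign m y : 0 <= y -> 0 <= (-1) ^+ m * exp_rem m y.
Proof.
elim: m y => [|m ih] y y0; first by rewrite exp_rem0 expr0 mul1r expR_ge0.
move: y0; rewrite le_eqVlt => /predU1P[<-|y0]; first by rewrite exp_rem_at0 mulr0.
have [c /andP[c0 cy] ->] := exp_rem_mvt m y0.
by rewrite exprS mulN1r mulNr mulNr mulrN opprK mulrA mulr_ge0 ?(ltW y0)// ih// ltW.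
Qed.

Lemma exp_rem_le m y : 0 <= y -> `|exp_rem m y| <= y ^+ m.
Proof.
elim: m y => [|m ih] y y0.
  by rewrite exp_rem0 expr0 ger0_norm ?expR_ge0// -expR0 ler_expR oppr_le0.
move: y0; rewrite le_eqVlt => /predU1P[<-|y0]; first by rewrite exp_rem_at0 normr0 exprn_ge0.
have [c /andP[c0 cy] ->] := exp_rem_mvt m y0.
rewrite normrM normrN (ger0_norm (ltW y0)) exprSr ler_pM ?normr_ge0 ?(ltW y0)//.
by rewrite (le_trans (ih c (ltW c0)))// lerXn2r ?nnegrE ?(ltW c0) ?(ltW y0)// ltW.
Qed.

Lemma exp_remS_le m y : 0 <= y -> `|exp_rem m.+1 y| <= 2 * y ^+ m.
Proof.
move=> y0; rewrite exp_remS (le_trans (ler_normB _ _))// mulr_natl mulr2n lerD ?exp_rem_le//.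
rewrite normrM normrX normrN (ger0_norm y0) ger0_norm ?invr_ge0//.
by rewrite ler_piMl ?exprn_ge0// invf_le1 ?ler1n ?ltr0n fact_gt0.
Qed.

Lemma expRN_le n y : 0 < y -> expR (- y) <= n`!%:R * y ^- n.
Proof.
move=> y0; rewrite expRN -invf_div lef_pV2 ?posrE ?expR_gt0//; last first.
  by rewrite divr_gt0 ?exprn_gt0// ltr0n fact_gt0.
case: n => [|n]; first by rewrite expr0 fact0 divr1 -expR0 ler_expR ltW.
by apply: le_trans (expR_ge1Dxn n (ltW y0)); rewrite lerDr.
Qed.

Lemma exp_rem_continuous m : continuous (exp_rem m).
Proof.
move=> x; apply: differentiable_continuous; rewrite -derivable1_diffP.
by have h := is_derive_exp_rem m x; exact: ex_derive.
Qed.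

(* [m] is the number of Taylor terms used in regularizing [x ^ (- k - 1)]. *)
Definition regular_order m k := k < m%:R /\ (m = 0%N \/ m%:R - 1 < k).

Lemma regular_orderS m k : regular_order m.+1 k -> regular_order m (k - 1) /\ 0 < k.
Proof.
move=> [km [//|]]; rewrite -natr1 addrK => mk; split; last exact: le_lt_trans mk.
split; first by rewrite ltrBlDr natr1.
by right; rewrite ltrD2r.
Qed.

Lemma taylor_terms_regular k : ~ (exists m : nat, k = m%:R) ->
  regular_order (taylor_terms k) k.
Proof.
move=> kN; rewrite /taylor_terms; case: ltP => [k0|k0]; first by split; [|left].
split; first exact: truncnS_gt.
right; rewrite -natr1 addrK lt_neqAle; apply/andP; split; last by rewrite truncn_le.
by apply/eqP => E; apply: kN; exists (Num.truncn k).
Qed.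

Lemma powR_mul_expn (s x : R) n : 0 < x -> x `^ s * x ^+ n = x `^ (s + n%:R).
Proof.
move=> x0; rewrite powRD; last by apply/implyP => _; exact: lt0r_neq0.
by rewrite powR_mulrn// ltW.
Qed.

Lemma powR_mul_expNn (s x : R) n : 0 < x -> x `^ s * x ^- n = x `^ (s - n%:R).
Proof.
move=> x0; rewrite powRB; last by apply/implyP => _; exact: lt0r_neq0.
by rewrite powR_mulrn// ltW.
Qed.

Definition decay_exponent m k : R :=
  if m is 0%N then - k - 1 - (Num.truncn (- k)).+1%:R else m%:R - 2 - k.

Lemma regular_exponents m k : regular_order m k ->
  -1 < m%:R - k - 1 /\ decay_exponent m k < -1 /\ decay_exponent m k <= m%:R - k - 1.
Proof.
move=> [km h]; suff : -1 < m%:R - k - 1 /\ decay_exponent m k < -1.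
  by move=> [h1 h2]; split => //; split => //; rewrite ltW// (lt_trans h2).
split; first by rewrite ltrBrDr addrC subrr subr_gt0.
rewrite /decay_exponent; case: m km h => [|m] km h.
  have := truncnS_gt (- k); set N := _%:R; lra.
by case: h => // h; lra.
Qed.

Lemma regular_integrand_le m k (c1 c2 : R) : regular_order m k -> 0 < c1 -> c1 <= c2 ->
  exists2 K : R, 0 <= K & forall x c, 0 < x -> c1 <= c <= c2 ->
   `|x `^ (- k - 1) * exp_rem m (c * x)| <= K * two_power (m%:R - k - 1) (decay_exponent m k) x.
Proof.
move=> mk c10 c12; have c20 : 0 < c2 by exact: lt_le_trans c12.
pose N := (Num.truncn (- k)).+1.
pose K1 := c2 ^+ m; pose K2 := 2 * c2 ^+ m.-1; pose K3 := N`!%:R * c1 ^- N.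
have K10 : 0 <= K1 by rewrite exprn_ge0// ltW.
have K20 : 0 <= K2 by rewrite mulr_ge0// exprn_ge0// ltW.
have K30 : 0 <= K3 by rewrite mulr_ge0// invr_ge0 exprn_ge0// ltW.
exists (K1 + K2 + K3); first by rewrite !addr_ge0.
move=> x c x0 /andP[cc1 cc2]; have c0 : 0 < c by exact: lt_le_trans cc1.
have cx0 : 0 < c * x by rewrite mulr_gt0.
rewrite normrM (ger0_norm (powR_ge0 _ _)) /two_power; case: ifPn => [x1|].
  apply: (@le_trans _ _ (K1 * x `^ (m%:R - k - 1))); last first.
    by rewrite ler_wpM2r ?powR_ge0// -addrA lerDl addr_ge0.
  rewrite (_ : m%:R - k - 1 = - k - 1 + m%:R); last by ring.
  rewrite -powR_mul_expn// mulrCA ler_wpM2l ?powR_ge0//.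
  rewrite (le_trans (exp_rem_le _ (ltW cx0)))// exprMn ler_wpM2r ?exprn_ge0 ?(ltW x0)//.
  by rewrite lerXn2r ?nnegrE// ltW.
rewrite -ltNge => x1; rewrite /decay_exponent.
case: m {mk} @K1 @K2 K10 K20 => [|m] K1 K2 K10 K20.
  apply: (@le_trans _ _ (K3 * x `^ (- k - 1 - N%:R))); last first.
    by rewrite ler_wpM2r ?powR_ge0// lerDr addr_ge0.
  rewrite -powR_mul_expNn// mulrCA ler_wpM2l ?powR_ge0//.
  rewrite exp_rem0 ger0_norm ?expR_ge0// (le_trans (expRN_le N cx0))//.
  rewrite -mulrA ler_wpM2l// exprMn invfM ler_wpM2r ?invr_ge0 ?exprn_ge0 ?(ltW x0)//.
  by rewrite lef_pV2 ?posrE ?exprn_gt0// lerXn2r ?nnegrE ?(ltW c10) ?(ltW c0).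
apply: (@le_trans _ _ (K2 * x `^ (m.+1%:R - 2 - k))); last first.
  by rewrite ler_wpM2r ?powR_ge0// addrAC lerDr addr_ge0.
rewrite (_ : m.+1%:R - 2 - k = - k - 1 + m%:R); last by rewrite -natr1; ring.
rewrite -powR_mul_expn// mulrCA ler_wpM2l ?powR_ge0//.
rewrite (le_trans (exp_remS_le _ (ltW cx0)))// -mulrA ler_wpM2l// exprMn ler_wpM2r ?exprn_ge0 ?(ltW x0)//.
by rewrite lerXn2r ?nnegrE// ltW.
Qed.

Lemma regular_integrand_continuous m k c x : 0 < x ->
  {for x, continuous (fun x => x `^ (- k - 1) * exp_rem m (c * x))}.
Proof.
move=> x0; apply: continuousM; first exact: continuous_powR_pos.
apply: continuous_comp; last exact: exp_rem_continuous.
by apply: continuousM => //; exact: cst_continuous.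
Qed.

Lemma regular_integrable_shift m k c alpha : regular_order m k -> 0 < c ->
  mu.-integrable `]alpha, +oo[
    (EFin \o (fun l => (l - alpha) `^ (- k - 1) * exp_rem m (c * (l - alpha)))).
Proof.
move=> mk c0; have [h1 [h2 h3]] := regular_exponents mk.
have [K K0 KP] := regular_integrand_le mk c0 (lexx c).
have iT : mu.-integrable `]alpha, +oo[
    (EFin \o (fun x => two_power (m%:R - k - 1) (decay_exponent m k) (x - alpha))).
  apply: integrable_shift => [x x0|x _|]; last exact: integrable_two_power.
    exact: continuous_two_power.
  exact: two_power_ge0.
apply: (@le_integrable _ (measurableTypeR R) _ mu _ _ _
  (fun x => K%:E * (two_power (m%:R - k - 1) (decay_exponent m k) (x - alpha))%:E)%E) => //.
- apply/measurable_EFinP; apply: continuous_at_measurable_ray => x hx.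
  apply: (@continuous_comp _ _ _ (fun x => x - alpha)
    (fun x => x `^ (- k - 1) * exp_rem m (c * x))).
    by apply: continuousB => //; exact: cst_continuous.
  by apply: regular_integrand_continuous; rewrite subr_gt0.
- move=> x; rewrite /= in_itv/= andbT -subr_gt0 => x0; rewrite lee_fin.
  rewrite (le_trans (KP (x - alpha) c x0 _)) ?lexx//.
  by rewrite [leRHS]ger0_norm// mulr_ge0// two_power_ge0.
- by apply: integrableZl.
Qed.

Lemma regular_integrable m k c : regular_order m k -> 0 < c ->
  mu.-integrable `]0, +oo[ (EFin \o (fun x => x `^ (- k - 1) * exp_rem m (c * x))).
Proof.
move=> mk c0; have := regular_integrable_shift 0 mk c0.
by apply: eq_integrable => // x _; rewrite /= subr0.
Qed.

Definition gamma_reg m k := \int[mu]_(x in `]0, +oo[) (x `^ (- k - 1) * exp_rem m x).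

End exponential_remainder.

Section gamma_function.
Variable R : realType.
Local Notation mu := (@lebesgue_measure R).
Implicit Types (m n p : nat) (x y c k : R).

Lemma gamma_reg_scale m k c alpha : regular_order m k -> 0 < c ->
  \int[mu]_(l in `]alpha, +oo[) ((l - alpha) `^ (- k - 1) * exp_rem m (c * (l - alpha))) =
  c `^ k * gamma_reg m k.
Proof.
move=> mk c0; pose f x := (-1) ^+ m * (x `^ (- k - 1) * exp_rem m x).
have fc x : 0 < x -> {for x, continuous f}.
  move=> x0; apply: continuousM; first exact: cst_continuous.
  by apply: continuousM; [exact: continuous_powR_pos|exact: exp_rem_continuous].
have f0 x : 0 < x -> 0 <= f x.
  by move=> x0; rewrite /f mulrCA mulr_ge0 ?powR_ge0// exp_rem_sign// ltW.
have := Rintegral_scale alpha c0 fc f0; rewrite /f RintegralZl//; last first.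
  have := regular_integrable mk (ltr01 : 0 < 1 :> R).
  by apply: eq_integrable => // x _; rewrite /= mul1r.
rewrite -/(gamma_reg m k) => H.
have s2 : (-1) ^+ m * (-1) ^+ m = 1 :> R by rewrite -exprD addnn -mul2n exprM sqrrN !expr1n.
rewrite -[gamma_reg m k]mul1r -[in X in _ = _ * (X * _)]s2 -mulrA H.
rewrite (_ : \int[mu]_(l in `]alpha, +oo[) ((-1) ^+ m * ((c * (l - alpha)) `^ (- k - 1) * exp_rem m (c * (l - alpha)))) =
  \int[mu]_(l in `]alpha, +oo[) (((-1) ^+ m * c `^ (- k - 1)) * ((l - alpha) `^ (- k - 1) * exp_rem m (c * (l - alpha))))); last first.
  apply: eq_Rintegral => l; rewrite inE/= in_itv/= andbT -subr_gt0 => l0.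
  by rewrite powRM ?ltW//; ring.
rewrite RintegralZl//; last exact: regular_integrable_shift.
set I := Rintegral _ _ _; move: s2; generalize ((-1) ^+ m : R) => s s2.
rewrite [RHS](_ : _ = s * s * (c `^ k * (c `^ (- k - 1) * c ^+ 1)) * I); last by ring.
rewrite s2 powR_mul_expn// subrK -powRD; last by apply/implyP => _; exact: lt0r_neq0.
by rewrite subrr powRr0 !mul1r.
Qed.

Lemma gamma_reg_rec m k : regular_order m.+1 k ->
  k * gamma_reg m.+1 k = - gamma_reg m (k - 1).
Proof.
move=> mk; have [mk1 k0] := regular_orderS mk.
have [h1 [h2 _]] := regular_exponents mk1.
have half0 : 0 < 2^-1 :> R by rewrite invr_gt0.
have [|K K0 KP] := @regular_integrand_le R m (k - 1) 2^-1 2 mk1 half0.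
  by rewrite invf_ple ?posrE//; lra.
pose G x := K * two_power (m%:R - (k - 1) - 1) (decay_exponent m (k - 1)) x.
have cpos c : `|c - 1| < 2^-1 -> 2^-1 <= c <= 2.
  by rewrite ltr_norml; lra.
have D : is_derive (1 : R) 1
    (fun c => \int[mu]_(x in `]0, +oo[) (x `^ (- k - 1) * exp_rem m.+1 (c * x)))
    (\int[mu]_(x in `]0, +oo[) (- (x `^ (- (k - 1) - 1) * exp_rem m (1 * x)))).
  apply: (@is_derive_Rintegral R `]0, +oo[
    (fun c x => x `^ (- k - 1) * exp_rem m.+1 (c * x))
    (fun c x => - (x `^ (- (k - 1) - 1) * exp_rem m (c * x))) G 1 2^-1).
  - exact: measurable_itv.
  - exact: half0.
  - by move=> c /cpos/andP[c0 _]; apply: regular_integrable => //; exact: lt_le_trans c0.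
  - move=> c x _; rewrite /= in_itv/= andbT => x0.
    have h : is_derive c 1 (fun c : R => c * x) x.
      by apply: is_derive_eq; rewrite /GRing.scale/=; ring.
    have h' := @is_derive1_comp R (exp_rem m.+1) (fun c => c * x) c _ _
      (is_derive_exp_rem m.+1 (c * x)) h.
    have := is_deriveZ (x `^ (- k - 1)) h'; congr (is_derive _ _ _ _).
    rewrite /= /GRing.scale/= (_ : - (k - 1) - 1 = - k - 1 + 1%:R); last by ring.
    by rewrite -powR_mul_expn// expr1; ring.
  - by move=> x; rewrite /G mulr_ge0// two_power_ge0.
  - rewrite /G/=; apply: (@integrableZl _ (measurableTypeR R) _ mu _ _ K
      (EFin \o two_power (m%:R - (k - 1) - 1) (decay_exponent m (k - 1)))) => //.
    exact: integrable_two_power.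
  - move=> c x /cpos cc; rewrite /= in_itv/= andbT => x0.
    by rewrite normrN KP.
have D' : is_derive (1 : R) 1 (fun c => c `^ k * gamma_reg m.+1 k) (k * gamma_reg m.+1 k).
  have h := is_derive1_powR k (ltr01 : 0 < 1 :> R).
  by apply: is_derive_eq; rewrite /GRing.scale/= powR1; ring.
have DD : is_derive (1 : R) 1 (fun c => c `^ k * gamma_reg m.+1 k)
    (\int[mu]_(x in `]0, +oo[) (- (x `^ (- (k - 1) - 1) * exp_rem m (1 * x)))).
  apply: near_eq_is_derive D; near=> c.
  have c0 : 0 < c by near: c; exact: lt_nbhsr.
  rewrite -(gamma_reg_scale 0 mk c0); apply: eq_Rintegral => x _.
  by rewrite subr0.
rewrite -(@derive_val _ _ _ _ _ _ _ D') (@derive_val _ _ _ _ _ _ _ DD).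
rewrite (_ : \int[mu]_(x in `]0, +oo[) (- (x `^ (- (k - 1) - 1) * exp_rem m (1 * x))) =
  \int[mu]_(x in `]0, +oo[) (-1 * (x `^ (- (k - 1) - 1) * exp_rem m (1 * x)))); last first.
  by apply: eq_Rintegral => x _; rewrite mulN1r.
rewrite RintegralZl ?mulN1r//; last exact: regular_integrable.
by congr (- _); apply: eq_Rintegral => x _; rewrite mul1r.
Unshelve. all: end_near. Qed.

Lemma gamma_reg_prod m k : regular_order m k ->
  gamma_reg m k * \prod_(i < m) (- k + i%:R) = gamma_integral (- k + m%:R).
Proof.
elim: m k => [|m ih] k mk.
  rewrite big_ord0 mulr1 addr0; apply: eq_Rintegral => x _.
  by rewrite exp_rem0.
have [mk1 k0] := regular_orderS mk.
rewrite big_ord_recl /= addr0 mulrA mulrN mulrC (mulrC _ k) gamma_reg_rec// opprK mulrC.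
rewrite (_ : - k + m.+1%:R = - (k - 1) + m%:R); last by rewrite -natr1; ring.
rewrite -ih//; congr (_ * _); apply: eq_bigr => i _.
by rewrite /bump /= add1n -natr1; ring.
Qed.

Lemma gamma_integral_gt0 x : 0 < x -> 0 < gamma_integral x.
Proof.
move=> x0; have mk : regular_order 0 (- x) by split; [rewrite oppr_lt0|left].
have := regular_integrable mk (ltr01 : 0 < 1 :> R); set f := fun y : R => _ => fi.
have -> : gamma_integral x = \int[mu]_(y in `]0, +oo[) f y.
  by apply: eq_Rintegral => y _; rewrite /f exp_rem0 opprK mul1r.
have sub : (`[1, 2]%classic : set R) `<=` `]0, +oo[%classic.
  by move=> y; rewrite /= !in_itv/= andbT => /andP[y1 _]; exact: lt_le_trans y1.
have fi' : mu.-integrable `[1, 2] (EFin \o f) by apply: integrableS fi.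
have f0 y : 0 < y -> 0 <= f y.
  by move=> y0; rewrite /f mulr_ge0 ?powR_ge0// exp_rem0 expR_ge0.
have H1 : expR (- 2) / 2 * (2 - 1) <= \int[mu]_(y in `[1, 2]) f y.
  rewrite -Rintegral_itv_cst; last by rewrite ler1n.
  apply: le_Rintegral => //; first exact/continuous_integrable_itv/cst_continuous.
  move=> y; rewrite /= in_itv/= => /andP[y1 y2]; rewrite /f exp_rem0 mul1r mulrC.
  have y0 : 0 < y by exact: lt_le_trans y1.
  apply: ler_pM; rewrite ?expR_ge0 ?invr_ge0//; last by rewrite ler_expR lerN2.
  apply: (@le_trans _ _ (y `^ (-1))); last by apply: ler_powR => //; lra.
  by rewrite powR_inv1 ?(ltW y0)// lef_pV2 ?posrE.
have H2 : \int[mu]_(y in `[1, 2]) f y <= \int[mu]_(y in `]0, +oo[) f y.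
  rewrite /Rintegral fine_le//; [exact: integrable_fin_num|exact: integrable_fin_num|].
  apply: ge0_subset_integral => //.
    by apply/measurable_EFinP; apply: continuous_at_measurable_pos => y; exact: regular_integrand_continuous.
  by move=> y; rewrite /= in_itv/= andbT lee_fin; exact: f0.
apply: lt_le_trans H2; apply: lt_le_trans H1.
by rewrite mulr_gt0 ?divr_gt0 ?expR_gt0// subr_gt0 ltr1n.
Qed.

Lemma gamma_reg_Gamma k : ~ (exists m : nat, k = m%:R) ->
  gamma_reg (taylor_terms k) k = Gamma (- k) /\ Gamma (- k) != 0.
Proof.
move=> kN; have mk := taylor_terms_regular kN; have [km _] := mk.
have P := gamma_reg_prod mk.
have g0 : gamma_integral (- k + (taylor_terms k)%:R) != 0.
  by rewrite gt_eqF// gamma_integral_gt0// addrC subr_gt0.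
have GE : Gamma (- k) = gamma_reg (taylor_terms k) k.
  move: P g0; rewrite /Gamma /taylor_terms oppr_gt0; case: ifP => k0.
    by rewrite big_ord0 mulr1 addr0 => ->.
  rewrite opprK => <- /=; rewrite mulf_eq0 negb_or => /andP[_ p0].
  by rewrite mulfK.
split; first by rewrite GE.
by rewrite GE; apply: contra_neq g0 => E; rewrite -P E mul0r.
Qed.


End gamma_function.

(** * Exponential transforms of test functions *)

Section real_test_functions.
Variable R : realType.
Local Notation mu := (@lebesgue_measure R).
Implicit Types (g phi : R -> R) (a b r alpha l t : R) (m p : nat).

Definition test_function a b g :=
  [/\ 0 < a, a <= b, continuous g & forall t, t \notin `[a, b] -> g t = 0].

Lemma test_integrable a b g phi : test_function a b g ->
  (forall t, 0 < t -> {for t, continuous phi}) ->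
  mu.-integrable `]0, +oo[ (EFin \o (fun t => phi t * g t)).
Proof.
move=> [a0 ab cg sg] cphi.
have sub : (`[a, b]%classic : set R) `<=` `]0, +oo[%classic.
  by move=> t; rewrite /= !in_itv/= andbT => /andP[h _]; exact: lt_le_trans h.
have h : mu.-integrable `[a, b] (EFin \o (fun t => phi t * g t)).
  apply: continuous_compact_integrable; first exact: segment_compact.
  apply: continuous_in_subspaceT => t; rewrite inE => /sub; rewrite /= in_itv/= andbT => t0.
  by apply: continuousM; [exact: cphi|exact: cg].
apply/integrable_mkcond => //; move/integrable_mkcond : h => /(_ (measurable_itv _)).
apply: eq_integrable => // t _; rewrite !patchE.
case: ifPn => [tab|tab]; first by rewrite ifT//; move: tab; rewrite !inE => /sub.
case: ifPn => // _; rewrite /= sg ?mulr0//.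
by move: tab; rewrite notin_setE/= => /negP.
Qed.

Lemma test_functionM a b g phi : continuous phi -> test_function a b g ->
  test_function a b (fun t => phi t * g t).
Proof.
move=> cphi [a0 ab cg sg]; split=> //; last by move=> t /sg ->; rewrite mulr0.
by move=> t; apply: continuousM; [exact: cphi|exact: cg].
Qed.

Lemma continuous_opp_shift r : continuous (fun t : R => - (t + r)).
Proof. by move=> t; apply: cvgN; apply: cvgD; [exact: cvg_id|exact: cvg_cst]. Qed.

Definition exp_transform r alpha g l :=
  \int[mu]_(t in `]0, +oo[) (expR (- (t + r) * (l - alpha)) * g t).

Lemma continuous_expR_lin (c d : R) : continuous (fun t : R => expR (- (t + c) * d)).
Proof.
move=> t; apply: continuous_comp; last exact: continuous_expR.
apply: continuousM; last exact: cst_continuous.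
by apply: continuousN; apply: continuousD => //; exact: cst_continuous.
Qed.

Lemma is_derive_exp_transform a b g r alpha l : 0 <= r -> test_function a b g ->
  is_derive l 1 (exp_transform r alpha g) (exp_transform r alpha (fun t => - (t + r) * g t) l).
Proof.
move=> r0 tg; have [a0 ab cg sg] := tg.
pose B := expR ((b + r) * (`|l - alpha| + 1)) * (b + r).
have br0 : 0 <= b + r by rewrite addr_ge0// (le_trans (ltW a0)).
have B0 : 0 <= B by rewrite mulr_ge0// expR_ge0.
apply: (@is_derive_Rintegral R `]0, +oo[
  (fun l t => expR (- (t + r) * (l - alpha)) * g t)
  (fun l t => expR (- (t + r) * (l - alpha)) * (- (t + r) * g t))
  (fun t => B * `|g t|) l 1) => //.
- move=> x _; apply: (test_integrable tg) => t _; exact: continuous_expR_lin.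
- move=> x t _ _.
  have h : is_derive x 1 (fun x : R => - (t + r) * (x - alpha)) (- (t + r)).
    by apply: is_derive_eq; rewrite /GRing.scale/=; ring.
  have h' := @is_derive1_comp R expR _ x _ _ (is_derive_expR _) h.
  have := is_deriveZ (g t) h'; rewrite /GRing.scale/=.
  by congr (is_derive _ _ _ _); [apply/funext => y; exact: mulrC|ring].
- by move=> t; rewrite mulr_ge0.
- have tg' : test_function a b (fun t => `|g t|).
    split => //; last by move=> t /sg ->; rewrite normr0.
    by move=> t; apply: continuous_comp; [exact: cg|exact: norm_continuous].
  by apply: (test_integrable tg') => t _; exact: cst_continuous.
- move=> x t xl _; have [tab|/sg ->] := boolP (t \in `[a, b]); last first.
    by rewrite normr0 !mulr0 normr0.
  move: tab; rewrite in_itv/= => /andP[ta tb].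
  have t0 : 0 <= t + r by rewrite addr_ge0// (le_trans (ltW a0)).
  have tbr : t + r <= b + r by rewrite lerD2r.
  rewrite !normrM normrN mulrA ler_wpM2r// (ger0_norm (expR_ge0 _)) (ger0_norm t0).
  apply: ler_pM; rewrite ?expR_ge0//.
  rewrite ler_expR mulNr -mulrN.
  have h1 : - (x - alpha) <= `|l - alpha| + 1.
    have := ler_norm (- (l - alpha)); rewrite normrN.
    by move: xl; rewrite ltr_norml; lra.
  apply: (@le_trans _ _ ((t + r) * (`|l - alpha| + 1))); first by rewrite ler_wpM2l.
  by rewrite ler_wpM2r// addr_ge0.
Qed.

Lemma derive1n_exp_transform a b g r alpha p : 0 <= r -> test_function a b g ->
  derive1n p (exp_transform r alpha g) = exp_transform r alpha (fun t => (- (t + r)) ^+ p * g t).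
Proof.
move=> r0; elim: p g => [|p ih] g tg.
  by rewrite derive1n0; congr (exp_transform r alpha _); apply/funext => t; rewrite expr0 mul1r.
have tg' : test_function a b (fun t => - (t + r) * g t).
  exact: test_functionM (@continuous_opp_shift r) tg.
rewrite derive1Sn (_ : derive1 (exp_transform r alpha g) = exp_transform r alpha (fun t => - (t + r) * g t)).
  by rewrite ih//; congr (exp_transform r alpha _); apply/funext => t; rewrite mulrA -exprSr.
apply/funext => l; rewrite derive1E.
by have h := is_derive_exp_transform alpha l r0 tg; rewrite derive_val.
Qed.

Lemma exp_transform_at g r alpha : exp_transform r alpha g alpha = \int[mu]_(t in `]0, +oo[) g t.
Proof.
by apply: eq_Rintegral => t _; rewrite subrr mulr0 expR0 mul1r.
Qed.

Lemma exp_transform_remainder a b g r alpha m l : 0 <= r -> test_function a b g ->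
  exp_transform r alpha g l -
    \sum_(p < m) p`!%:R^-1 * derive1n p (exp_transform r alpha g) alpha * (l - alpha) ^+ p =
  \int[mu]_(t in `]0, +oo[) (exp_rem m ((t + r) * (l - alpha)) * g t).
Proof.
move=> r0 tg; elim: m => [|m ih].
  rewrite big_ord0 subr0; apply: eq_Rintegral => t _.
  by rewrite exp_rem0 mulNr.
rewrite big_ord_recr /= opprD addrA ih (derive1n_exp_transform _ _ r0 tg) exp_transform_at.
have cX (d : R) : continuous (fun t : R => (t + r) * d).
  by move=> t; apply: cvgM; [apply: cvgD; [exact: cvg_id|]|]; exact: cvg_cst.
have cE n : continuous (fun t : R => exp_rem n ((t + r) * (l - alpha))).
  move=> t; apply: (@continuous_comp _ _ _ (fun t => (t + r) * (l - alpha)) (exp_rem n)).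
    exact: cX.
  exact: exp_rem_continuous.
have cN : continuous (fun t : R => (- (t + r)) ^+ m).
  move=> t; apply: (@continuous_comp _ _ _ (fun t => - (t + r)) (fun x => x ^+ m)).
    exact: continuous_opp_shift.
  exact: exprn_continuous.
have iN := test_integrable tg (fun t _ => cN t).
rewrite mulrAC -RintegralZl//.
rewrite -RintegralB//.
- apply: eq_Rintegral => t _; rewrite exp_remS (_ : - ((t + r) * (l - alpha)) = - (t + r) * (l - alpha)); last by rewrite mulNr.
  rewrite exprMn.
  by generalize (exp_rem m ((t + r) * (l - alpha))) => E; ring.
- by apply: (test_integrable tg) => t _; exact: cE m t.
- have := test_integrable (test_functionM cN tg) (fun t _ => @cst_continuous _ _ (m`!%:R^-1 * (l - alpha) ^+ m) t).
  by apply: eq_integrable.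
Qed.

End real_test_functions.

Section power_pairing.
Variable R : realType.
Local Notation mu := (@lebesgue_measure R).
Local Notation TR := (measurableTypeR R).
Variables (a b r alpha k : R) (m : nat) (g : R -> R).
Hypotheses (r0 : 0 <= r) (mk : regular_order m k) (tg : test_function a b g).

Let A : set TR := `]alpha, +oo[%classic.

Let q (l t : R) : R :=
  \1_A l * (l - alpha) `^ (- k - 1) * exp_rem m ((t + r) * (l - alpha)) * g t.

Let f (z : TR * TR) : \bar R := (q z.1 z.2)%:E.

Let mA : measurable A. Proof. exact: measurable_itv. Qed.

Let a0 : 0 < a. Proof. by case: tg. Qed.
Let cg : continuous g. Proof. by case: tg. Qed.
Let sg t : t \notin `[a, b] -> g t = 0. Proof. by case: tg => _ _ _; exact. Qed.

Let g_le0 t : t <= 0 -> g t = 0.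
Proof.
by move=> t0; apply: sg; rewrite in_itv/= negb_and -ltNge (le_lt_trans t0).
Qed.

Let mf : measurable_fun setT f.
Proof.
have m1 : measurable_fun setT (fun z : TR * TR => z.1 - alpha).
  by apply: measurable_funB => //; exact: measurable_fst.
have m2 : measurable_fun setT (fun z : TR * TR => z.2 + r).
  by apply: measurable_funD => //; exact: measurable_snd.
apply/measurable_EFinP; rewrite /q.
apply: measurable_funM; last first.
  apply: (measurableT_comp (f := g)); last exact: measurable_snd.
  exact: continuous_measurable_fun.
apply: measurable_funM; last first.
  apply: (measurableT_comp (f := @exp_rem R m)).
    by apply: continuous_measurable_fun; exact: exp_rem_continuous.
  exact: measurable_funM.
apply: measurable_funM; last first.
  by apply: (measurableT_comp (f := fun x : R => x `^ (- k - 1))) => //.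
have h1 : measurable_fun setT (\1_A : TR -> R) by exact: measurable_indic.
have h2 : measurable_fun setT (fst : TR * TR -> TR) by exact: measurable_fst.
have h3 := measurableT_comp h1 h2.
exact: h3.
Qed.

Let q_le : exists2 K : R, 0 <= K & forall l t, `|q l t| <=
  \1_A l * (K * two_power (m%:R - k - 1) (decay_exponent m k) (l - alpha)) * `|g t|.
Proof.
have ab : a <= b by case: tg.
have abr : a <= b + r by rewrite (le_trans ab)// lerDl.
have [K K0 KP] := regular_integrand_le mk a0 abr.
exists K => // l t; rewrite /q normrM.
have [tab|/sg ->] := boolP (t \in `[a, b]); last by rewrite normr0 !mulr0.
rewrite ler_wpM2r//.
rewrite indicE; case: (boolP (l \in A)) => lA /=; last by rewrite !mul0r normr0.
rewrite !mul1r; apply: KP; first by move: lA; rewrite /A inE/= in_itv/= andbT subr_gt0.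
by move: tab; rewrite in_itv/= => /andP[ta tb]; rewrite lerD2r tb andbT (le_trans ta)// lerDl.
Qed.

Let integrable_f : (mu \x mu)%E.-integrable setT f.
Proof.
have [h1 [h2 h3]] := regular_exponents mk.
have [K K0 KP] := q_le.
pose B (l : R) := \1_A l * (K * two_power (m%:R - k - 1) (decay_exponent m k) (l - alpha)).
have iT : mu.-integrable `]alpha, +oo[
    (EFin \o (fun x => two_power (m%:R - k - 1) (decay_exponent m k) (x - alpha))).
  apply: integrable_shift => [x x0|x _|]; last exact: integrable_two_power.
    exact: continuous_two_power.
  exact: two_power_ge0.
have iB : mu.-integrable setT (EFin \o B).
  have := integrableZl mA K iT; move/(integrable_mkcond _ mA).
  apply: eq_integrable => // x _; rewrite patchE /B /= indicE.
  by case: (boolP (x \in A)) => xA /=; rewrite ?mul1r ?mul0r// EFinM.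
have ig : mu.-integrable setT (EFin \o (fun t => `|g t|)).
  have tg' : test_function a b (fun t => `|g t|).
    case: tg => ? ? ? ?; split => //; last by move=> t /sg ->; rewrite normr0.
    by move=> t; apply: continuous_comp; [exact: cg|exact: norm_continuous].
  have /integrable_mkcond := test_integrable tg' (fun t _ => @cst_continuous _ _ (1 : R) t).
  move=> /(_ (measurable_itv _)).
  apply: eq_integrable => // x _; rewrite patchE /= mul1r; case: ifPn => //.
  by rewrite notin_setE/= in_itv/= andbT => /negP; rewrite -leNgt => /g_le0 ->; rewrite normr0.
apply: (@le_integrable _ _ _ _ _ measurableT f (fun z => (B z.1 * `|g z.2|)%:E)) => //.
  move=> z _; rewrite /f lee_fin (le_trans (KP _ _))// ger0_norm//.
  by rewrite mulr_ge0// /B mulr_ge0// mulr_ge0// two_power_ge0.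
have mB : measurable_fun setT B by have /integrableP[/measurable_EFinP] := iB.
have mg : measurable_fun setT (fun t => `|g t|) by have /integrableP[/measurable_EFinP] := ig.
apply/integrable12ltyP.
  apply/measurable_EFinP; apply: measurable_funM.
    by apply: (measurableT_comp (f := B)) => //; exact: measurable_fst.
  by apply: (measurableT_comp (f := fun t => `|g t|)) => //; exact: measurable_snd.
pose N := \int[mu]_t `|g t|.
have BE l : (\int[mu]_t `|(B (l, t).1 * `|g (l, t).2|)%:E| = `|B l|%:E * N%:E)%E.
  rewrite [RHS](_ : _ = (`|B l|%:E * \int[mu]_t (`|g t|)%:E)%E); last first.
    by rewrite /N /Rintegral fineK//; exact: integrable_fin_num.
  rewrite -ge0_integralZl//; last exact/measurable_EFinP.
  by apply: eq_integral => t _ /=; rewrite normrM normr_id.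
under eq_integral do rewrite BE.
rewrite ge0_integralZr//.
- have /integrableP[_ h] := iB.
  have F : (\int[mu]_x `|B x|%:E)%E \is a fin_num.
    by rewrite ge0_fin_numE//; apply: integral_ge0 => x _; rewrite lee_fin.
  apply: (@le_lt_trans _ _ ((fine (\int[mu]_x `|B x|%:E))%:E * N%:E)%E).
    by rewrite (fineK F).
  by rewrite -EFinM ltry.
- apply/measurable_EFinP; exact: measurableT_comp.
- by rewrite lee_fin; apply: Rintegral_ge0.
Qed.

Lemma power_pairing :
  \int[mu]_(l in `]alpha, +oo[) ((l - alpha) `^ (- k - 1) *
     \int[mu]_(t in `]0, +oo[) (exp_rem m ((t + r) * (l - alpha)) * g t)) =
  gamma_reg m k * \int[mu]_(t in `]0, +oo[) ((t + r) `^ k * g t).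
Proof.
have cE l : continuous (fun t : R => exp_rem m ((t + r) * (l - alpha))).
  move=> t; apply: (@continuous_comp _ _ _ (fun t => (t + r) * (l - alpha)) (exp_rem m)).
    by apply: cvgM; [apply: cvgD; [exact: cvg_id|]|]; exact: cvg_cst.
  exact: exp_rem_continuous.
have I1 l : (\int[mu]_t f (l, t) =
   (((fun l => (l - alpha) `^ (- k - 1) *
     \int[mu]_(t in `]0, +oo[) (exp_rem m ((t + r) * (l - alpha)) * g t)) \_ A) l)%:E)%E.
  have it := test_integrable tg (fun t _ => cE l t).
  rewrite patchE /f /q /= indicE; case: (boolP (l \in A)) => lA /=; last first.
    by rewrite integral0_eq// => t _; rewrite !mul0r.
  rewrite EFinM /Rintegral fineK; last exact: integrable_fin_num.
  rewrite -integralZl//= [RHS]integral_mkcond; apply: eq_integral => t _.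
  rewrite patchE; case: ifPn => [_|]; first by rewrite -EFinM mul1r mulrA.
  by rewrite notin_setE/= in_itv/= andbT => /negP; rewrite -leNgt => /g_le0 ->; rewrite mulr0.
have I2 t : (\int[mu]_l f (l, t) =
   (((fun t => gamma_reg m k * ((t + r) `^ k * g t)) \_ `]0, +oo[) t)%:E)%E.
  rewrite patchE; case: ifPn => [|]; last first.
    rewrite notin_setE/= in_itv/= andbT => /negP; rewrite -leNgt => /g_le0 gt.
    by rewrite integral0_eq// => l _; rewrite /f /q /= gt mulr0.
  rewrite inE/= in_itv/= andbT => t0.
  have tr0 : 0 < t + r by rewrite ltr_wpDr.
  have it := regular_integrable_shift alpha mk tr0.
  rewrite mulrA (mulrC (gamma_reg m k)) -(gamma_reg_scale alpha mk tr0) mulrC EFinM.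
  rewrite /Rintegral fineK; last exact: integrable_fin_num.
  rewrite -integralZl//= [RHS]integral_mkcond; apply: eq_integral => l _.
  rewrite patchE /f /q /= indicE; case: (boolP (l \in A)) => lA /=; last by rewrite !mul0r.
  by rewrite -EFinM mul1r [in RHS]mulrC.
have := Fubini integrable_f.
under eq_integral do rewrite I1.
under [in X in _ = X -> _]eq_integral do rewrite I2.
move=> /(congr1 fine) H.
rewrite Rintegral_mkcond [LHS]H -RintegralZl.
- by rewrite [in RHS]Rintegral_mkcond.
- by [].
- apply: (test_integrable tg) => t t0.
  apply: (@continuous_comp _ _ _ (fun t : R => t + r) (fun x => x `^ k)).
    by apply: cvgD; [exact: cvg_id|exact: cvg_cst].
  by apply: continuous_powR_pos; rewrite ltr_wpDr.
Qed.

End power_pairing.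

(** * The regularized functional *)

Section real_smooth_functions.
Variable R : realType.
Implicit Types (u v : R -> R) (alpha t l B c : R) (m p : nat).

Definition smooth u := forall p t, derivable (derive1n p u) t 1.

Lemma smooth_is_derive u p t : smooth u -> is_derive t 1 (derive1n p u) (derive1n p.+1 u t).
Proof.
by move=> su; apply: DeriveDef; [exact: su|rewrite derive1nS derive1E].
Qed.

Lemma smooth_continuous u p : smooth u -> continuous (derive1n p u).
Proof.
move=> su t; apply: differentiable_continuous; rewrite -derivable1_diffP.
exact: su.
Qed.

Lemma smooth_derive1 u : smooth u -> smooth (derive1 u).
Proof. by move=> su p t; rewrite -derive1Sn. Qed.

Lemma derive1n_lin u v c d p : smooth u -> smooth v ->
  derive1n p (fun t => c * u t + d * v t) =
  (fun t => c * derive1n p u t + d * derive1n p v t).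
Proof.
move=> su sv; elim: p => [|p ih]; first by rewrite derive1n0.
rewrite derive1nS ih; apply/funext => t; rewrite derive1E.
have hu := smooth_is_derive p t su; have hv := smooth_is_derive p t sv.
have h := is_deriveD (is_deriveZ c hu) (is_deriveZ d hv).
by have := @derive_val _ _ _ _ _ _ _ h.
Qed.

Lemma smooth_lin u v c d : smooth u -> smooth v -> smooth (fun t => c * u t + d * v t).
Proof.
move=> su sv p t; rewrite derive1n_lin//.
have hu := smooth_is_derive p t su; have hv := smooth_is_derive p t sv.
have h := is_deriveD (is_deriveZ c hu) (is_deriveZ d hv).
exact: (@ex_derive _ _ _ _ _ _ _ h).
Qed.

Definition taylor alpha m u l : R :=
  \sum_(p < m) p`!%:R^-1 * derive1n p u alpha * (l - alpha) ^+ p.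

Lemma taylorS alpha m u l : taylor alpha m.+1 u l =
  taylor alpha m u l + m`!%:R^-1 * derive1n m u alpha * (l - alpha) ^+ m.
Proof. by rewrite /taylor big_ord_recr. Qed.

Lemma is_derive_shiftX alpha m l :
  is_derive l 1 (fun l : R => (l - alpha) ^+ m) (m%:R * (l - alpha) ^+ m.-1).
Proof.
have h : is_derive (l - alpha) 1 (fun z : R => z ^+ m) (m%:R * (l - alpha) ^+ m.-1).
  apply: DeriveDef; first exact: exprn_derivable.
  by rewrite exp_derive scaler1.
have h' : is_derive l 1 (fun z : R => z - alpha) 1.
  by apply: is_derive_eq; rewrite subr0.
have := @is_derive1_comp R (fun z => z ^+ m) (fun z => z - alpha) l _ _ h h'.
by rewrite mulr1.
Qed.

Lemma is_derive_taylor alpha m u l :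
  is_derive l 1 (taylor alpha m.+1 u) (taylor alpha m (derive1 u) l).
Proof.
elim: m => [|m ih].
  rewrite (_ : taylor alpha 1 u = cst (u alpha)).
    by rewrite /taylor big_ord0; exact: is_derive_cst.
  by apply/funext => x; rewrite taylorS /taylor big_ord0 add0r fact0 invr1 mul1r mulr1.
rewrite (_ : taylor alpha m.+2 u = fun x => taylor alpha m.+1 u x +
  (m.+1`!%:R^-1 * derive1n m.+1 u alpha) * (x - alpha) ^+ m.+1); last first.
  by apply/funext => x; rewrite taylorS.
have := is_deriveD ih (is_deriveZ (m.+1`!%:R^-1 * derive1n m.+1 u alpha) (is_derive_shiftX alpha m.+1 l)).
congr (is_derive _ _ _ _).
rewrite taylorS; congr (_ + _); rewrite -derive1Sn.
generalize (derive1n m.+1 u alpha) => D; rewrite /GRing.scale/= factS natrM invfM.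
have m0 : m.+1%:R != 0 :> R by rewrite pnatr_eq0.
have mf0 : m`!%:R != 0 :> R by rewrite pnatr_eq0 -lt0n fact_gt0.
by field; rewrite nat1r m0 mf0.
Qed.

Lemma taylor_at alpha m u : taylor alpha m.+1 u alpha = u alpha.
Proof.
elim: m => [|m ih]; rewrite taylorS.
  by rewrite /taylor big_ord0 add0r fact0 invr1 mul1r mulr1.
by rewrite ih subrr expr0n mulr0 addr0.
Qed.

Lemma taylor_remainder_le alpha m u B : smooth u ->
  (forall t, alpha <= t <= alpha + 1 -> `|derive1n m u t| <= B) ->
  forall l, alpha <= l <= alpha + 1 -> `|u l - taylor alpha m u l| <= B * (l - alpha) ^+ m.
Proof.
elim: m u => [|m ih] u su uB l /andP[al la1].
  by rewrite /taylor big_ord0 subr0 expr0 mulr1 uB// al la1.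
have B0 : 0 <= B by apply: le_trans (uB alpha _); rewrite ?lexx ?lerDl ?ler01.
move: al; rewrite le_eqVlt => /predU1P[<-|al].
  by rewrite taylor_at !subrr normr0 expr0n mulr0.
pose v x := u x - taylor alpha m.+1 u x.
have dv (x : R) : is_derive x 1 v (derive1 u x - taylor alpha m (derive1 u) x).
  exact: is_deriveB (smooth_is_derive 0 x su) (is_derive_taylor alpha m u x).
have cv : {within `[alpha, l], continuous v}.
  apply: derivable_within_continuous => x _.
  by have h := dv x; exact: ex_derive.
have [c] := MVT al (fun x _ => dv x) cv.
rewrite in_itv/= {2}/v taylor_at subrr subr0 => /andP[ac cl]; rewrite /v => ->.
rewrite normrM (ger0_norm (_ : 0 <= l - alpha)); last by rewrite subr_ge0 ltW.
rewrite exprSr mulrA ler_wpM2r ?subr_ge0 ?(ltW al)//.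
have uB' t : alpha <= t <= alpha + 1 -> `|derive1n m (derive1 u) t| <= B.
  by rewrite -derive1Sn; exact: uB.
have := ih _ (smooth_derive1 su) uB' c; rewrite (ltW ac) (le_trans (ltW cl))// => /(_ isT) h.
apply: (le_trans h); rewrite ler_wpM2l// lerXn2r ?nnegrE ?subr_ge0 ?(ltW ac) ?(ltW al)//.
by rewrite lerD2r ltW.
Qed.

End real_smooth_functions.

Section regularized_functional.
Variable R : realType.
Local Notation mu := (@lebesgue_measure R).
Variables (alpha k : R) (m : nat).
Hypothesis mk : regular_order m k.
Implicit Types (u v : R -> R) (l t B : R).

Let N := (Num.truncn (- k)).+1.

Definition controlled B u := [/\ smooth u,
  forall p t, (p <= m)%N -> alpha <= t <= alpha + 1 -> `|derive1n p u t| <= B &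
  forall t, alpha + 1 < t -> `|u t| <= B * (t - alpha) ^- N].

Definition regular_integrand u l := (l - alpha) `^ (- k - 1) * (u l - taylor alpha m u l).

Definition regular_functional u := \int[mu]_(l in `]alpha, +oo[) regular_integrand u l.

Local Notation dom := (fun l => two_power (m%:R - k - 1) (decay_exponent m k) (l - alpha)).

Lemma regular_integrand_bound B u l : controlled B u -> alpha < l ->
  `|regular_integrand u l| <= m.+1%:R * B * dom l.
Proof.
move=> [su uB uN] al; pose x := l - alpha; have x0 : 0 < x by rewrite subr_gt0.
have B0 : 0 <= B.
  by apply: le_trans (uB 0%N alpha isT _); rewrite ?lexx ?lerDl ?ler01.
have B1 : B <= m.+1%:R * B by rewrite ler_peMl// ler1n.
rewrite /regular_integrand normrM (ger0_norm (powR_ge0 _ _)) -/x /two_power.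
case: ifPn => [x1|].
  have lI : alpha <= l <= alpha + 1 by rewrite (ltW al) addrC -lerBlDr.
  have := taylor_remainder_le su (fun t => uB m t (leqnn m)) lI; rewrite -/x => h.
  rewrite (_ : m%:R - k - 1 = - k - 1 + m%:R); last by ring.
  rewrite -powR_mul_expn// mulrCA ler_wpM2l ?powR_ge0//.
  by rewrite (le_trans h)// ler_wpM2r// exprn_ge0// ltW.
rewrite -ltNge => x1.
have ul : `|u l| <= B * x ^- N by apply: uN; rewrite addrC -ltrBrDr.
rewrite /decay_exponent /taylor.
have derB p : (p <= m)%N -> `|derive1n p u alpha| <= B.
  by move=> pm; apply: uB => //; rewrite lexx lerDl ler01.
move: derB {uB} B1; case: m => [|m'] derB B1.
  rewrite big_ord0 subr0 -powR_mul_expNn// mulrCA mul1r.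
  by rewrite ler_wpM2l ?powR_ge0.
rewrite (_ : m'.+1%:R - 2 - k = - k - 1 + m'%:R); last by rewrite -natr1; ring.
rewrite -powR_mul_expn// mulrCA ler_wpM2l ?powR_ge0//.
have xX n : (n <= m')%N -> x ^+ n <= x ^+ m'.
  by move=> nm; rewrite ler_weXn2l// ltW.
rewrite (le_trans (ler_normB _ _))// -natr1 mulrDl mul1r mulrDl addrC lerD//.
  apply: (le_trans (ler_norm_sum _ _ _)).
  apply: (@le_trans _ _ (\sum_(p < m'.+1) B * x ^+ m')); last first.
    by rewrite sumr_const card_ord -[leLHS]mulr_natl mulrA.
  apply: ler_sum => p _; rewrite normrM normrX (ger0_norm (ltW x0)).
  apply: ler_pM => //; last by apply: xX; rewrite -ltnS.
    by rewrite exprn_ge0// ltW.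
  rewrite normrM -[leRHS]mul1r; apply: ler_pM => //; last by apply: derB; exact: ltnW.
  by rewrite ger0_norm ?invr_ge0// invf_le1 ?ler1n ?ltr0n fact_gt0.
apply: (le_trans ul); rewrite ler_wpM2l//.
apply: (@le_trans _ _ 1); last by rewrite exprn_ege1// ltW.
by rewrite invf_le1 ?exprn_ege1 ?exprn_gt0// ltW.
Qed.

Lemma regular_integrand_measurable u : smooth u ->
  measurable_fun `]alpha, +oo[ (regular_integrand u).
Proof.
move=> su; apply: continuous_at_measurable_ray => l al.
apply: continuousM.
  apply: (@continuous_comp _ _ _ (fun l : R => l - alpha) (fun x => x `^ (- k - 1))).
    by apply: cvgB; [exact: cvg_id|exact: cvg_cst].
  by apply: continuous_powR_pos; rewrite subr_gt0.
have cu : {for l, continuous u} := @smooth_continuous R u 0 su l.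
apply: continuousB; first exact: cu.
case: m => [|m'].
  rewrite (_ : taylor alpha 0 u = cst 0); first exact: cst_continuous.
  by apply/funext => x; rewrite /taylor big_ord0.
apply: differentiable_continuous; rewrite -derivable1_diffP.
by have h := is_derive_taylor alpha m' u l; exact: ex_derive.
Qed.

Lemma integrable_dom : mu.-integrable `]alpha, +oo[ (EFin \o dom).
Proof.
have [h1 [h2 h3]] := regular_exponents mk.
apply: integrable_shift => [x x0|x _|]; last exact: integrable_two_power.
  exact: continuous_two_power.
exact: two_power_ge0.
Qed.

Lemma regular_integrand_integrable B u : controlled B u ->
  mu.-integrable `]alpha, +oo[ (EFin \o regular_integrand u).
Proof.
move=> uB; have [su _ _] := uB.
apply: (@le_integrable _ (measurableTypeR R) _ mu _ _ _
  (fun l => (m.+1%:R * B)%:E * (dom l)%:E)%E) => //.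
- by apply/measurable_EFinP; exact: regular_integrand_measurable.
- move=> l; rewrite /= in_itv/= andbT => al; rewrite lee_fin.
  by rewrite (le_trans (regular_integrand_bound uB al))// ler_norm.
- by apply: integrableZl => //; exact: integrable_dom.
Qed.

Lemma regular_functional_lin B B' u v (c d : R) : controlled B u -> controlled B' v ->
  regular_functional (fun t => c * u t + d * v t) =
  c * regular_functional u + d * regular_functional v.
Proof.
move=> uB vB; have [su _ _] := uB; have [sv _ _] := vB.
have iu := regular_integrand_integrable uB; have iv := regular_integrand_integrable vB.
have icu : mu.-integrable `]alpha, +oo[ (EFin \o (fun l => c * regular_integrand u l)).
  exact: (@integrableZl _ (measurableTypeR R) _ mu _ _ c _ iu).
have idv : mu.-integrable `]alpha, +oo[ (EFin \o (fun l => d * regular_integrand v l)).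
  exact: (@integrableZl _ (measurableTypeR R) _ mu _ _ d _ iv).
rewrite /regular_functional -RintegralZl// -RintegralZl// -RintegralD//.
apply: eq_Rintegral => l _; rewrite /regular_integrand.
rewrite (_ : taylor alpha m (fun t => c * u t + d * v t) l =
  c * taylor alpha m u l + d * taylor alpha m v l); first by ring.
rewrite /taylor !mulr_sumr -big_split/=; apply: eq_bigr => p _.
by rewrite derive1n_lin//; ring.
Qed.

Lemma regular_functional_cvg0 B (u : nat -> R -> R) : (forall j, controlled B (u j)) ->
  (forall p, (p < m)%N -> derive1n p (u j) alpha @[j --> \oo] --> 0) ->
  (forall l, alpha < l -> u j l @[j --> \oo] --> 0) ->
  regular_functional (u j) @[j --> \oo] --> 0.
Proof.
move=> uB du0 u0.
have H : ((\int[mu]_(l in `]alpha, +oo[) (regular_integrand (u j) l)%:E)%E @[j --> \oo] -->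
    (\int[mu]_(l in `]alpha, +oo[) (cst 0%E) l)%E).
  apply: (@dominated_cvg _ (measurableTypeR R) R mu `]alpha, +oo[ (measurable_itv _)
    (fun j l => (regular_integrand (u j) l)%:E) (cst 0%E)
    (fun l => (m.+1%:R * B)%:E * (dom l)%:E)%E) => //.
  - by move=> j; apply/measurable_EFinP; apply: regular_integrand_measurable; case: (uB j).
  - move=> l; rewrite /= in_itv/= andbT => al; apply: cvg_EFin; first exact: nearW.
    rewrite -[X in _ --> X](mulr0 ((l - alpha) `^ (- k - 1))); apply: cvgMr.
    rewrite -[X in _ --> X](subr0 0); apply: cvgB; first exact: u0.
    suff : forall n, (n <= m)%N -> taylor alpha n (u j) l @[j --> \oo] --> 0 by exact.
    elim=> [_|n ih nm].
      by under eq_fun do rewrite /taylor big_ord0; exact: cvg_cst.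
    have h1 := ih (ltnW nm).
    have h2 : n`!%:R^-1 * derive1n n (u j) alpha * (l - alpha) ^+ n @[j --> \oo] -->
        n`!%:R^-1 * 0 * (l - alpha) ^+ n.
      by apply: cvgMl; apply: cvgMr; exact: du0.
    have h3 := cvgD h1 h2; rewrite mulr0 mul0r addr0 in h3.
    have E : (fun j => taylor alpha n.+1 (u j) l) = (fun j => taylor alpha n (u j) l +
        n`!%:R^-1 * derive1n n (u j) alpha * (l - alpha) ^+ n).
      by apply/funext => j; exact: taylorS.
    by rewrite E; exact: h3.
  - by apply: integrableZl => //; exact: integrable_dom.
  - move=> j l; rewrite /= in_itv/= andbT => al; rewrite lee_fin.
    exact: regular_integrand_bound.
rewrite integral0 in H.
exact: fine_cvg H.
Qed.

End regularized_functional.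

(** * Membership in the dual of Y *)

Section damped_functions.
Local Open Scope complex_scope.
Variable R : realType.
Local Notation C := R[i].
Local Notation nc := (@Normc.normc R).
Local Notation T := (@circle_derivative R).
Variables (alpha r : R).
Hypothesis r0 : 0 <= r.
Implicit Types (w : C -> C) (rho M B : R).

Definition damped w (z : C) : C := cexp (- r%:C * z + (r * alpha)%:C) * w z.

Lemma damped_conjE w l : damped_conj alpha r w l = conjc (damped w l%:C).
Proof.
rewrite /damped_conj /damped (_ : - r%:C * l%:C + (r * alpha)%:C = (- r * (l - alpha))%:C); last first.
  by apply/eqP; rewrite eq_complex /=; apply/andP; split; apply/eqP; ring.
rewrite cexpR; case: (w l%:C) => x y /=.
by apply/eqP; rewrite eq_complex /=; apply/andP; split; apply/eqP; ring.
Qed.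

Lemma damped_conj_Re w l : complex.Re (damped_conj alpha r w l) = complex.Re (damped w l%:C).
Proof. by rewrite damped_conjE; case: (damped _ _). Qed.

Lemma damped_conj_Im w l : complex.Im (damped_conj alpha r w l) = - complex.Im (damped w l%:C).
Proof. by rewrite damped_conjE; case: (damped _ _). Qed.

Lemma entire_damped w : entire w -> entire (damped w).
Proof.
move=> ew z; have h1 : derivable ((fun z => cexp (- r%:C * z + (r * alpha)%:C)) : C^o -> C^o) z 1.
  apply: (@derivable_compC R (@cexp R) (fun z => - r%:C * z + (r * alpha)%:C)).
    exact: derivable_affine.
  exact: derivable_cexp.
exact: (derivableM h1 (ew z)).
Qed.

Lemma damped_bounded w rho M : 0 <= M -> bounded_on_disc w rho M ->
  bounded_on_disc (damped w) rho (expR (r * (rho + `|alpha|)) * M).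
Proof.
move=> M0 wM z hz; rewrite Normc.normcM normc_cexp; apply: ler_pM.
- exact: expR_ge0.
- exact: normc_ge0.
- rewrite ler_expR cReD cReM /= oppr0 mul0r subr0.
  have h1 : - complex.Re z <= rho.
    by rewrite (le_trans _ hz)// (le_trans _ (Re_le_normc z))// -normrN ler_norm.
  have h2 := ler_norm alpha.
  rewrite mulNr -mulrN -mulrDr ler_wpM2l//.
  by rewrite lerD.
- exact: wM.
Qed.

Lemma Y_bounds_disc rp rm (c : nat -> R) w rho : Y_bounds rp rm c w -> 0 <= rho ->
  bounded_on_disc w rho (`|c 0%N| * expR ((`|rp| + `|rm|) * rho)).
Proof.
move=> wY rho0 z hz; have [h1 h2] := wY 0%N z.
have hz' : `|complex.Re z| <= rho by exact: le_trans (Re_le_normc z) hz.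
have b (s : R) : `|s| <= `|rp| + `|rm| -> c 0%N * (1 + nc z) ^- 0 * expR (s * `|complex.Re z|) <=
    `|c 0%N| * expR ((`|rp| + `|rm|) * rho).
  move=> hs; rewrite expr0 invr1 mulr1.
  apply: (@le_trans _ _ (`|c 0%N| * expR (s * `|complex.Re z|))).
    by rewrite ler_wpM2r ?expR_ge0// ler_norm.
  rewrite ler_wpM2l// ler_expR.
  apply: (@le_trans _ _ (`|s| * `|complex.Re z|)); first by rewrite ler_wpM2r// ler_norm.
  by rewrite ler_pM.
have [z0|/ltW z0] := leP 0 (complex.Re z).
  by apply: (le_trans (h1 z0)); apply: b; rewrite lerDl.
by apply: (le_trans (h2 z0)); apply: b; rewrite lerDr.
Qed.

Lemma circle_smooth_damped w rp rm (c : nat -> R) : entire w -> Y_bounds rp rm c w ->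
  circle_smooth (damped w).
Proof.
move=> ew wY; apply: entire_circle_smooth; first exact: entire_damped.
move=> rho; have rho0 : 0 <= Num.max 0 rho by rewrite le_max lexx.
have h := Y_bounds_disc wY rho0.
have M0 : 0 <= `|c 0%N| * expR ((`|rp| + `|rm|) * Num.max 0 rho).
  by rewrite mulr_ge0// expR_ge0.
have h' := damped_bounded M0 h.
eexists => z hz; apply: h'.
by rewrite le_max hz orbT.
Qed.

Lemma damped_conj_derive1n w p : circle_smooth (damped w) ->
  derive1n p (fun l => complex.Re (damped_conj alpha r w l)) =
    (fun l => complex.Re (iter p T (damped w) l%:C)) /\
  derive1n p (fun l => complex.Im (damped_conj alpha r w l)) =
    (fun l => - complex.Im (iter p T (damped w) l%:C)).
Proof.
move=> sw; have [h1 h2] := derive1n_circle p sw.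
split.
  by rewrite -h1; congr (derive1n p _); apply/funext => l; exact: damped_conj_Re.
rewrite (_ : (fun l => complex.Im (damped_conj alpha r w l)) =
  (fun l => - complex.Im (damped w l%:C))); last first.
  by apply/funext => l; exact: damped_conj_Im.
elim: p {h1} h2 => [|p ih] h2; first by rewrite derive1n0.
have [h1' h2'] := derive1n_circle p sw.
rewrite derive1nS ih//; apply/funext => l; rewrite derive1E.
have [_ d] := derivable_circle p sw l; rewrite h2' in d.
rewrite (_ : (fun l : R => - complex.Im (iter p T (damped w) l%:C)) =
  - (fun l : R => complex.Im (iter p T (damped w) l%:C))); last by apply/funext.
by rewrite deriveN// -derive1E -h2' -derive1nS h2.
Qed.

Lemma damped_conj_smooth w : circle_smooth (damped w) ->
  smooth (fun l => complex.Re (damped_conj alpha r w l)) /\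
  smooth (fun l => complex.Im (damped_conj alpha r w l)).
Proof.
move=> sw; split=> p t.
  have [-> _] := damped_conj_derive1n p sw.
  by have [d _] := derivable_circle p sw t; have [h _] := derive1n_circle p sw; rewrite h in d.
have [_ ->] := damped_conj_derive1n p sw.
have [_ d] := derivable_circle p sw t; have [_ h] := derive1n_circle p sw; rewrite h in d.
exact: derivableN d.
Qed.

Lemma damped_conj_derive1n_le w p (l : R) : circle_smooth (damped w) ->
  `|derive1n p (fun l => complex.Re (damped_conj alpha r w l)) l| <= nc (iter p T (damped w) l%:C) /\
  `|derive1n p (fun l => complex.Im (damped_conj alpha r w l)) l| <= nc (iter p T (damped w) l%:C).
Proof.
move=> sw; have [-> ->] := damped_conj_derive1n p sw.
by rewrite normrN Re_le_normc Im_le_normc.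
Qed.

Lemma controlled_damped k m rp rm (c : nat -> R) : rp < 0 ->
  exists B, forall w, entire w -> Y_bounds rp rm c w ->
    controlled alpha k m B (fun l => complex.Re (damped_conj alpha r w l)) /\
    controlled alpha k m B (fun l => complex.Im (damped_conj alpha r w l)).
Proof.
move=> rp0; pose N := (Num.truncn (- k)).+1.
pose rho (p : nat) : R := `|alpha| + 1 + p%:R.
have rho0 p : 0 <= rho p by rewrite !addr_ge0.
pose M p := expR (r * (rho p + `|alpha|)) * (`|c 0%N| * expR ((`|rp| + `|rm|) * rho p)).
have M0 p : 0 <= M p by rewrite mulr_ge0 ?mulr_ge0 ?expR_ge0.
pose B1 := \sum_(p < m.+1) 4 ^+ p * M p.
pose B2 := `|c N| * expR (`|rm| * `|alpha|) * (1 + `|alpha|) ^+ N.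
have B10 : 0 <= B1 by apply: sumr_ge0 => p _; rewrite mulr_ge0 ?exprn_ge0.
have B20 : 0 <= B2 by rewrite mulr_ge0 ?exprn_ge0 ?mulr_ge0 ?expR_ge0 ?addr_ge0.
exists (B1 + B2) => w ew wY; have sw := circle_smooth_damped ew wY.
have [s1 s2] := damped_conj_smooth sw.
have near_ (p : nat) (t : R) : (p <= m)%N -> alpha <= t <= alpha + 1 ->
    nc (iter p T (damped w) t%:C) <= B1 + B2.
  move=> pm /andP[t1 t2].
  have h : bounded_on_disc (damped w) (`|alpha| + 1 + p%:R) (M p).
    by apply: damped_bounded; [rewrite mulr_ge0 ?expR_ge0|exact: Y_bounds_disc wY (rho0 p)].
  have := @iter_circle_bounded R (damped w) (`|alpha| + 1) (M p) p sw h t%:C.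
  have ht : nc t%:C <= `|alpha| + 1.
    by rewrite normcR ler_norml; have := ler_norm alpha; have := ler_norm (- alpha); rewrite normrN; lra.
  move=> /(_ ht) /le_trans; apply; rewrite -[leLHS]addr0 lerD//.
  have pm' : (p < m.+1)%N by [].
  rewrite /B1 (bigD1 (Ordinal pm'))//= lerDl; apply: sumr_ge0 => q _.
  by rewrite mulr_ge0 ?exprn_ge0.
have far (t : R) : alpha + 1 < t -> nc (damped w t%:C) <= (B1 + B2) * (t - alpha) ^- N.
  move=> ht; have ta0 : 0 < t - alpha by lra.
  apply: (@le_trans _ _ (B2 * (t - alpha) ^- N)); last first.
    by rewrite ler_wpM2r ?invr_ge0 ?exprn_ge0 ?(ltW ta0)// lerDr.
  rewrite /damped Normc.normcM normc_cexp cReD cReM /= oppr0 mul0r subr0.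
  apply: (@le_trans _ _ (nc (w t%:C))).
    rewrite ler_piMl ?normc_ge0// -expR0 ler_expR.
    by rewrite (_ : - r * t + r * alpha = - (r * (t - alpha))) ?oppr_le0 ?mulr_ge0 ?(ltW ta0)//; ring.
  have [h1 h2] := wY N t%:C; rewrite normcR /= in h1 h2.
  have w_le (s : R) : s * `|t| <= `|rm| * `|alpha| ->
      c N * (1 + `|t|) ^- N * expR (s * `|t|) <= B2 * (t - alpha) ^- N.
    move=> hs; have t10 : 0 < 1 + `|t| by rewrite ltr_pwDl.
    apply: (@le_trans _ _ (`|c N| * (1 + `|t|) ^- N * expR (`|rm| * `|alpha|))).
      apply: (@le_trans _ _ (`|c N| * (1 + `|t|) ^- N * expR (s * `|t|))).
        rewrite ler_wpM2r ?expR_ge0// ler_wpM2r ?ler_norm// invr_ge0 exprn_ge0// ltW//.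
      by rewrite ler_wpM2l ?ler_expR// mulr_ge0// invr_ge0 exprn_ge0// ltW.
    rewrite mulrAC /B2 -!mulrA ler_wpM2l// ler_wpM2l ?expR_ge0//.
    rewrite ler_pdivlMr ?exprn_gt0// mulrC ler_pdivrMr ?exprn_gt0// -exprMn.
    have pos : 0 <= (1 + `|alpha|) * (1 + `|t|) by rewrite mulr_ge0 ?addr_ge0.
    rewrite lerXn2r ?nnegrE ?(ltW ta0)//.
    have := ler_norm t; have := ler_norm (- alpha); rewrite normrN.
    have : 0 <= `|alpha| * `|t| by rewrite mulr_ge0.
    by rewrite mulrDl mul1r mulrDr mulr1; lra.
  have [t0|t0] := leP 0 t.
    apply: (le_trans (h1 t0)); apply: w_le.
    by rewrite (@le_trans _ _ 0)// ?mulr_ge0// nmulr_rle0.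
  apply: (le_trans (h2 (ltW t0))); apply: w_le.
  apply: (@le_trans _ _ (`|rm| * `|t|)); first by rewrite ler_wpM2r// ler_norm.
  by rewrite ler_wpM2l// !ltr0_norm//; lra.
split; split => //.
- move=> p t pm ht; exact: le_trans (damped_conj_derive1n_le p t sw).1 (near_ p t pm ht).
- move=> t ht; rewrite damped_conj_Re; exact: le_trans (Re_le_normc _) (far t ht).
- move=> p t pm ht; exact: le_trans (damped_conj_derive1n_le p t sw).2 (near_ p t pm ht).
- move=> t ht; rewrite damped_conj_Im normrN; exact: le_trans (Im_le_normc _) (far t ht).
Qed.

Lemma compact_box (rho : R) :
  compact ((fun z : C^o => `|complex.Re z| <= rho /\ `|complex.Im z| <= rho) : set C^o).
Proof.
pose f (p : R * R) : C^o := p.1 +i* p.2.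
have cf : continuous f.
  move=> p; apply/cvgrPdist_le => e e0; have [e0' ->] := ltcR0 e0.
  have e20 : 0 < complex.Re e / 2 by rewrite divr_gt0.
  near=> q; rewrite normc_normr lecR; apply: (le_trans (normc_le_ReIm _)) => /=.
  rewrite [leRHS]splitr; apply: lerD.
    near: q; apply: (@cvgr_dist_le _ _ _ _ _ (fst : R * R -> R) p.1) => //.
    exact: cvg_fst.
  near: q; apply: (@cvgr_dist_le _ _ _ _ _ (snd : R * R -> R) p.2) => //.
  exact: cvg_snd.
have cK : compact (`[- rho, rho]%classic `*` `[- rho, rho]%classic : set (R * R)).
  by apply: compact_setX; exact: segment_compact.
have := continuous_compact (continuous_subspaceT cf) cK.
set A := [set f x | x in _]; set B := (X in _ -> compact X).
suff -> : A = B by exact.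
apply/seteqP; split=> [_ [[x y] [/= hx hy] <-]|[x y] /= [hx hy]].
  by move: hx hy; rewrite /B /= !in_itv/= -!ler_norml.
by exists (x, y) => //=; rewrite !in_itv/= -!ler_norml.
Unshelve. all: end_near. Qed.

Lemma Y_null_disc (phi : nat -> C -> C) : Y_null phi -> forall rho e : R, 0 < e ->
  \forall j \near \oo, bounded_on_disc (phi j) rho e.
Proof.
move=> [_ phi0] rho e e0; have eC0 : 0 < e%:C :> C by rewrite ltcR.
have := phi0; rewrite fam_cvgP => /(_ _ (@compact_box rho)) H.
have := H [set h : C^o -> C^o | forall y : C^o,
  `|complex.Re y| <= rho /\ `|complex.Im y| <= rho -> ball (0 : C^o) e%:C (h y)].
move=> /(_ _)[|n _ nP].
  apply/uniform_nbhs; exists [set xy : C^o * C^o | ball xy.1 e%:C xy.2].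
  by split => //; exact: (entourage_ball C^o (PosNum eC0)).
exists n => // j /nP /= h z hz.
have := h z; rewrite /ball /= sub0r normrN normc_normr ltcR => /(_ _)/ltW; apply.
by split; [exact: le_trans (Re_le_normc _) hz|exact: le_trans (Im_le_normc _) hz].
Qed.

Lemma damped_null k m (phi : nat -> C -> C) : (forall j, Y_space (phi j)) -> Y_null phi ->
  exists B, [/\ forall j,
      controlled alpha k m B (fun l => complex.Re (damped_conj alpha r (phi j) l)) /\
      controlled alpha k m B (fun l => complex.Im (damped_conj alpha r (phi j) l)) &
    forall p l,
      derive1n p (fun l => complex.Re (damped_conj alpha r (phi j) l)) l @[j --> \oo] --> 0 /\
      derive1n p (fun l => complex.Im (damped_conj alpha r (phi j) l)) l @[j --> \oo] --> 0].
Proof.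
move=> Yphi null; have [[rp [rm [c [rp0 cphi]]]] _] := null.
have [B BP] := @controlled_damped k m rp rm c rp0.
have ephi j : entire (phi j) by case: (Yphi j).
exists B; split=> [j|p l]; first exact: BP.
have key (e : R) : 0 < e -> \forall j \near \oo, nc (iter p T (damped (phi j)) l%:C) <= e.
  move=> e0; pose rho := `|l| + p%:R.
  pose K := 4 ^+ p * expR (r * (rho + `|alpha|)).
  have K0 : 0 < K by rewrite mulr_gt0 ?expR_gt0 ?exprn_gt0.
  have := Y_null_disc null rho (divr_gt0 e0 K0); apply: filterS => j h.
  have h' := damped_bounded (ltW (divr_gt0 e0 K0)) h.
  have sw := circle_smooth_damped (ephi j) (cphi j).
  have := @iter_circle_bounded R _ `|l| _ p sw h' l%:C.
  rewrite normcR lexx => /(_ isT); rewrite mulrA -/K mulrCA divff ?mulr1//.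
  by rewrite gt_eqF.
split; apply/cvgrPdist_le => e e0; have := key e e0; apply: filterS => j h;
  rewrite sub0r normrN; apply: le_trans h;
  have [h1 h2] := damped_conj_derive1n_le p l (circle_smooth_damped (ephi j) (cphi j)) => //.
Qed.

End damped_functions.

Section componentwise_functionals.
Local Open Scope complex_scope.
Variable R : realType.
Local Notation C := R[i].

Lemma cvg_complex0 (x y : nat -> R) :
  x j @[j --> \oo] --> 0 -> y j @[j --> \oo] --> 0 ->
  (fun j => x j +i* y j : C^o) @ \oo --> (0 : C^o).
Proof.
move=> x0 y0; apply/cvgrPdist_le => e e0; have [e0' ->] := ltcR0 e0.
have e20 : 0 < complex.Re e / 2 by rewrite divr_gt0.
near=> j; rewrite sub0r normrN normc_normr lecR (le_trans (normc_le_ReIm _))//=.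
rewrite [leRHS]splitr; apply: lerD; rewrite -normrN -sub0r.
  by near: j; move/cvgrPdist_le : x0; exact.
by near: j; move/cvgrPdist_le : y0; exact.
Unshelve. all: end_near. Qed.

Definition linear_on (Adm : set (R -> R)) (Lam : (R -> R) -> R) :=
  forall (c d : R) u v, Adm u -> Adm v -> Adm (fun t => c * u t + d * v t) /\
    Lam (fun t => c * u t + d * v t) = c * Lam u + d * Lam v.

Definition componentwise (Lam : (R -> R) -> R) (f : R -> C) : C :=
  Lam (fun t => complex.Re (f t)) +i* Lam (fun t => complex.Im (f t)).

Lemma antilinear_componentwise T (X : set (T -> C)) (D : (T -> C) -> R -> C) Adm Lam :
  linear_on Adm Lam ->
  (forall f, X f -> Adm (fun t => complex.Re (D f t)) /\ Adm (fun t => complex.Im (D f t))) ->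
  (forall (a b : C) f g t, D (fun x => a * f x + b * g x) t = conjc a * D f t + conjc b * D g t) ->
  antilinear_on X (fun f => componentwise Lam (D f)).
Proof.
move=> lin XA anti a b f g Xf Xg.
have [fr fi] := XA f Xf; have [gr gi] := XA g Xg.
pose mix (p q p' q' : R) (u v u' v' : R -> R) t :=
  1 * (p * u t + q * v t) + 1 * (p' * u' t + q' * v' t).
have mixE p q p' q' u v u' v' : Adm u -> Adm v -> Adm u' -> Adm v' ->
    Lam (mix p q p' q' u v u' v') = p * Lam u + q * Lam v + (p' * Lam u' + q' * Lam v').
  move=> Au Av Au' Av'.
  have [A1 E1] := lin p q u v Au Av; have [A2 E2] := lin p' q' u' v' Au' Av'.
  by have [_ ->] := lin 1 1 _ _ A1 A2; rewrite E1 E2 !mul1r.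
rewrite /componentwise.
rewrite (_ : (fun t => complex.Re (D (fun x => a * f x + b * g x) t)) =
  mix (complex.Re a) (complex.Im a) (complex.Re b) (complex.Im b)
    (fun t => complex.Re (D f t)) (fun t => complex.Im (D f t))
    (fun t => complex.Re (D g t)) (fun t => complex.Im (D g t))); last first.
  apply/funext => t; rewrite anti cReD !cReM /mix !mul1r.
  by case: a => ? ?; case: b => ? ? /=; rewrite !mulNr !opprK.
rewrite (_ : (fun t => complex.Im (D (fun x => a * f x + b * g x) t)) =
  mix (complex.Re a) (- complex.Im a) (complex.Re b) (- complex.Im b)
    (fun t => complex.Im (D f t)) (fun t => complex.Re (D f t))
    (fun t => complex.Im (D g t)) (fun t => complex.Re (D g t))); last first.
  apply/funext => t; rewrite anti cImD !cImM /mix !mul1r.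
  by case: a => ? ?; case: b => ? ? /=.
rewrite !mixE//.
apply/eqP; rewrite eq_complex !cReD !cImD !cReM !cImM.
by case: a => ? ?; case: b => ? ? /=; apply/andP; split; apply/eqP; ring.
Qed.

Lemma componentwise_cvg0 (Lam : (R -> R) -> R) (f : nat -> R -> C) :
  Lam (fun t => complex.Re (f j t)) @[j --> \oo] --> 0 ->
  Lam (fun t => complex.Im (f j t)) @[j --> \oo] --> 0 ->
  (fun j => componentwise Lam (f j) : C^o) @ \oo --> (0 : C^o).
Proof. exact: cvg_complex0. Qed.

Lemma cRe_sum n (F : 'I_n -> C) : complex.Re (\sum_(i < n) F i) = \sum_(i < n) complex.Re (F i).
Proof. by apply: (big_morph (@complex.Re R)) => // x y; exact: cReD. Qed.

Lemma cIm_sum n (F : 'I_n -> C) : complex.Im (\sum_(i < n) F i) = \sum_(i < n) complex.Im (F i).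
Proof. by apply: (big_morph (@complex.Im R)) => // x y; exact: cImD. Qed.

End componentwise_functionals.

Section sigma_functions.
Local Open Scope complex_scope.
Variable R : realType.
Local Notation C := R[i].
Local Notation nc := (@Normc.normc R).
Local Notation mu := (@lebesgue_measure R).
Variables (alpha r k : R).
Hypothesis r0 : 0 <= r.

Let weight (t : R) : R := (t + r) `^ k * expR (- alpha * t).

Let pairing (u : R -> R) := \int[mu]_(t in `]0, +oo[) (weight t * u t).

Lemma distribution_componentwise :
  distribution_of (fun t : R => (weight t)%:C) =
  fun F => componentwise pairing (fun t => conjc (F t)).
Proof.
apply/funext => F; rewrite /distribution_of /cintegral /componentwise /pairing.
by congr (_ +i* _); apply: eq_Rintegral => t _; rewrite ?cReM ?cImM /= mul0r ?subr0 ?addr0.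
Qed.

Let weight_continuous t : 0 < t -> {for t, continuous weight}.
Proof.
move=> t0; apply: continuousM.
  apply: (@continuous_comp _ _ _ (fun t : R => t + r) (fun x => x `^ k)).
    by apply: cvgD; [exact: cvg_id|exact: cvg_cst].
  by apply: continuous_powR_pos; rewrite ltr_wpDr.
apply: (@continuous_comp _ _ _ (fun t : R => - alpha * t) expR); last exact: continuous_expR.
by apply: cvgM; [exact: cvg_cst|exact: cvg_id].
Qed.

Let tests : set (R -> R) := fun u => exists a b, test_function a b u.

Lemma test_function_subset (a b a' b' : R) (u : R -> R) : test_function a b u ->
  0 < a' -> a' <= a -> b <= b' -> test_function a' b' u.
Proof.
move=> [a0 ab cu su] a'0 a'a bb'; split => //; first by rewrite (le_trans a'a)// (le_trans ab).
move=> t ht; apply: su; apply: contra ht; rewrite !in_itv/= => /andP[h1 h2].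
by rewrite (le_trans a'a)// (le_trans h2).
Qed.

Lemma pairing_linear : linear_on tests pairing.
Proof.
move=> c d u v [a [b tu]] [a' [b' tv]].
have [a0 _ _ _] := tu; have [a'0 _ _ _] := tv.
pose a'' := Num.min a a'; pose b'' := Num.max b b'.
have a''0 : 0 < a'' by rewrite lt_min a0.
have {}tu : test_function a'' b'' u.
  by apply: (test_function_subset tu) => //; rewrite ?ge_min ?le_max lexx.
have {}tv : test_function a'' b'' v.
  by apply: (test_function_subset tv) => //; rewrite ?ge_min ?le_max lexx orbT.
have [_ ab cu su] := tu; have [_ _ cv sv] := tv.
split.
  exists a'', b''; split => //.
    by move=> t; apply: cvgD; apply: cvgM; try exact: cvg_cst; [exact: cu|exact: cv].
  by move=> t ht; rewrite su ?sv// !mulr0 addr0.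
have iu := test_integrable tu weight_continuous.
have iv := test_integrable tv weight_continuous.
have icu : mu.-integrable `]0, +oo[ (EFin \o (fun t => c * (weight t * u t))).
  exact: (@integrableZl _ (measurableTypeR R) _ mu _ _ c _ iu).
have idv : mu.-integrable `]0, +oo[ (EFin \o (fun t => d * (weight t * v t))).
  exact: (@integrableZl _ (measurableTypeR R) _ mu _ _ d _ iv).
rewrite /pairing -RintegralZl// -RintegralZl// -RintegralD//.
by apply: eq_Rintegral => t _; generalize (weight t) => W; ring.
Qed.

Lemma test_space_test_function (F : R -> C) (a b : R) : csmooth F -> 0 < a -> supported_in a b F ->
  test_function a (Num.max a b) (fun t => complex.Re (F t)) /\
  test_function a (Num.max a b) (fun t => complex.Im (F t)).
Proof.
move=> sF a0 supp.
have s t : t \notin `[a, Num.max a b] -> F t = 0.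
  move=> ht; apply: supp; apply: contra ht; rewrite !in_itv/= => /andP[-> h].
  by rewrite le_max h orbT.
have ab : a <= Num.max a b by rewrite le_max lexx.
have [c1 c2] : continuous (fun t => complex.Re (F t)) /\ continuous (fun t => complex.Im (F t)).
  split=> t; apply: differentiable_continuous; rewrite -derivable1_diffP.
    by have [h _] := sF 0%N t.
  by have [_ h] := sF 0%N t.
by split; split => // t /s ->.
Qed.

Lemma test_functionN (a b : R) (u : R -> R) : test_function a b u ->
  test_function a b (fun t => - u t).
Proof.
move=> [a0 ab cu su]; split => //; last by move=> t /su ->; rewrite oppr0.
by move=> t; apply: cvgN; exact: cu.
Qed.

Lemma conj_test_function (F : R -> C) (a b : R) : csmooth F -> 0 < a -> supported_in a b F ->
  test_function a (Num.max a b) (fun t => complex.Re (conjc (F t))) /\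
  test_function a (Num.max a b) (fun t => complex.Im (conjc (F t))).
Proof.
move=> sF a0 supp; have [h1 h2] := test_space_test_function sF a0 supp.
split.
  rewrite (_ : (fun t => complex.Re _) = (fun t => complex.Re (F t)))//.
  by apply/funext => t; case: (F t).
rewrite (_ : (fun t => complex.Im _) = (fun t => - complex.Im (F t))); first exact: test_functionN.
by apply/funext => t; case: (F t).
Qed.

Lemma conj_lin (T : Type) (a b : C) (f g : T -> C) t :
  conjc (a * f t + b * g t) = conjc a * conjc (f t) + conjc b * conjc (g t).
Proof. by rewrite rmorphD !rmorphM. Qed.

Lemma pairing_le (a b e : R) (u : R -> R) : test_function a b u -> (forall t, `|u t| <= e) ->
  `|pairing u| <= e * \int[mu]_(t in `[a, b]) `|weight t|.
Proof.
move=> tu ue; have [a0 ab cu su] := tu.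
have sub : (`[a, b]%classic : set R) `<=` `]0, +oo[%classic.
  by move=> t; rewrite /= !in_itv/= andbT => /andP[h _]; exact: lt_le_trans h.
have E : pairing u = \int[mu]_(t in `[a, b]) (weight t * u t).
  rewrite /pairing Rintegral_mkcond [RHS]Rintegral_mkcond; congr Rintegral.
  apply/funext => t; rewrite !patchE.
  case: ifPn => [t0|t0].
    case: ifPn => //; rewrite notin_setE/= => /negP h.
    by rewrite su ?mulr0.
  case: ifPn => //; rewrite inE => /sub h.
  by move: t0; rewrite notin_setE.
have iw : mu.-integrable `[a, b] (EFin \o (fun t => `|weight t|)).
  apply: continuous_compact_integrable; first exact: segment_compact.
  apply: continuous_in_subspaceT => t; rewrite inE => /sub; rewrite /= in_itv/= andbT => t0.
  by apply: continuous_comp; [exact: weight_continuous|exact: norm_continuous].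
have iwu : mu.-integrable `[a, b] (EFin \o (fun t => weight t * u t)).
  by apply: integrableS (test_integrable tu weight_continuous).
rewrite E (le_trans (le_normr_Rintegral _ iwu))// -RintegralZl//.
apply: le_Rintegral => //.
- by have := integrable_abse iwu; apply: eq_integrable.
- exact: (@integrableZl _ (measurableTypeR R) _ mu _ _ e _ iw).
- by move=> t _; rewrite normrM mulrC ler_wpM2r.
Qed.

Lemma distribution_test_dual : test_dual (distribution_of (fun t : R => (weight t)%:C)).
Proof.
rewrite distribution_componentwise; split.
  apply: (antilinear_componentwise pairing_linear) => [F [sF [a [b [a0 supp]]]]|a b f g t].
    have [h1 h2] := conj_test_function sF a0 supp.
    by split; exists a, (Num.max a b).
  exact: conj_lin.
move=> F XF [[a [b [a0 supp]]] null].
have tF j := conj_test_function (XF j).1 a0 (supp j).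
pose I := \int[mu]_(t in `[a, Num.max a b]) `|weight t|.
have I0 : 0 <= I by apply: Rintegral_ge0.
have key (u : nat -> R -> R) : (forall j, test_function a (Num.max a b) (u j)) ->
    (forall j t, `|u j t| <= nc (F j t)) -> pairing (u j) @[j --> \oo] --> 0.
  move=> tu uF; apply/cvgrPdist_le => e e0.
  have I1 : 0 < I + 1 by rewrite ltr_wpDl.
  have := null 0%N (e / (I + 1)) (divr_gt0 e0 I1); apply: filterS => j h.
  rewrite sub0r normrN.
  have ue t : `|u j t| <= e / (I + 1).
    apply: (le_trans (uF j t)); have /ltW := h t.
    by rewrite /cderive /=; case: (F j t).
  apply: (le_trans (pairing_le (tu j) ue)); rewrite -/I.
  by rewrite mulrAC ler_pdivrMr// ler_wpM2l ?(ltW e0)// lerDl.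
have ncJ z : nc (conjc z) = nc z by case: z => x y /=; rewrite sqrrN.
apply: (@componentwise_cvg0 _ pairing (fun j t => conjc (F j t))); apply: key.
- by move=> j; case: (tF j).
- by move=> j t; rewrite -ncJ Re_le_normc.
- by move=> j; case: (tF j).
- by move=> j t; rewrite -ncJ Im_le_normc.
Qed.

End sigma_functions.

Section sigma_dual.
Local Open Scope complex_scope.
Variable R : realType.
Local Notation C := R[i].
Local Notation mu := (@lebesgue_measure R).
Variables (alpha r k : R).
Hypothesis r0 : 0 <= r.

Definition delta_functional m (u : R -> R) : R := (-1) ^+ m * derive1n m u alpha.

Definition power_functional (u : R -> R) : R :=
  (Gamma (- k))^-1 * regular_functional alpha k (taylor_terms k) u.

Lemma sigma_delta_componentwise m :
  sigma_delta alpha r m = fun w => componentwise (delta_functional m) (damped_conj alpha r w).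
Proof.
apply/funext => w; rewrite /sigma_delta /delta_derivative /componentwise /delta_functional.
have -> : (-1) ^+ m = ((-1) ^+ m)%:C :> C.
  by rewrite (rmorphXn (real_complex R)) rmorphN1.
by apply/eqP; rewrite eq_complex cReM cImM /= !mul0r subr0 addr0 !eqxx.
Qed.

Lemma real_complexV_nat n : (n%:R)^-1 = ((n%:R)^-1)%:C :> C.
Proof. by rewrite (fmorphV (real_complex R)) rmorph_nat. Qed.

Lemma sigma_power_componentwise :
  sigma_power alpha r k = fun w => componentwise power_functional (damped_conj alpha r w).
Proof.
apply/funext => w; rewrite /sigma_power /power_plus /cintegral /componentwise /power_functional.
set om := damped_conj alpha r w.
have ReE l : complex.Re (((l - alpha) `^ (- k - 1))%:C * (om l - \sum_(p < taylor_terms k)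
    (p`!%:R)^-1 * cderive p om alpha * ((l - alpha) ^+ p)%:C)) =
    regular_integrand alpha k (taylor_terms k) (fun t => complex.Re (om t)) l.
  rewrite cReM /= mul0r subr0 /regular_integrand; congr (_ * _).
  rewrite cReB cRe_sum; congr (_ - _); apply: eq_bigr => p _.
  by rewrite real_complexV_nat !cReM cImM /= !mul0r !mulr0 !subr0.
have ImE l : complex.Im (((l - alpha) `^ (- k - 1))%:C * (om l - \sum_(p < taylor_terms k)
    (p`!%:R)^-1 * cderive p om alpha * ((l - alpha) ^+ p)%:C)) =
    regular_integrand alpha k (taylor_terms k) (fun t => complex.Im (om t)) l.
  rewrite cImM /= mul0r addr0 /regular_integrand; congr (_ * _).
  rewrite cImB cIm_sum; congr (_ - _); apply: eq_bigr => p _.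
  by rewrite real_complexV_nat !cImM !cReM /= !mul0r !mulr0 !addr0 add0r.
under eq_Rintegral do rewrite ReE.
under [X in _ * (_ +i* X) = _]eq_Rintegral do rewrite ImE.
by apply/eqP; rewrite eq_complex cReM cImM /= !mul0r subr0 addr0 !eqxx.
Qed.

Lemma damped_conj_antilinear (a b : C) (f g : C -> C) l :
  damped_conj alpha r (fun x => a * f x + b * g x) l =
  conjc a * damped_conj alpha r f l + conjc b * damped_conj alpha r g l.
Proof.
rewrite /damped_conj rmorphD !rmorphM mulrDr.
by congr (_ + _); rewrite mulrCA.
Qed.

Lemma delta_functional_linear m : linear_on (@smooth R) (delta_functional m).
Proof.
move=> c d u v su sv; split; first exact: smooth_lin.
by rewrite /delta_functional derive1n_lin//; ring.
Qed.

Lemma controlled_lin m B B' (u v : R -> R) (c d : R) :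
  controlled alpha k m B u -> controlled alpha k m B' v ->
  controlled alpha k m (`|c| * B + `|d| * B') (fun t => c * u t + d * v t).
Proof.
move=> [su u1 u2] [sv v1 v2]; split; first exact: smooth_lin.
  move=> p t pm ht; rewrite derive1n_lin// (le_trans (ler_normD _ _))// !normrM.
  by rewrite lerD// ler_wpM2l// ?u1 ?v1.
move=> t ht; rewrite (le_trans (ler_normD _ _))// !normrM mulrDl -!mulrA.
by rewrite lerD// ler_wpM2l// ?u2 ?v2.
Qed.

Lemma power_functional_linear : regular_order (taylor_terms k) k ->
  linear_on (fun u => exists B, controlled alpha k (taylor_terms k) B u) power_functional.
Proof.
move=> mk c d u v [B uB] [B' vB]; split.
  by exists (`|c| * B + `|d| * B'); exact: controlled_lin.
rewrite /power_functional (regular_functional_lin mk c d uB vB).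
by generalize (regular_functional alpha k (taylor_terms k) u)
  (regular_functional alpha k (taylor_terms k) v) ((Gamma (- k))^-1) => x y z; ring.
Qed.

Lemma sigma_delta_Y_dual m : Y_dual (sigma_delta alpha r m).
Proof.
rewrite sigma_delta_componentwise; split.
  apply: (antilinear_componentwise (delta_functional_linear m)); last exact: damped_conj_antilinear.
  move=> w [ew [rp [rm [c [rp0 wY]]]]].
  exact: damped_conj_smooth (circle_smooth_damped alpha r0 ew wY).
move=> phi Yphi null; have [B [_ h]] := @damped_null R alpha r r0 0 0 phi Yphi null.
have [h1 h2] := h m alpha.
apply: (@componentwise_cvg0 _ (delta_functional m) (fun j => damped_conj alpha r (phi j)));
  rewrite -[X in _ --> X](mulr0 ((-1) ^+ m)); apply: cvgMr; [exact: h1|exact: h2].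
Qed.

Lemma sigma_power_Y_dual : regular_order (taylor_terms k) k -> Y_dual (sigma_power alpha r k).
Proof.
move=> mk; rewrite sigma_power_componentwise; split.
  apply: (antilinear_componentwise (power_functional_linear mk)); last exact: damped_conj_antilinear.
  move=> w [ew [rp [rm [c [rp0 wY]]]]].
  have [B BP] := @controlled_damped R alpha r r0 k (taylor_terms k) rp rm c rp0.
  by have [h1 h2] := BP w ew wY; split; exists B.
move=> phi Yphi null; have [B [hB h]] := damped_null alpha r0 k (taylor_terms k) Yphi null.
apply: (@componentwise_cvg0 _ power_functional (fun j => damped_conj alpha r (phi j)));
  rewrite -[X in _ --> X](mulr0 ((Gamma (- k))^-1)); apply: cvgMr.
  apply: (regular_functional_cvg0 mk (B := B)) => [j|p _|l _].
  - by case: (hB j).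
  - by case: (h p alpha).
  - by case: (h 0%N l).
apply: (regular_functional_cvg0 mk (B := B)) => [j|p _|l _].
- by case: (hB j).
- by case: (h p alpha).
- by case: (h 0%N l).
Qed.

Lemma damped_conj_laplace (F : R -> C) : test_space F ->
  exists a b, exists gr gi : R -> R, [/\ test_function a b gr, test_function a b gi,
    forall t, gr t = complex.Re (conjc (F t)) /\ gi t = complex.Im (conjc (F t)),
    (fun l => complex.Re (damped_conj alpha r (laplace F) l)) =
      exp_transform r alpha (fun t => expR (- alpha * t) * gr t) &
    (fun l => complex.Im (damped_conj alpha r (laplace F) l)) =
      exp_transform r alpha (fun t => expR (- alpha * t) * gi t)].
Proof.
move=> [sF [a [b [a0 supp]]]]; have [h1 h2] := conj_test_function sF a0 supp.
exists a, (Num.max a b), (fun t => complex.Re (conjc (F t))), (fun t => complex.Im (conjc (F t))).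
have ce (l : R) : continuous (fun t : R => expR (- t * l)).
  move=> t; apply: (@continuous_comp _ _ _ (fun t : R => - t * l) expR); last exact: continuous_expR.
  by apply: cvgM; [apply: cvgN; exact: cvg_id|exact: cvg_cst].
have key (g : R -> R) l : test_function a (Num.max a b) g ->
    exp_transform r alpha (fun t => expR (- alpha * t) * g t) l =
    expR (- r * (l - alpha)) * \int[mu]_(t in `]0, +oo[) (expR (- t * l) * g t).
  move=> tg; rewrite -RintegralZl.
  - apply: eq_Rintegral => t _; rewrite !mulrA -!expRD; congr (expR _ * _); ring.
  - exact: measurable_itv.
  - by apply: (test_integrable tg) => t _; exact: ce.
have cE (t l : R) : cexp (- t%:C * l%:C) = (expR (- t * l))%:C.
  by rewrite -cexpR; congr cexp; apply/eqP; rewrite eq_complex /=; apply/andP; split; apply/eqP; ring.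
split => //; apply/funext => l; rewrite key// /damped_conj /laplace /cintegral.
  rewrite cReM /= mul0r subr0; congr (_ * _); apply: eq_Rintegral => t _.
  by rewrite cE cReM /= mul0r subr0; case: (F t).
rewrite cImM /= mul0r addr0; congr (_ * _).
rewrite -mulN1r -RintegralZl//.
  apply: eq_Rintegral => t _.
  by rewrite cE cImM /= mul0r addr0 mulN1r -mulrN; case: (F t).
have := test_integrable (test_functionN h2) (fun t _ => ce l t).
apply: eq_integrable => // t _; rewrite /= cE cImM /= mul0r addr0.
by case: (F t) => x y /=; rewrite opprK.
Qed.

Lemma delta_exp_transform (a b : R) (g : R -> R) m : k = m%:R -> test_function a b g ->
  delta_functional m (exp_transform r alpha (fun t => expR (- alpha * t) * g t)) =
  \int[mu]_(t in `]0, +oo[) ((t + r) `^ k * expR (- alpha * t) * g t).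
Proof.
move=> km tg.
have ce : continuous (fun t : R => expR (- alpha * t)).
  move=> t; apply: (@continuous_comp _ _ _ (fun t : R => - alpha * t) expR); last exact: continuous_expR.
  by apply: cvgM; [exact: cvg_cst|exact: cvg_id].
have tg' := test_functionM ce tg.
rewrite /delta_functional (derive1n_exp_transform _ _ r0 tg') exp_transform_at.
rewrite -RintegralZl//; last first.
  apply: (test_integrable tg') => t _.
  apply: (@continuous_comp _ _ _ (fun t => - (t + r)) (fun x => x ^+ m)).
    exact: continuous_opp_shift.
  exact: exprn_continuous.
apply: eq_Rintegral => t; rewrite inE/= in_itv/= andbT => t0.
rewrite km powR_mulrn ?addr_ge0 ?(ltW t0)// !mulrA; congr (_ * _ * _).
by rewrite -exprMn mulN1r opprK.
Qed.

Lemma power_exp_transform (a b : R) (g : R -> R) : ~ (exists m : nat, k = m%:R) ->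
  test_function a b g ->
  power_functional (exp_transform r alpha (fun t => expR (- alpha * t) * g t)) =
  \int[mu]_(t in `]0, +oo[) ((t + r) `^ k * expR (- alpha * t) * g t).
Proof.
move=> kN tg; have mk := taylor_terms_regular kN.
have [gG G0] := gamma_reg_Gamma kN.
have ce : continuous (fun t : R => expR (- alpha * t)).
  move=> t; apply: (@continuous_comp _ _ _ (fun t : R => - alpha * t) expR); last exact: continuous_expR.
  by apply: cvgM; [exact: cvg_cst|exact: cvg_id].
have tg' := test_functionM ce tg.
rewrite /power_functional /regular_functional.
rewrite (_ : \int[mu]_(l in `]alpha, +oo[) _ = \int[mu]_(l in `]alpha, +oo[)
  ((l - alpha) `^ (- k - 1) * \int[mu]_(t in `]0, +oo[)
    (exp_rem (taylor_terms k) ((t + r) * (l - alpha)) * (expR (- alpha * t) * g t)))); last first.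
  by apply: eq_Rintegral => l _; rewrite /regular_integrand -(exp_transform_remainder _ _ _ r0 tg').
rewrite (power_pairing _ r0 mk tg') gG mulrA mulVf// mul1r.
by apply: eq_Rintegral => t _; rewrite mulrA.
Qed.

End sigma_dual.

Local Open Scope complex_scope.

Theorem lemma6p2 (R : realType) (alpha r k : R) (hr : 0 <= r) :
  let h := distribution_of
    (fun t : R => ((t + r) `^ k * expR (- alpha * t))%:C) in
  (~ (exists m : nat, k = m%:R) ->
     is_sigma_function h (sigma_power alpha r k)) /\
  (forall m : nat, k = m%:R ->
     is_sigma_function h (sigma_delta alpha r m)).
Proof.
move=> h; have td : test_dual h by exact: distribution_test_dual.
split=> [kN|m km].
  split => //; first exact: sigma_power_Y_dual (taylor_terms_regular kN).
  move=> F XF; rewrite /laplace_adjoint sigma_power_componentwise /h distribution_componentwise.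
  have [a [b [gr [gi [tr ti gE Er Ei]]]]] := damped_conj_laplace alpha r XF.
  rewrite /componentwise Er Ei (power_exp_transform alpha hr kN tr)// (power_exp_transform alpha hr kN ti)//.
  by congr (_ +i* _); apply: eq_Rintegral => t _; have [Gr Gi] := gE t; rewrite ?Gr ?Gi.
split => //; first exact: sigma_delta_Y_dual.
move=> F XF; rewrite /laplace_adjoint sigma_delta_componentwise /h distribution_componentwise.
have [a [b [gr [gi [tr ti gE Er Ei]]]]] := damped_conj_laplace alpha r XF.
rewrite /componentwise Er Ei (delta_exp_transform alpha hr km tr)// (delta_exp_transform alpha hr km ti)//.
by congr (_ +i* _); apply: eq_Rintegral => t _; have [Gr Gi] := gE t; rewrite ?Gr ?Gi.
Qed.
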